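(* For every $n,d\in\mathbb N$, $$\boldsymbol\lambda\bigl(\mathcal P_d(\mathcal L(\ell_2^n))\bigr)=\int_{\mathcal U_n}\Bigg|\sum_{\mu\vdash d}\frac{n^{\ell(\mu)}}{z_\mu}\prod_{j=1}^{\ell(\mu)}\operatorname{tr}\bigl(g^{\mu_j}\bigr)\Bigg|\,d\mu_{\mathcal U_n}(g).$$ Moreover, for fixed $d$, $$\lim_{n\to\infty}\frac{\boldsymbol\lambda\bigl(\mathcal P_d(\mathcal L(\ell_2^n))\bigr)}{\sqrt{\binom{n^2+d-1}{d}}}=\frac{\Gamma\left(1+\frac d2\right)}{\sqrt{d!}}.$$ Equivalently, $$\lim_{n\to\infty}\frac{\boldsymbol\lambda\bigl(\mathcal P_d(\mathcal L(\ell_2^n))\bigr)}{n^d}=\frac{\Gamma\left(1+\frac d2\right)}{d!}.$$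
   Context: Complex scalars. $\ell_2^n=\ell_2^n(\mathbb C)$ is the $n$-dimensional complex Hilbert space, $\mathcal L(\ell_2^n)$ the space of linear operators on it with the operator norm. $\mathcal P_d(\mathcal L(\ell_2^n))$ is the complex Banach space of all complex $d$-homogeneous (holomorphic) polynomials on $\mathcal L(\ell_2^n)$ with the supremum norm on the closed operator-norm unit ball. $\mathcal U_n$ is the unitary group with normalized Haar measure $\mu_{\mathcal U_n}$. A partition $\mu\vdash d$ is a non-increasing sequence $\mu_1\ge\mu_2\ge\cdots$ of non-negative integers with sum $d$; $\ell(\mu)$ is its number of non-zero parts; $m_r(\mu)$ is the number of parts equal to $r$; $z_\mu=\prod_{r\ge1}r^{m_r(\mu)}m_r(\mu)!$. Projection constants: for a subspace $X$ of a Banach space $Y$, $\boldsymbol\lambda(X,Y)=\inf\{\|P\|: P\in\mathcal L(Y),\ P^2=P,\ P(Y)=X\}$; $\boldsymbol\lambda(X)=\sup_Y\boldsymbol\lambda(X,Y)$ over all Banach spaces $Y$ containing $X$ isometrically. *)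

(* Defs.v *)
From HB Require Import structures.
From mathcomp Require Import all_boot all_order all_algebra.
From mathcomp Require Import complex.
From mathcomp Require Import all_classical all_reals all_analysis.
Set Implicit Arguments.
Unset Strict Implicit.
Unset Printing Implicit Defensive.
Import Order.TTheory GRing.Theory Num.Theory.
Import numFieldNormedType.Exports.
Local Open Scope classical_set_scope.
Local Open Scope ring_scope.

(* Naming the structure, rather than writing R[i], selects the topology and the
   norm that every numClosedFieldType carries; the norm takes values in Cplx R
   itself, whence rnorm below. *)
Definition Cplx (R : realType) : numClosedFieldType := R[i].

Definition rnorm (R : realType) (Y : normedZmodType (Cplx R)) (y : Y) : R :=
  complex.Re `|y|.

Definition opnorm (R : realType) (V W : Type) (NV : V -> R) (NW : W -> R)
    (f : V -> W) : \bar R :=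
  ereal_sup [set (NW (f x))%:E | x in [set x | NV x <= 1]].

Definition rel_proj_const (R : realType) (Y : completeNormedModType (Cplx R))
    (X : set Y) : \bar R :=
  ereal_inf [set opnorm (@rnorm R Y) (@rnorm R Y) P | P in
    [set P : {linear Y -> Y} |
       [/\ continuous P, forall y, P (P y) = P y & range P = X]]].

Definition proj_const (R : realType) (X : normedModType (Cplx R)) : \bar R :=
  ereal_sup [set r |
    exists (Y : completeNormedModType (Cplx R)) (j : {linear X -> Y}),
      (forall x, `|j x| = `|x|) /\ r = rel_proj_const (range j)].

Definition l2norm (R : realType) (n : nat) (v : 'cV[Cplx R]_n) : R :=
  Num.sqrt (\sum_i rnorm (v i 0) ^+ 2).

Definition op_ball (R : realType) (n : nat) : set 'M[Cplx R]_n :=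
  [set A | (opnorm (@l2norm R n) (@l2norm R n) (mulmx A) <= 1)%E].

Definition upd (d : nat) (T : Type) (x : 'I_d -> T) (i : 'I_d) (t : T) :
    'I_d -> T :=
  fun k => if k == i then t else x k.

Definition multilinear_form (K : pzRingType) (V : lmodType K) (d : nat)
    (phi : ('I_d -> V) -> K) : Prop :=
  forall (x : 'I_d -> V) (i : 'I_d) (a : K) (u v : V),
    phi (upd x i (a *: u + v)) = a * phi (upd x i u) + phi (upd x i v).

(* No boundedness of phi is required: this is used on the finite-dimensional
   space of matrices only, where it is automatic. *)
Definition is_hpoly (K : pzRingType) (V : lmodType K) (d : nat) (p : V -> K) :
    Prop :=
  exists2 phi : ('I_d -> V) -> K,
    multilinear_form phi & forall x, p x = phi (fun=> x).

Definition hpoly_pred (R : realType) (d n : nat) :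
    {pred 'M[Cplx R]_n -> (Cplx R)^o} :=
  fun p => `[< is_hpoly d p >].

Section HPoly.
Variables (R : realType) (d n : nat).
Local Notation C := (Cplx R).

Lemma hpoly_closed : subsemimod_closed (@hpoly_pred R d n).
Proof.
split; first split.
- apply/asboolP; exists (fun=> 0) => // x i a u v.
  by rewrite mulr0 addr0.
- move=> p q /asboolP[f fL fE] /asboolP[g gL gE]; apply/asboolP.
  exists (fun x => f x + g x) => [x i a u v|x].
    by rewrite fL gL mulrDr addrACA.
  by rewrite -fE -gE.
- move=> c p /asboolP[f fL fE]; apply/asboolP.
  exists (fun x => c * f x) => [x i a u v|x].
    by rewrite fL mulrDr mulrCA.
  by rewrite -fE.
Qed.

HB.instance Definition _ :=
  GRing.isSubSemiModClosed.Build C ('M[C]_n -> C^o) (@hpoly_pred R d n)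
    hpoly_closed.

Record hpoly := HPoly {
  hpoly_fun :> 'M[C]_n -> C^o;
  hpolyP : hpoly_fun \in @hpoly_pred R d n }.

HB.instance Definition _ := [isSub for hpoly_fun].
HB.instance Definition _ := [Choice of hpoly by <:].
HB.instance Definition _ := [SubChoice_isSubLmodule of hpoly by <:].

Definition hpoly_norm (p : hpoly) : R :=
  sup [set rnorm (p A : C) | A in @op_ball R n].
End HPoly.

Definition RtoC (R : realType) (x : R) : Cplx R := x%:C%C.

Section RtoC.
Variable R : realType.
Implicit Types x y : R.

Lemma RtoC_le x y : (RtoC x <= RtoC y) = (x <= y).
Proof. exact: lecR. Qed.

Lemma RtoCD x y : RtoC (x + y) = RtoC x + RtoC y.
Proof. exact: (rmorphD (real_complex R)). Qed.

Lemma RtoCM x y : RtoC (x * y) = RtoC x * RtoC y.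
Proof. exact: (rmorphM (real_complex R)). Qed.

Lemma RtoC_inj : injective (@RtoC R).
Proof. exact: complexI. Qed.

End RtoC.

Section RNorm.
Variables (R : realType) (Y : normedZmodType (Cplx R)).

Lemma rnormE (y : Y) : RtoC (rnorm y) = `|y|.
Proof. exact: (RRe_real (normr_real y)). Qed.

Lemma rnorm_ge0 (y : Y) : 0 <= rnorm y.
Proof. by rewrite -RtoC_le rnormE; exact: normr_ge0. Qed.

Lemma rnormD (x y : Y) : rnorm (x + y) <= rnorm x + rnorm y.
Proof.
rewrite -RtoC_le RtoCD !rnormE; exact: (@ler_normD (Cplx R)).
Qed.

Lemma rnorm0 : rnorm (0 : Y) = 0.
Proof. by rewrite /rnorm normr0. Qed.

Lemma rnorm_eq0 (y : Y) : rnorm y = 0 -> y = 0.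
Proof. by move=> y0; apply/eqP; rewrite -normr_eq0 -rnormE y0. Qed.

Lemma rnorm_sum (I : Type) (r : seq I) (P : pred I) (F : I -> Y) :
  rnorm (\sum_(i <- r | P i) F i) <= \sum_(i <- r | P i) rnorm (F i).
Proof.
elim/big_rec2 : _ => [|i y x _ xy]; first by rewrite rnorm0.
by rewrite (le_trans (rnormD _ _))// lerD2l.
Qed.

End RNorm.

Lemma rnormM (R : realType) (a b : Cplx R) : rnorm (a * b) = rnorm a * rnorm b.
Proof. by apply: RtoC_inj; rewrite RtoCM !rnormE normrM. Qed.

Lemma rnorm_real (R : realType) (t : R) : 0 <= t -> rnorm (RtoC t) = t.
Proof.
move=> t0; apply: RtoC_inj; rewrite rnormE ger0_norm//.
by rewrite -RtoC_le in t0.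
Qed.

Section Multilinear.
Variables (K : pzRingType) (V : lmodType K) (d : nat).
Variables (phi : ('I_d -> V) -> K) (phiL : multilinear_form phi).

Lemma multilinear0 x i : phi (upd x i 0) = 0.
Proof.
have := phiL x i 1 0 0; rewrite scaler0 addr0 mul1r.
by rewrite -{1}[phi _]addr0 => /addrI.
Qed.

Lemma multilinear_sum x i (I : finType) (c : I -> K) (w : I -> V) :
  phi (upd x i (\sum_e c e *: w e)) = \sum_e c e * phi (upd x i (w e)).
Proof.
elim/big_rec2 : _ => [|e y z _ <-]; first exact: multilinear0.
exact: phiL.
Qed.

Lemma upd_id T (x : 'I_d -> T) i : upd x i (x i) = x.
Proof. by apply/funext => k; rewrite /upd; case: eqP => // ->. Qed.

End Multilinear.

Lemma multilinearZ (K : comPzRingType) (V : lmodType K) (d : nat)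
    (phi : ('I_d -> V) -> K) (a : K) (v : V) :
  multilinear_form phi ->
  phi (fun=> a *: v) = a ^+ d * phi (fun=> v).
Proof.
move=> phiL.
suff /(_ d (leqnn d)) : forall m, (m <= d)%N ->
    phi (fun k : 'I_d => if (k < m)%N then a *: v else v) =
    a ^+ m * phi (fun=> v).
  by move=> <-; congr phi; apply/funext => k; rewrite ltn_ord.
elim=> [_|m IHm md]; first by rewrite mul1r; congr phi; apply/funext.
rewrite exprS -mulrA -(IHm (ltnW md)).
pose x := (fun k : 'I_d => if (k < m)%N then a *: v else v).
have xE : x = upd x (Ordinal md) v.
  apply/funext => k; rewrite /x /upd -val_eqE/=.
  by case: ltngtP.
rewrite -/x [in RHS]xE -[RHS]addr0 -(multilinear0 phiL x (Ordinal md)) -phiL.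
congr phi; apply/funext => k; rewrite /x /upd -val_eqE/= addr0 ltnS.
by case: ltngtP.
Qed.

Section HPolyNorm.
Variables (R : realType) (d n : nat).
Local Notation C := (Cplx R).

Lemma multilinear_bounded (phi : ('I_d -> 'M[C]_n) -> C) :
  multilinear_form phi ->
  exists M : R, forall x : 'I_d -> 'M[C]_n,
    (forall k i j, rnorm (x k i j) <= 1) ->
    rnorm (phi x) <= M.
Proof.
move=> phiL.
suff /(_ d)[M HM] : forall m, exists M : R, forall x : 'I_d -> 'M[C]_n,
    (forall k i j, rnorm (x k i j) <= 1) ->
    (forall k : 'I_d, (m <= k)%N ->
       exists e : 'I_n * 'I_n, x k = delta_mx e.1 e.2) -> rnorm (phi x) <= M.
  by exists M => x x1; apply: HM => // k; rewrite leqNgt ltn_ord.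
elim=> [|m [M IHM]].
  exists (\sum_(f : {ffun 'I_d -> 'I_n * 'I_n})
    rnorm (phi (fun k => delta_mx (f k).1 (f k).2))) => x _ xd.
  have /choice[f fx] : forall k : 'I_d,
      exists e : 'I_n * 'I_n, x k = delta_mx e.1 e.2 by move=> k; exact: xd.
  rewrite (bigD1 [ffun k => f k])//=.
  have -> : phi (fun k => delta_mx ([ffun k => f k] k).1 ([ffun k => f k] k).2)
      = phi x by congr phi; apply/funext => k; rewrite ffunE fx.
  by rewrite lerDl sumr_ge0// => g _; exact: rnorm_ge0.
have [md|dm] := ltnP m d; last first.
  exists M => x x1 xd; apply: IHM => // k mk.
  by have := leq_trans dm mk; rewrite leqNgt ltn_ord.
exists (\sum_(e : 'I_n * 'I_n) M) => x x1 xd.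
pose k0 := Ordinal md.
have -> : phi x = \sum_(e : 'I_n * 'I_n)
    x k0 e.1 e.2 * phi (upd x k0 (delta_mx e.1 e.2)).
  rewrite -(multilinear_sum phiL) -[in LHS](upd_id x k0).
  by rewrite [in LHS](matrix_sum_delta (x k0)) pair_bigA.
apply: le_trans (rnorm_sum _ _ _) _; apply: ler_sum => e _.
rewrite rnormM -[leRHS]mul1r ler_pM ?rnorm_ge0//; apply: IHM => [k i j|k mk].
- rewrite /upd; case: eqP => _; last exact: x1.
  rewrite mxE; case: (_ && _); last by rewrite rnorm0 ler01.
  by rewrite /rnorm normr1.
- rewrite /upd; case: eqP => [_|/eqP kk0]; first by exists e.
  apply: xd; rewrite ltn_neqAle mk andbT.
  by rewrite -val_eqE/= eq_sym in kk0.
Qed.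

Lemma l2norm_coord (v : 'cV[C]_n) i : rnorm (v i 0) <= l2norm v.
Proof.
rewrite -[leLHS]ger0_norm ?rnorm_ge0// -sqrtr_sqr ler_wsqrtr//.
by rewrite (bigD1 i)//= lerDl sumr_ge0// => j _; rewrite sqr_ge0.
Qed.

Lemma op_ball_coord (A : 'M[C]_n) i j : op_ball A -> rnorm (A i j) <= 1.
Proof.
move=> /= A1; pose e : 'cV[C]_n := delta_mx j 0.
have e1 : l2norm e <= 1.
  rewrite /l2norm (bigD1 j)//= big1 ?addr0.
    by rewrite mxE !eqxx /rnorm normr1 expr1n sqrtr1.
  by move=> k kj; rewrite mxE (negbTE kj) rnorm0 expr0n.
have : ((l2norm (A *m e))%:E <= 1)%E.
  by apply: le_trans A1; apply: ereal_sup_ubound; exists e.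
rewrite lee_fin; apply: le_trans.
by apply: le_trans (l2norm_coord _ i); rewrite -colE mxE.
Qed.

Lemma op_ball0 : op_ball (0 : 'M[C]_n).
Proof.
apply: ge_ereal_sup => _ [v _ <-]; rewrite lee_fin mul0mx /l2norm big1.
  by rewrite sqrtr0 ler01.
by move=> i _; rewrite mxE rnorm0 expr0n.
Qed.

Lemma op_ball_absorbing (A : 'M[C]_n) :
  exists2 t : R, 0 < t & op_ball (RtoC t *: A).
Proof.
pose s := \sum_i \sum_j rnorm (A i j).
have s0 : 0 <= s.
  by apply: sumr_ge0 => i _; apply: sumr_ge0 => j _; exact: rnorm_ge0.
pose K := Num.sqrt (s ^+ 2 *+ n) + 1.
have K0 : 0 < K by rewrite ltr_wpDl// sqrtr_ge0.
have t0 : 0 < K^-1 by rewrite invr_gt0.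
exists K^-1 => //; apply: ge_ereal_sup => _ [v v1 <-].
rewrite lee_fin -scalemxAl.
have -> : l2norm (RtoC K^-1 *: (A *m v)) = K^-1 * l2norm (A *m v).
  rewrite /l2norm -[X in _ = X * _](ger0_norm (ltW t0)) -sqrtr_sqr.
  rewrite -sqrtrM ?sqr_ge0//.
  rewrite mulr_sumr; congr Num.sqrt; apply: eq_bigr => i _.
  by rewrite mxE rnormM exprMn rnorm_real// ltW.
rewrite ler_pdivrMl// mulr1 /K ler_wpDr// /l2norm ler_wsqrtr//.
rewrite -[leRHS](_ : \sum_(i < n) s ^+ 2 = _); last first.
  by rewrite sumr_const card_ord.
apply: ler_sum => i _; rewrite lerXn2r ?nnegrE ?rnorm_ge0// mxE.
apply: le_trans (rnorm_sum _ _ _) _.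
rewrite /s [leRHS](bigD1 i)//= ler_wpDr//.
  by apply: sumr_ge0 => k _; apply: sumr_ge0 => j _; exact: rnorm_ge0.
apply: ler_sum => j _; rewrite rnormM -[leRHS]mulr1.
by rewrite ler_pM ?rnorm_ge0// (le_trans (l2norm_coord _ _)).
Qed.

Implicit Types p q : hpoly R d n.
Local Notation vals p := [set rnorm (p A : C) | A in @op_ball R n].

Lemma hpoly_has_sup p : has_sup (vals p).
Proof.
split; first by exists (rnorm (p 0 : C)); exists 0 => //; exact: op_ball0.
have /asboolP[phi phiL pE] := hpolyP p.
have [M HM] := multilinear_bounded phiL.
exists M => _ [A A1 <-]; rewrite pE; apply: HM => k i j.
exact: op_ball_coord.
Qed.

Lemma hpoly_norm_ub p A : op_ball A -> rnorm (p A : C) <= hpoly_norm p.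
Proof. by move=> A1; apply: ub_le_sup; [have [] := hpoly_has_sup p|exists A]. Qed.

Lemma hpoly_norm_le p M :
  (forall A, op_ball A -> rnorm (p A : C) <= M) -> hpoly_norm p <= M.
Proof.
move=> pM; apply: ge_sup; first by have [] := hpoly_has_sup p.
by move=> _ [A A1 <-]; exact: pM.
Qed.

Lemma hpoly_norm_ge0 p : 0 <= hpoly_norm p.
Proof. exact: le_trans (rnorm_ge0 _) (hpoly_norm_ub p op_ball0). Qed.

Definition hpoly_normC p : C := RtoC (hpoly_norm p).

Lemma hpoly_normD p q :
  hpoly_normC (p + q) <= hpoly_normC p + hpoly_normC q.
Proof.
rewrite /hpoly_normC -RtoCD RtoC_le.
apply: hpoly_norm_le => A A1.
exact: le_trans (rnormD _ _) (lerD (hpoly_norm_ub p A1) (hpoly_norm_ub q A1)).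
Qed.

Lemma hpoly_normZ (c : C) p : hpoly_normC (c *: p) = `|c| * hpoly_normC p.
Proof.
rewrite /hpoly_normC -rnormE -RtoCM; congr RtoC.
have cpE A : rnorm ((c *: p) A : C) = rnorm c * rnorm (p A : C).
  exact: rnormM.
apply/eqP; rewrite eq_le; apply/andP; split.
  apply: hpoly_norm_le => A A1; rewrite cpE ler_wpM2l ?rnorm_ge0//.
  exact: hpoly_norm_ub.
have [c0|c0] := eqVneq (rnorm c) 0.
  by rewrite c0 mul0r hpoly_norm_ge0.
have {}c0 : 0 < rnorm c by rewrite lt_def c0 rnorm_ge0.
rewrite -ler_pdivlMl//; apply: hpoly_norm_le => A A1.
by rewrite ler_pdivlMl// -cpE hpoly_norm_ub.
Qed.

Lemma hpoly_norm_eq0 p : hpoly_normC p = 0 -> p = 0.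
Proof.
move=> /(@RtoC_inj R) p0; apply/val_inj/funext => A.
have [t t0 tA] := op_ball_absorbing A.
have /asboolP[phi phiL pE] := hpolyP p.
have : p (RtoC t *: A) = 0.
  apply/(@rnorm_eq0 R C)/eqP; rewrite eq_le rnorm_ge0 andbT -p0.
  exact: hpoly_norm_ub.
rewrite pE (multilinearZ _ _ phiL) -pE => /eqP.
rewrite mulf_eq0 expf_eq0 => /orP[/andP[_ /eqP/(@RtoC_inj R) te0]|/eqP//].
by rewrite te0 ltxx in t0.
Qed.

HB.instance Definition _ := Lmodule_isNormed.Build C (hpoly R d n)
  hpoly_normD hpoly_normZ hpoly_norm_eq0.

End HPolyNorm.

Definition unitary_group (R : realType) (n : nat) : set 'M[Cplx R]_n :=
  [set g | g \is unitarymx].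

Definition mxBorel (R : realType) (n : nat) :=
  g_sigma_algebraType (@open 'M[Cplx R]_n).

(* The Haar measure of the unitary group is represented by the Borel
   probability measure on all matrices which is carried by that group. *)
Definition is_haar (R : realType) (n : nat)
    (mu : probability (mxBorel R n) R) : Prop :=
  [/\ mu (@unitary_group R n) = 1%E,
      forall (g : 'M[Cplx R]_n) (A : set (mxBorel R n)),
        unitary_group g -> measurable A ->
        mu [set h | A (g *m h)] = mu A &
      forall (g : 'M[Cplx R]_n) (A : set (mxBorel R n)),
        unitary_group g -> measurable A ->
        mu [set h | A (h *m g)] = mu A].

(* A partition of d has at most d non-zero parts, each of them at most d, so it
   is determined by its first d terms (indexed from 0 here). *)
Definition is_partition (d : nat) (m : {ffun 'I_d -> 'I_d.+1}) : bool :=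
  [forall i : 'I_d, forall j : 'I_d, (i <= j)%N ==> (m j <= m i)%N] && (\sum_i m i == d)%N.

Definition plength (d : nat) (m : {ffun 'I_d -> 'I_d.+1}) : nat :=
  #|[pred i | (0 < m i)%N]|.

Definition pmult (d : nat) (m : {ffun 'I_d -> 'I_d.+1}) (r : nat) : nat :=
  #|[pred i | nat_of_ord (m i) == r]|.

Definition pz (d : nat) (m : {ffun 'I_d -> 'I_d.+1}) : nat :=
  (\prod_(1 <= r < d.+1) (r ^ pmult m r * (pmult m r)`!))%N.

Definition Gamma (R : realType) (x : R) : R :=
  \int[lebesgue_measure]_(t in `]0, +oo[) (t `^ (x - 1) * expR (- t)).

(* Main.v *)
Require Import Defs.
From HB Require Import structures.
From mathcomp Require Import all_boot all_order all_algebra.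
From mathcomp Require Import cyclic separable cyclotomic.
From mathcomp Require Import complex.
From mathcomp Require Import all_classical all_reals all_analysis measurable_realfun.
From mathcomp Require Import ring lra zify.
Set Implicit Arguments.
Unset Strict Implicit.
Unset Printing Implicit Defensive.
Import Order.TTheory GRing.Theory Num.Theory.
Import numFieldNormedType.Exports.
Local Open Scope classical_set_scope.
Local Open Scope ring_scope.
Local Open Scope sesquilinear_scope.

(* On X = P_d(L(l_2^n)) the norm is the maximum over the unitary group: a contraction is a
   product W D P with W, P unitary and D diagonal, and a polynomial in one diagonal entry is
   largest on the unit circle. Let kappa be the bi-invariant reproducing kernel of X in
   L^2(Haar) at the identity. Convolution with kappa, discretised along a fine partition of
   the group, extends to every superspace with norm close to the L^1-norm of kappa.
   Conversely, inside the bounded functions on the group a projection onto X is tested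
   against convolution with the phase of kappa, whose trace is the L^1-norm. On a unitary
   matrix kappa is the complete symmetric polynomial h_d in the eigenvalues, each repeated n
   times, which Newton's identities turn into the sum over partitions.

   For the asymptotics, E|kappa|^2 = kappa(1) and the smallness of E|tr g^2|^2 / n^2 show that
   kappa / n^d is (tr g)^d / d! up to an error tending to 0 in L^2; by induction on d the
   moments of |tr g|^2 tend to those of an exponential variable. The half-integer moments
   follow by approximating x^m sqrt x by polynomials in x and exp(- s x). *)

(** Hahn-Banach extensions to a superspace [Y] are chosen point by point and need not vary
    measurably over the group, so no integral over the group is ever taken in [Y]. Such integrals
    become finite weighted sums over sample points, with an error that is uniform because every
    function involved is Lipschitz on the group. A finite sum no longer fixes X, and the small
    defect is repaired on the finitely many monomials. For the same reason the lower bound compares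
    only traces of operators on X, which the discretised operators reproduce up to a small error.
    The phase is regularised because kappa may vanish. In the asymptotic half, kappa at the identity
    is the dimension of X, about n^(2d)/d!, while the second moment of (tr g)^d/d! is E|tr
    g|^(2d)/d!^2; equating leading orders produces the value d! of the limit moment. The remainder
    of degree d involves only moments of |tr g|^2 of order below d, which closes the induction.
    Gamma enters as the exponential moment of order d/2, because |tr g|^d is the power d/2 of |tr
    g|^2. *)

Lemma exists_prim_root (C : numClosedFieldType) (N : nat) :
  (0 < N)%N -> exists w : C, N.-primitive_root w.
Proof.
move=> N0; pose p : {poly C} := 'X^N - 1.
have [r Dp] := closed_field_poly_normal p.
rewrite (monicP (monicXnsubC 1 N0)) scale1r in Dp.
have uniqr : uniq r.
  by rewrite -separable_prod_XsubC -Dp separable_Xn_sub_1// pnatr_eq0 lt0n_neq0.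
have : has N.-primitive_root r; last by case/hasP => w _ pw; exists w.
rewrite has_prim_root// ?size_map.
- by apply/allP => w wr; rewrite unity_rootE -subr_eq0; have := wr;
     rewrite -root_prod_XsubC -Dp /root /p !hornerE.
- suff <- : (size p).-1 = size r by rewrite size_XnsubC.
  by rewrite Dp size_prod_XsubC.
Qed.

Lemma norm_prim_root (C : numClosedFieldType) (N : nat) (w : C) (k : nat) :
  N.-primitive_root w -> `|w ^+ k| = 1.
Proof.
move=> pw; rewrite normrX.
have /eqP : `|w| ^+ N = 1 by rewrite -normrX prim_expr_order// normr1.
rewrite pexprn_eq1 ?normr_ge0 ?gtn_eqF ?(prim_order_gt0 pw)//=.
by move=> /eqP ->; rewrite expr1n.
Qed.

(** Discrete orthogonality takes the place of Cauchy's integral formula, first in one variable and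
    later for all matrix entries at once. For distinct [a] and [b] below [N], the ratio [z] is an
    [N]-th root of unity other than 1, so its geometric sum vanishes. *)
Lemma sum_prim_root (C : numClosedFieldType) (N : nat) (w : C) (a b : nat) :
  N.-primitive_root w -> (a < N)%N -> (b < N)%N ->
  \sum_(k < N) (w ^+ k) ^+ a / (w ^+ k) ^+ b = N%:R * (a == b)%:R.
Proof.
move=> pw aN bN.
have w0 : w != 0 by rewrite -normr_gt0 -[w]expr1 (norm_prim_root _ pw) ltr01.
pose z := w ^+ a / w ^+ b.
have zE k : (w ^+ k) ^+ a / (w ^+ k) ^+ b = z ^+ k.
  by rewrite /z expr_div_n -!exprM ![(k * _)%N]mulnC.
under eq_bigr do rewrite zE.
have [ab|ab] := eqVneq a b.
  rewrite (eq_bigr (fun=> 1)) => [|k _]; last first.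
    by rewrite /z ab divff ?expf_neq0// expr1n.
  by rewrite sumr_const card_ord mulr1.
rewrite mulr0; have z1 : z != 1.
  apply: contra ab => /eqP ze; rewrite -(modn_small aN) -(modn_small bN).
  rewrite -(eq_prim_root_expr pw); apply/eqP.
  by rewrite -[LHS](divfK (expf_neq0 b w0)) -/z ze mul1r.
apply: (mulfI (x := z - 1)); first by rewrite subr_eq0.
have zN : z ^+ N = 1.
  by rewrite /z expr_div_n (exprAC w a) (exprAC w b) (prim_expr_order pw) !expr1n divr1.
by rewrite -subrX1 mulr0 zN subrr.
Qed.

(** * The maximum principle on the unitary group *)

Section MaximumModulus.
Variable R : realType.
Local Notation C := (Cplx R).

Lemma rnorm1P (z : C) : rnorm z = 1 <-> `|z| = 1.
Proof.
split; first by rewrite -rnormE => ->.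
by move=> z1; rewrite /rnorm z1.
Qed.

Lemma rnormX (z : C) k : rnorm (z ^+ k) = rnorm z ^+ k.
Proof.
elim: k => [|k IH]; first by rewrite !expr0 /rnorm normr1.
by rewrite !exprS rnormM IH.
Qed.

Lemma rnormV (z : C) : rnorm z^-1 = (rnorm z)^-1.
Proof.
have [->|z0] := eqVneq z 0; first by rewrite invr0 rnorm0 invr0.
have n0 : rnorm z != 0 by apply: contra z0 => /eqP/rnorm_eq0 ->.
by apply: (mulfI n0); rewrite -rnormM !divff// /rnorm normr1.
Qed.

Lemma rnorm_nat k : rnorm (k%:R : C) = k%:R.
Proof.
by rewrite -[in LHS](rmorph_nat (real_complex R)) -[LHS]/(rnorm (RtoC _)) rnorm_real.
Qed.

(* A coefficient is an average of the values over the roots of unity. *)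
Lemma coef_le_circle (q : {poly C}) (M : R) j :
  (forall w : C, rnorm w = 1 -> rnorm q.[w] <= M) -> rnorm q`_j <= M.
Proof.
move=> qM.
have M0 : 0 <= M by apply: le_trans (qM 1 _); rewrite ?rnorm_ge0// rnorm1P normr1.
have [jq|jq] := leqP (size q) j; first by rewrite nth_default// rnorm0.
have N0 : (0 < size q)%N by apply: leq_ltn_trans jq.
have [w pw] := exists_prim_root C N0.
have qE : (size q)%:R * q`_j = \sum_(k < size q) q.[w ^+ k] / (w ^+ k) ^+ j.
  under eq_bigr do rewrite horner_coef mulr_suml.
  rewrite exchange_big/= (bigD1 (Ordinal jq))//= [X in _ + X]big1 => [|i ij].
    under eq_bigr do rewrite -mulrA.
    by rewrite -mulr_sumr (sum_prim_root pw)// eqxx mulr1 addr0 mulrC.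
  under eq_bigr do rewrite -mulrA.
  rewrite -mulr_sumr (sum_prim_root pw)//.
  by rewrite -[_ == j]/(i == Ordinal jq) (negbTE ij) !mulr0.
have : rnorm ((size q)%:R * q`_j) <= (size q)%:R * M.
  rewrite qE; apply: le_trans (rnorm_sum _ _ _) _.
  have -> : (size q)%:R * M = \sum_(k < size q) M by rewrite sumr_const card_ord mulr_natl.
  apply: ler_sum => k _; have wk : rnorm (w ^+ k) = 1.
    by apply/rnorm1P; rewrite (norm_prim_root _ pw).
  rewrite rnormM rnormV rnormX wk expr1n invr1 mulr1; exact: qM.
by rewrite rnormM rnorm_nat ler_pM2l// ltr0n.
Qed.

Lemma horner_le_coef (q : {poly C}) (M : R) (z : C) :
  (forall j, rnorm q`_j <= M) -> rnorm z <= 1 -> rnorm q.[z] <= (size q)%:R * M.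
Proof.
move=> qM z1; rewrite horner_coef; apply: le_trans (rnorm_sum _ _ _) _.
have -> : (size q)%:R * M = \sum_(k < size q) M by rewrite sumr_const card_ord mulr_natl.
apply: ler_sum => k _; rewrite rnormM rnormX -[leRHS]mulr1.
by rewrite ler_pM ?rnorm_ge0 ?exprn_ge0 ?exprn_ile1 ?rnorm_ge0.
Qed.

(** Linear growth cannot dominate a geometric sequence. Bernoulli's inequality is itself only linear
    in the exponent, so it is squared: for [x = 1 + e] the power [x ^+ (m * 2)] is at least a
    quadratic in [m]. *)
Lemma le_of_pow_le (x : R) (N : nat) :
  0 <= x -> (forall m, x ^+ m <= (N * m).+1%:R) -> x <= 1.
Proof.
move=> x0 xN; rewrite leNgt; apply/negP => x1.
pose e := x - 1; have e0 : 0 < e by rewrite subr_gt0.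
have bern m : 1 + m%:R * e <= x ^+ m.
  elim: m => [|m IH]; first by rewrite mul0r addr0 expr0.
  rewrite exprSr; apply: le_trans (ler_wpM2r x0 IH).
  have -> : x = 1 + e by rewrite /e addrC subrK.
  have := mulr_ge0 (mulr_ge0 (ler0n R m) (ltW e0)) (ltW e0).
  by rewrite -natr1; nra.
(* For [m] this large the quadratic term [m^2 e^2] beats [2 N m], and the exponent [m * 2]
   contradicts the hypothesis. *)
have [m mE] : exists m : nat, (2 * N)%:R + 1 < m%:R * e ^+ 2.
  exists (Num.truncn (((2 * N)%:R + 1) / e ^+ 2)).+1.
  by rewrite -ltr_pdivrMr ?exprn_gt0// truncnS_gt.
have m0 : 0 < m%:R :> R.
  by rewrite ltr0n lt0n; apply/eqP => m0; move: mE; rewrite m0 mul0r ltNge ler_wpDl.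
have := xN (m * 2)%N; rewrite exprM -natr1 !natrM leNgt => /negP; apply.
have me0 : 0 < m%:R * e by rewrite mulr_gt0.
have : (1 + m%:R * e) ^+ 2 <= (x ^+ m) ^+ 2.
  by rewrite lerXn2r ?nnegrE ?exprn_ge0 ?addr_ge0 ?bern// ltW.
apply: lt_le_trans.
have : m%:R * ((2 * N)%:R + 1) < m%:R * (m%:R * e ^+ 2) by rewrite ltr_pM2l.
by rewrite natrM; nra.
Qed.

(** Power trick: the bound through coefficients loses the factor [size q]. Applied to [q ^+ m] it
    loses only a factor linear in [m], which disappears after taking [m]-th roots. *)
Lemma horner_le_circle (q : {poly C}) (M : R) (z : C) :
  (forall w : C, rnorm w = 1 -> rnorm q.[w] <= M) -> rnorm z <= 1 ->
  rnorm q.[z] <= M.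
Proof.
move=> qM z1.
have M0 : 0 <= M by apply: le_trans (qM 1 _); rewrite ?rnorm_ge0// rnorm1P normr1.
have pow m : rnorm q.[z] ^+ m <= ((size q).-1 * m).+1%:R * M ^+ m.
  rewrite -rnormX -horner_exp.
  apply: (@le_trans _ _ ((size (q ^+ m))%:R * M ^+ m)).
    apply: horner_le_coef => // j; apply: coef_le_circle => w w1.
    by rewrite horner_exp rnormX lerXn2r ?nnegrE ?rnorm_ge0 ?qM.
  by rewrite ler_wpM2r ?exprn_ge0// ler_nat size_exp_leq.
have [M00|M00] := eqVneq M 0.
  by have := pow 1%N; rewrite M00 !expr1 mulr0.
have {}M0 : 0 < M by rewrite lt_def M00.
rewrite -[leRHS]mul1r -ler_pdivrMr//.
apply: (@le_of_pow_le _ (size q).-1) => [|m]; first by rewrite divr_ge0 ?rnorm_ge0 ?ltW.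
by rewrite expr_div_n ler_pdivrMr ?exprn_gt0.
Qed.

End MaximumModulus.

Section MultilinearExpansion.
Variables (R : realType) (n d : nat).
Local Notation C := (Cplx R).
Local Notation E := ('I_n * 'I_n)%type.
Local Notation unit_mx e := (delta_mx e.1 e.2 : 'M[C]_n).

Lemma delta_mxE (e e' : E) : (unit_mx e) e'.1 e'.2 = (e == e')%:R.
Proof. by rewrite mxE -pair_eqE /pair_eq/= eq_sym [e.2 == _]eq_sym. Qed.

Lemma multilinear_expand (phi : ('I_d -> 'M[C]_n) -> C) (x : 'I_d -> 'M[C]_n) :
  multilinear_form phi ->
  phi x = \sum_(w : {ffun 'I_d -> E})
            (\prod_k x k (w k).1 (w k).2) * phi (fun k => unit_mx (w k)).
Proof.
move=> phiL.
(* [m] counts the leading slots that may still hold arbitrary matrices; all later slots already hold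
   matrix units. The inductive step expands the last arbitrary slot. *)
suff /(_ d x) H : forall m (x : 'I_d -> 'M[C]_n),
    (forall k : 'I_d, (m <= k)%N -> exists e : E, x k = unit_mx e) ->
    phi x = \sum_(w : {ffun 'I_d -> E})
            (\prod_k x k (w k).1 (w k).2) * phi (fun k => unit_mx (w k)).
  by apply: H => k; rewrite leqNgt ltn_ord.
elim=> {x} [|m IHm] x xd.
  have /choice[f fx] : forall k : 'I_d, exists e : E, x k = unit_mx e.
    by move=> k; exact: xd.
  rewrite (bigD1 [ffun k => f k])//= [X in _ + X]big1 => [|w wf]; last first.
    have /existsP[k wk] : [exists k, w k != f k].
      rewrite -negb_forall; apply: contra wf => /forallP wf.
      by apply/eqP/ffunP => k; rewrite ffunE; exact/eqP.
    by rewrite (bigD1 k)//= fx delta_mxE eq_sym (negbTE wk) !mul0r.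
  rewrite addr0 big1 => [|k _]; last by rewrite ffunE fx delta_mxE eqxx.
  by rewrite mul1r; congr phi; apply/funext => k; rewrite ffunE fx.
have [md|dm] := ltnP m d; last first.
  apply: IHm => k mk; apply: xd; have := leq_trans dm mk.
  by rewrite leqNgt ltn_ord.
pose k0 := Ordinal md.
have -> : phi x = \sum_(e : E) x k0 e.1 e.2 * phi (upd x k0 (unit_mx e)).
  rewrite -(multilinear_sum phiL) -[in LHS](upd_id x k0).
  by rewrite [in LHS](matrix_sum_delta (x k0)) pair_bigA.
under eq_bigr => e _.
  rewrite IHm; last first.
    move=> k mk; rewrite /upd; case: eqP => [_|/eqP kk0]; first by exists e.
    apply: xd; rewrite ltn_neqAle mk andbT.
    by rewrite -val_eqE/= eq_sym in kk0.
  rewrite mulr_sumr.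
  over.
rewrite exchange_big/=; apply: eq_bigr => w _.
under eq_bigr => e _ do rewrite mulrA.
rewrite -mulr_suml; congr (_ * _).
rewrite [RHS](bigD1 k0)//= (bigD1 (w k0))//= [X in _ + X]big1 => [|e ew]; last first.
  by rewrite (bigD1 k0)//= /upd eqxx delta_mxE (negbTE ew) mul0r mulr0.
rewrite addr0; congr (_ * _).
rewrite (bigD1 k0)//= /upd eqxx delta_mxE eqxx mul1r.
by apply: eq_bigr => k /negbTE ->.
Qed.

Lemma hpoly_word_expand (p : hpoly R d n) :
  exists c : {ffun 'I_d -> E} -> C,
    forall A, p A = \sum_w c w * \prod_k A (w k).1 (w k).2.
Proof.
have /asboolP[phi phiL pE] := hpolyP p.
exists (fun w => phi (fun k => unit_mx (w k))) => A.
by rewrite pE (multilinear_expand _ phiL); apply: eq_bigr => w _; rewrite mulrC.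
Qed.

(** Restriction to a polynomial curve of matrices reduces questions about [p] to one complex
    variable, where [horner_le_circle] applies. *)
Lemma hpoly_path (p : hpoly R d n) (Q : 'I_n -> 'I_n -> {poly C}) :
  exists q : {poly C}, forall z, p (\matrix_(i, j) (Q i j).[z]) = q.[z].
Proof.
have [c pE] := hpoly_word_expand p.
exists (\sum_w c w *: \prod_k Q (w k).1 (w k).2) => z.
rewrite pE horner_sum; apply: eq_bigr => w _.
rewrite hornerZ horner_prod; congr (_ * _).
by apply: eq_bigr => k _; rewrite mxE.
Qed.

End MultilinearExpansion.

(** * Singular values and the operator-norm ball *)

Section Unitary.
Variables (R : realType) (n : nat).
Local Notation C := (Cplx R).
Implicit Types (v : 'cV[C]_n) (A B g : 'M[C]_n).

Lemma RtoC_sum (I : finType) (F : I -> R) : RtoC (\sum_i F i) = \sum_i RtoC (F i).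
Proof. exact: (big_morph (@RtoC R) (@RtoCD R)). Qed.

Lemma RtoC1 : RtoC (1 : R) = 1. Proof. by []. Qed.
Lemma RtoC0 : RtoC (0 : R) = 0. Proof. by []. Qed.

Lemma RtoC_rnorm_sq (z : C) : RtoC (rnorm z ^+ 2) = z * z^*.
Proof. by rewrite expr2 RtoCM !rnormE -expr2 normCK. Qed.

Lemma conj_RtoC (t : R) : (RtoC t)^* = RtoC t.
Proof. by apply/CrealP/complex_realP; exists t. Qed.

Lemma l2norm_ge0 v : 0 <= l2norm v. Proof. exact: sqrtr_ge0. Qed.

Lemma l2norm_sq v : l2norm v ^+ 2 = \sum_i rnorm (v i 0) ^+ 2.
Proof. by rewrite sqr_sqrtr// sumr_ge0// => i _; rewrite sqr_ge0. Qed.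

Lemma l2norm_form v : RtoC (l2norm v ^+ 2) = (v^t* *m v) 0 0.
Proof.
rewrite l2norm_sq RtoC_sum mxE; apply: eq_bigr => i _.
by rewrite RtoC_rnorm_sq !mxE mulrC.
Qed.

Lemma trmxC_mul m p q (A : 'M[C]_(m, p)) (B : 'M[C]_(p, q)) :
  (A *m B)^t* = B^t* *m A^t*.
Proof. by rewrite trmx_mul map_mxM. Qed.

Lemma unitary_mulVmx g : g \is unitarymx -> g^t* *m g = 1%:M.
Proof. by move=> /unitarymxP /mulmx1C. Qed.

Lemma l2norm_unitary g v : g \is unitarymx -> l2norm (g *m v) = l2norm v.
Proof.
move=> gU; apply/eqP; rewrite -(@eqrXn2 _ 2) ?l2norm_ge0//; apply/eqP.
apply: (@RtoC_inj R); rewrite !l2norm_form trmxC_mul mulmxA -(mulmxA (v^t*)).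
by rewrite (unitary_mulVmx gU) mulmx1.
Qed.

Lemma op_ballP A : op_ball A <-> forall v, l2norm v <= 1 -> l2norm (A *m v) <= 1.
Proof.
split => [AB v v1|H].
  by rewrite -lee_fin; apply: le_trans AB; apply: ereal_sup_ubound; exists v.
by apply: ge_ereal_sup => _ [v v1 <-]; rewrite lee_fin; exact: H.
Qed.

Lemma unitary_op_ball g : g \is unitarymx -> op_ball g.
Proof. by move=> gU; apply/op_ballP => v; rewrite l2norm_unitary. Qed.

Lemma l2normE0 v : l2norm v = 0 -> v = 0.
Proof.
move=> v0; apply/matrixP => i j; rewrite ord1 mxE; apply: rnorm_eq0.
by apply/eqP; rewrite eq_le rnorm_ge0 -v0 l2norm_coord.
Qed.

Lemma diag_unitary (D : 'rV[C]_n) :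
  (forall j, rnorm (D 0 j) = 1) -> diag_mx D \is unitarymx.
Proof.
move=> D1; apply/unitarymxP; rewrite tr_diag_mx map_diag_mx mulmx_diag.
apply/matrixP => i j; rewrite !mxE; case: eqP => // _.
by rewrite -RtoC_rnorm_sq D1 expr1n.
Qed.

(** Diagonalise [A^t* *m A] by a unitary [P]; the columns of [B], the product of [A] and the adjoint
    of [P], are then orthogonal and their norms are the singular values. Invertibility of [A] keeps
    these norms nonzero, so the columns can be normalised to form [W]. The norms are at most 1
    because the columns are images of unit vectors. *)
Lemma singular_values A : A \in unitmx -> op_ball A ->
  exists (W P : 'M[C]_n) (D : 'rV[C]_n),
    [/\ W \is unitarymx, P \is unitarymx, forall j, rnorm (D 0 j) <= 1 &
        A = W *m diag_mx D *m P].
Proof.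
move=> Au /op_ballP Ab; pose H := A^t* *m A.
have Hn : H \is normalmx by apply/normalmxP; rewrite /H trmxC_mul trmxCK.
pose P := spectralmx H; have PU : P \is unitarymx by exact: spectral_unitarymx.
have HE : P *m H *m P^t* = diag_mx (spectral_diag H).
  have /orthomx_spectralP HE := Hn.
  rewrite [X in P *m X]HE -/P invmx_unitary// !mulmxA (unitarymxP PU) mul1mx.
  by rewrite -mulmxA (unitarymxP PU) mulmx1.
pose B := A *m P^t*.
have BB : B^t* *m B = diag_mx (spectral_diag H).
  by rewrite -HE trmxC_mul trmxCK /B !mulmxA.
have colB j : col j B = A *m col j (P^t*) by rewrite colE -mulmxA -colE.
have sE j : spectral_diag H 0 j = RtoC (l2norm (col j B) ^+ 2).
  have := congr1 (fun X : 'M[C]_n => X j j) BB; rewrite [in RHS]mxE eqxx mulr1n => <-.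
  by rewrite l2norm_form !mxE; apply: eq_bigr => i _; rewrite !mxE.
have sN0 j : l2norm (col j B) != 0.
  apply/eqP => /l2normE0; rewrite colB => H0.
  have : col j (P^t*) = 0 by rewrite -[LHS](mulKmx Au) H0 mulmx0.
  rewrite colE.
  move/(congr1 (mulmx P)); rewrite mulmxA (unitarymxP PU) mul1mx mulmx0.
  by move/matrixP/(_ j 0)/eqP; rewrite !mxE !eqxx oner_eq0.
pose D : 'rV[C]_n := \row_j RtoC (l2norm (col j B)).
pose D' : 'rV[C]_n := \row_j (RtoC (l2norm (col j B)))^-1.
have DN0 j : RtoC (l2norm (col j B)) != 0.
  by apply: contra (sN0 j) => /eqP/(@RtoC_inj R) ->.
exists (B *m diag_mx D'), P, D; split; [|exact: PU| |].
- rewrite -trmxC_unitary; apply/unitarymxP; rewrite trmxCK trmxC_mul.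
  rewrite mulmxA -(mulmxA _ (B^t*)) BB tr_diag_mx map_diag_mx !mulmx_diag.
  apply/matrixP => i j; rewrite !mxE; case: eqP => // _; rewrite mulr1n sE.
  rewrite RtoCM; move: (DN0 i) => DNi.
  rewrite fmorphV /= conj_RtoC mulrA mulVf ?DN0// mul1r mulfV ?DN0//.
- move=> j; rewrite mxE rnorm_real ?l2norm_ge0// colB; apply: Ab.
  by rewrite colE l2norm_unitary ?trmxC_unitary// /l2norm (bigD1 j)//= big1 ?addr0
    ?mxE ?eqxx /rnorm ?normr1 ?expr1n ?sqrtr1// => k kj;
   rewrite mxE (negbTE kj) normr0 expr0n.
- rewrite -(mulmxA B) mulmx_diag (_ : diag_mx _ = 1%:M).
    by rewrite mulmx1 -mulmxA (unitary_mulVmx PU) mulmx1.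
  by apply/matrixP => i j; rewrite !mxE mulVf.
Qed.

Lemma op_ball_convex A (t : R) : op_ball A -> 0 <= t <= 1 ->
  op_ball (A + RtoC t *: (1%:M - A)).
Proof.
move=> /op_ballP Ab /andP[t0 t1]; apply/op_ballP => v v1.
have -> : (A + RtoC t *: (1%:M - A)) *m v = RtoC (1 - t) *: (A *m v) + RtoC t *: v.
  rewrite mulmxDl -scalemxAl mulmxBl mul1mx RtoCD scalerBr scalerDl RtoC1.
  rewrite scale1r -addrA; congr (_ + _); rewrite addrC; congr (_ + _).
  by rewrite -[RtoC (- t)]/(real_complex R (- t)) rmorphN scaleNr.
rewrite -[leRHS]sqrtr1 ler_wsqrtr//.
have sq1 (u : 'cV[C]_n) : l2norm u <= 1 -> \sum_i rnorm (u i 0) ^+ 2 <= 1.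
  by move=> u1; rewrite -l2norm_sq exprn_ile1 ?l2norm_ge0.
apply: (@le_trans _ _ (\sum_i ((1 - t) * rnorm ((A *m v) i 0) ^+ 2 + t * rnorm (v i 0) ^+ 2))).
  apply: ler_sum => i _; rewrite mxE [X in X + _]mxE [X in _ + X]mxE.
  set x := (A *m v) i 0; set y := v i 0.
  apply: (@le_trans _ _ (((1 - t) * rnorm x + t * rnorm y) ^+ 2)).
    rewrite lerXn2r ?nnegrE ?rnorm_ge0 ?addr_ge0 ?mulr_ge0 ?rnorm_ge0 ?subr_ge0//.
    apply: le_trans (rnormD _ _) _; rewrite !rnormM !rnorm_real ?subr_ge0//.
  (* The convexity defect of the square is [t (1 - t)] times the square of the difference of the two
     moduli. *)
  have := mulr_ge0 (mulr_ge0 t0 (_ : 0 <= 1 - t)) (sqr_ge0 (rnorm x - rnorm y)).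
  by rewrite subr_ge0 => /(_ t1); nra.
rewrite big_split/= -!mulr_sumr.
apply: (@le_trans _ _ ((1 - t) * 1 + t * 1)); last by rewrite !mulr1 subrK.
by rewrite lerD// ler_wpM2l ?subr_ge0 ?sq1 ?Ab.
Qed.

End Unitary.

Section MaximumPrinciple.
Variables (R : realType) (n d : nat) (p : hpoly R d n) (M : R).
Local Notation C := (Cplx R).
Hypothesis pM : forall g : 'M[C]_n, g \is unitarymx -> rnorm (p g : C) <= M.

(** Induction on the number of entries of [D] not yet known to lie on the unit circle: [p] is a
    polynomial in one such entry, and its bound on the circle is the induction hypothesis. *)
Let diag_le (W P : 'M[C]_n) (D : 'rV[C]_n) :
  W \is unitarymx -> P \is unitarymx -> (forall j, rnorm (D 0 j) <= 1) ->
  rnorm (p (W *m diag_mx D *m P) : C) <= M.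
Proof.
move=> WU PU; suff /(_ n D) H : forall m (D : 'rV[C]_n),
    (forall j, rnorm (D 0 j) <= 1) ->
    (forall j : 'I_n, (m <= j)%N -> rnorm (D 0 j) = 1) ->
    rnorm (p (W *m diag_mx D *m P) : C) <= M.
  by move=> D1; apply: H => // j; rewrite leqNgt ltn_ord.
elim=> {D} [|m IHm] D D1 Dm.
  by apply: pM; rewrite !mul_unitarymx ?diag_unitary// => j; exact: Dm.
have [mn|nm] := ltnP m n; last first.
  by apply: IHm => // j mj; have := leq_trans nm mj; rewrite leqNgt ltn_ord.
pose k0 := Ordinal mn.
pose Dz z : 'rV[C]_n := \row_k (if k == k0 then z else D 0 k).
pose Q i j : {poly C} :=
  \sum_k (W i k * P k j) *: (if k == k0 then 'X else (D 0 k)%:P).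
have [q qE] := hpoly_path p Q.
have QE z : W *m diag_mx (Dz z) *m P = \matrix_(i, j) (Q i j).[z].
  apply/matrixP => i j; rewrite !mxE horner_sum; apply: eq_bigr => k _.
  rewrite mul_mx_diag !mxE hornerZ mulrAC; congr (_ * _).
  by case: eqP => _; rewrite ?hornerX ?hornerC.
have -> : D = Dz (D 0 k0).
  by apply/matrixP => i j; rewrite ord1 mxE; case: eqP => [->|].
rewrite QE qE; apply: horner_le_circle => // w w1.
rewrite -qE -QE; apply: IHm => j.
  by rewrite mxE; case: eqP => // _; rewrite w1.
rewrite mxE; case: eqP => // /eqP jk mj; apply: Dm.
by rewrite ltn_neqAle mj andbT; rewrite -val_eqE/= eq_sym in jk.
Qed.

(** A singular [A] is out of reach of [singular_values], so it is approached along the segment from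
    the identity. The determinant along this segment is a polynomial with value 1 at the identity,
    hence nonzero, and only finitely many points have to be avoided. *)
Lemma maximum_principle (A : 'M[C]_n) : op_ball A -> rnorm (p A : C) <= M.
Proof.
move=> Ab.
pose Q i j : {poly C} := (A i j)%:P + ((1%:M - A) i j) *: 'X.
have [q qE] := hpoly_path p Q.
pose r : {poly C} := \det (\matrix_(i, j) Q i j).
have QE z : \matrix_(i, j) (Q i j).[z] = A + z *: (1%:M - A).
  apply/matrixP => i j; rewrite [LHS]mxE [RHS]mxE hornerD hornerC hornerZ hornerX.
  by rewrite mulrC [X in _ = _ + X]mxE.
have rE z : r.[z] = \det (A + z *: (1%:M - A)).
  rewrite -QE /r -[LHS]/(horner_eval z _) -det_map_mx; congr (\det _).
  by apply/matrixP => i j; rewrite !mxE.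
have r0 : r != 0.
  apply/eqP => r0; have := rE 1; rewrite r0 horner0 scale1r addrC subrK det1.
  by move/eqP; rewrite eq_sym oner_eq0.
have qM (t : R) : 0 <= t <= 1 -> ~~ root r (RtoC t) -> rnorm q.[RtoC t] <= M.
  move=> t01 rt; rewrite -qE QE.
  have := op_ball_convex Ab t01; set B := (A + _) => Bb.
  have Bu : B \in unitmx by rewrite unitmxE unitfE /B -rE.
  have [W [P [D [WU PU D1 ->]]]] := singular_values Bu Bb.
  exact: diag_le.
have -> : p A = q.[0] by rewrite -qE QE scale0r addr0.
(* Splitting off the constant term bounds [q(0) - q(t)] by [t K], the price for moving from [A] to a
   nearby invertible matrix. *)
have [q' qq'] : exists q' : {poly C}, q = q' * 'X + q.[0]%:P.
  have : root (q - q.[0]%:P) 0 by rewrite /root hornerD hornerN hornerC subrr.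
  by move/factor_theorem => [q']; rewrite polyC0 subr0 => /eqP; rewrite subr_eq => /eqP; exists q'.
pose K : R := (size q')%:R * \sum_(j < size q') rnorm q'`_j.
have K0 : 0 <= K by rewrite mulr_ge0// sumr_ge0// => j _; exact: rnorm_ge0.
have qK (t : R) : 0 <= t <= 1 -> ~~ root r (RtoC t) -> rnorm q.[0] <= M + t * K.
  move=> t01 rt; have tM := qM t t01 rt; have /andP[t0 t1] := t01.
  have -> : q.[0] = q.[RtoC t] + - (q'.[RtoC t] * RtoC t).
    by rewrite [in q.[RtoC t]]qq' hornerD hornerM hornerX hornerC addrAC subrr add0r.
  apply: le_trans (rnormD _ _) _; apply: lerD tM _.
  have -> : rnorm (- (q'.[RtoC t] * RtoC t)) = rnorm (q'.[RtoC t] * RtoC t).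
    by rewrite /rnorm normrN.
  rewrite rnormM rnorm_real// mulrC ler_wpM2l// /K; apply: horner_le_coef.
    move=> j; have [jq|jq] := ltnP j (size q').
      by rewrite (bigD1 (Ordinal jq))//= lerDl sumr_ge0// => i _; exact: rnorm_ge0.
    by rewrite nth_default// rnorm0 sumr_ge0// => i _; exact: rnorm_ge0.
  by rewrite rnorm_real.
rewrite leNgt; apply/negP => Mq; pose e := rnorm q.[0] - M.
have e0 : 0 < e by rewrite subr_gt0.
(* If the bound failed by [e], every [t k = 1 / (k + N)] would be too close to 0 to be anything but
   a root of the determinant, and these are more roots than its degree allows. *)
pose N := (Num.truncn (K / e)).+1.
pose t k : R := (k + N)%:R^-1.
have tK k : t k * K < e.
  rewrite mulrC ltr_pdivrMr ?ltr0n ?addnS// mulrC -ltr_pdivrMr//.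
  by apply: lt_le_trans (truncnS_gt _) _; rewrite ler_nat -addnS leq_addl.
have t01 k : 0 <= t k <= 1.
  by rewrite invr_ge0 ler0n invf_le1 ?ltr0n ?ler1n addnS.
have rt k : root r (RtoC (t k)).
  apply/negPn/negP => rt; have := qK _ (t01 k) rt; rewrite leNgt => /negP; apply.
  by rewrite -ltrBrDl tK.
pose rs := [seq RtoC (t k) | k <- iota 0 (size r)].
have : (size rs < size r)%N.
  apply: max_poly_roots => //; first by apply/allP => _ /mapP[k _ ->].
  rewrite map_inj_uniq ?iota_uniq// => k l /(@RtoC_inj R)/invr_inj/eqP.
  by rewrite eqr_nat eqn_add2r => /eqP.
by rewrite size_map size_iota ltnn.
Qed.

End MaximumPrinciple.

(** * Monomials and coefficients *)

Section HPolyOps.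
Variables (R : realType) (n d : nat).
Local Notation C := (Cplx R).
Local Notation E := ('I_n * 'I_n)%type.
Implicit Types (p q : hpoly R d n) (A u v : 'M[C]_n).

Lemma hpoly_ext p q : (forall A, p A = q A) -> p = q.
Proof. by move=> pq; apply/val_inj/funext. Qed.

Lemma hpolyD p q A : (p + q) A = p A + q A. Proof. by []. Qed.
Lemma hpolyZ (c : C) p A : (c *: p) A = c * p A. Proof. by []. Qed.
Lemma hpoly0 A : (0 : hpoly R d n) A = 0. Proof. by []. Qed.

Lemma hpoly_sum (I : Type) (r : seq I) (P : pred I) (F : I -> hpoly R d n) A :
  (\sum_(i <- r | P i) F i) A = \sum_(i <- r | P i) F i A.
Proof. exact: (big_morph (fun p : hpoly R d n => p A : C) (fun p q => hpolyD p q A) (hpoly0 A)). Qed.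

Lemma htrans_subproof p u v : (fun A => p (u *m A *m v)) \in @hpoly_pred R d n.
Proof.
have /asboolP[phi phiL pE] := hpolyP p.
apply/asboolP; exists (fun x => phi (fun k => u *m x k *m v)) => [x i a B D|A].
  have updE z : (fun k => u *m upd x i z k *m v) = upd (fun k => u *m x k *m v) i (u *m z *m v).
    by apply/funext => k; rewrite /upd; case: eqP.
  have lin : u *m (a *: B + D) *m v = a *: (u *m B *m v) + u *m D *m v.
    by rewrite mulmxDr mulmxDl -scalemxAr -scalemxAl.
  have := phiL (fun k => u *m x k *m v) i a (u *m B *m v) (u *m D *m v).
  by rewrite -lin -(updE B) -(updE D) -(updE (a *: B + D)).
by rewrite pE.
Qed.

Definition htrans u v p : hpoly R d n := HPoly (htrans_subproof p u v).

Lemma htransE u v p A : htrans u v p A = p (u *m A *m v). Proof. by []. Qed.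

Lemma word_is_hpoly (w : 'I_d -> E) :
  is_hpoly d (fun A : 'M[C]_n => \prod_k A (w k).1 (w k).2 : C^o).
Proof.
exists (fun x : 'I_d -> 'M[C]_n => \prod_k x k (w k).1 (w k).2) => // x i a B D.
rewrite (bigD1 i)//= [X in _ = _ * X + _](bigD1 i)//= [X in _ = _ + X](bigD1 i)//=.
have H z : \prod_(k | k != i) upd x i z k (w k).1 (w k).2 =
           \prod_(k | k != i) x k (w k).1 (w k).2.
  by apply: eq_bigr => k ki; rewrite /upd (negbTE ki).
by rewrite !H /upd eqxx !mxE mulrDl mulrA.
Qed.

Definition mindex := {a : {ffun E -> 'I_d.+1} | (\sum_e a e == d)%N}.

(** Listing each index with its multiplicity exhibits the monomial as the diagonal of the [d]-linear
    form attached to a word. *)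
Definition mword (a : mindex) : seq E := flatten [seq nseq (val a e) e | e <- index_enum E].

Lemma size_mword a : size (mword a) == d.
Proof.
rewrite size_flatten /shape -map_comp sumnE big_map.
by under eq_bigr do rewrite /= size_nseq; exact: (valP a).
Qed.

Lemma prod_mword a (F : E -> C) : \prod_(e <- mword a) F e = \prod_e F e ^+ val a e.
Proof.
rewrite big_flatten big_map; apply: eq_bigr => e _.
by rewrite big_nseq -Monoid.iteropE.
Qed.

Lemma mono_subproof (a : mindex) :
  (fun A : 'M[C]_n => \prod_e A e.1 e.2 ^+ val a e : C^o) \in @hpoly_pred R d n.
Proof.
apply/asboolP; have [phi phiL pE] := word_is_hpoly (tnth (Tuple (size_mword a))).
by exists phi => // A; rewrite -prod_mword -pE -(big_tuple _ _ (Tuple (size_mword a)) predT (fun e => A e.1 e.2)).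
Qed.

Definition mono (a : mindex) : hpoly R d n := HPoly (mono_subproof a).

Lemma monoE a A : mono a A = \prod_e A e.1 e.2 ^+ val a e. Proof. by []. Qed.

Lemma word_count_subproof (w : {ffun 'I_d -> E}) :
  (\sum_e [ffun e => inord #|[pred k | w k == e]| : 'I_d.+1] e == d)%N.
Proof.
apply/eqP; under eq_bigr => e _.
  rewrite ffunE inordK; last by rewrite ltnS -[leqRHS]card_ord max_card.
  rewrite -sum1_card; over.
by rewrite (exchange_big_dep predT)//= -[RHS]card_ord -sum1_card; apply: eq_bigr => k _;
   rewrite (big_pred1 (w k))// => e; rewrite inE eq_sym.
Qed.

Definition word_count (w : {ffun 'I_d -> E}) : mindex :=
  exist (fun a : {ffun E -> 'I_d.+1} => (\sum_e a e == d)%N) _ (word_count_subproof w).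

Lemma mono_word (w : {ffun 'I_d -> E}) A :
  mono (word_count w) A = \prod_k A (w k).1 (w k).2.
Proof.
rewrite monoE (partition_big w predT)//=; apply: eq_bigr => e _.
rewrite ffunE inordK; last by rewrite ltnS -[leqRHS]card_ord max_card.
by rewrite (eq_bigr (fun=> A e.1 e.2)) => [|k /eqP ->//]; rewrite prodr_const.
Qed.

Let w_root : C := sval (cid (exists_prim_root C (ltn0Sn d))).
Let w_rootP : (d.+1).-primitive_root w_root.
Proof. by rewrite /w_root; case: cid. Qed.

(** A discrete Fourier coefficient over the torus of [d.+1]-th roots of unity, an order that
    separates the exponents 0 to [d]. Being a finite sum of values, it makes sense for any function
    and is linear by construction. *)
Definition mcoef (a : mindex) (f : 'M[C]_n -> C) : C :=
  (d.+1%:R ^+ #|{: E}|)^-1 * \sum_(k : {ffun E -> 'I_d.+1})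
    f (\matrix_(i, j) w_root ^+ k (i, j)) / \prod_e (w_root ^+ k e) ^+ val a e.

Lemma mcoef_sum a (I : finType) (c : I -> C) (F : I -> 'M[C]_n -> C) :
  mcoef a (fun A => \sum_i c i * F i A) = \sum_i c i * mcoef a (F i).
Proof.
rewrite /mcoef; under eq_bigr do rewrite mulr_suml.
rewrite exchange_big mulr_sumr; apply: eq_bigr => i _.
by rewrite mulrCA; congr (_ * _); rewrite mulr_sumr; apply: eq_bigr => k _; rewrite mulrA.
Qed.

Lemma mcoef_mono a b : mcoef a (mono b) = (a == b)%:R.
Proof.
rewrite /mcoef.
under eq_bigr => k _.
  rewrite monoE -prodf_div.
  under eq_bigr => e _ do rewrite mxE -surjective_pairing.
  over.
rewrite -(bigA_distr_bigA (fun e (k : 'I_d.+1) => (w_root ^+ k) ^+ val b e / (w_root ^+ k) ^+ val a e)).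
under eq_bigr do rewrite (sum_prim_root w_rootP)//.
rewrite big_split/= prodr_const mulKf ?expf_neq0 ?pnatr_eq0//.
have [->|ab] := eqVneq a b; first by rewrite big1// => e _; rewrite eqxx.
have /existsP[e ae] : [exists e, val a e != val b e].
  rewrite -negb_forall; apply: contra ab => /forallP ab.
  by apply/eqP/val_inj/ffunP => e; exact/eqP.
have {}ae : (val b e == val a e :> nat) = false.
  by apply: contraNF ae => /eqP ab'; apply/eqP/val_inj.
by rewrite (bigD1 e)//= ae mul0r.
Qed.

Lemma mono_expand p : p = \sum_a mcoef a p *: mono a.
Proof.
have [c pE] := hpoly_word_expand p.
have pE' : (p : _ -> C) = fun A => \sum_w c w * mono (word_count w) A.
  by apply/funext => A; rewrite pE; apply: eq_bigr => w _; rewrite mono_word.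
apply: hpoly_ext => A; rewrite hpoly_sum {1}pE'.
under [RHS]eq_bigr => a _ do rewrite hpolyZ pE' mcoef_sum mulr_suml.
rewrite exchange_big; apply: eq_bigr => w _.
have mE a : mcoef a (fun A => mono (word_count w) A) = (a == word_count w)%:R.
  exact: mcoef_mono.
rewrite (bigD1 (word_count w)) // mE eqxx mulr1 big1 => [|a aw].
  exact/esym/addr0.
by rewrite mE (negbTE aw) mulr0 mul0r.
Qed.

End HPolyOps.

Arguments mono : simpl never.
Arguments htrans : simpl never.

(** * Integration over the unitary group *)

Section Topology.
Variables (R : realType) (n : nat).
Local Notation C := (Cplx R).
Local Notation B := (mxBorel R n).
Local Notation entry M i j := ((M : 'M[C]_n) i j).

Lemma open_entrywise (A : set 'M[C]_n) :
  (forall M, A M -> exists2 r : R, 0 < r & forall M' : 'M[C]_n, (forall i j, rnorm (M i j - M' i j) < r) -> A M') ->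
  open A.
Proof.
move=> AO; rewrite openE => M /AO[r r0 rA].
apply/nbhs_ballP; exists (RtoC r); first by rewrite /= -RtoC0 ltcR.
move=> M' [_ MM']; apply: rA => i j; have := MM' i j.
by rewrite -ball_normE/= -rnormE ltcR.
Qed.

Lemma measurable_open (A : set 'M[C]_n) : open A -> measurable (A : set B).
Proof. by move=> Ao; exact: sub_sigma_algebra. Qed.

Lemma measurable_mx (f : B -> B) :
  (forall M, exists2 K : R, 0 < K & forall M' r, (forall i j, rnorm (entry M i j - entry M' i j) < r) ->
    forall i j, rnorm (entry (f M) i j - entry (f M') i j) < K * r) ->
  measurable_fun setT f.
Proof.
move=> fK; apply: (@measurability _ _ B B setT f (@open 'M[C]_n)) => //.
move=> _ [A Ao <-]; rewrite setTI; apply: measurable_open; apply: open_entrywise => M AM.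
have /nbhs_ballP[e /= e0 eA] : nbhs (f M : 'M[C]_n) A by rewrite openE in Ao; exact: Ao.
have [K K0 MK] := fK M.
have [e1 eE] : exists e1, e = RtoC e1 by have /ltW/ger0_real/complex_realP := e0.
subst e; rewrite -RtoC0 ltcR in e0.
exists (e1 / K); first by rewrite divr_gt0.
move=> M' /MK H; apply: eA; split; first by rewrite -RtoC0 ltcR.
move=> i j; rewrite -ball_normE/= -rnormE ltcR; apply: lt_le_trans (H i j) _.
by rewrite mulrC divfK ?gt_eqF.
Qed.

End Topology.

Section ComplexMeasurable.
Variables (R : realType) (n : nat).
Local Notation C := (Cplx R).
Local Notation B := (mxBorel R n).
Local Notation entry M i j := ((M : 'M[C]_n) i j).
Local Notation Re := (@complex.Re R).
Local Notation Im := (@complex.Im R).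

Lemma rnorm_sqrt (z : C) : rnorm z = Num.sqrt (Re z ^+ 2 + Im z ^+ 2).
Proof. by case: z. Qed.

Lemma Re_le_rnorm (z : C) : `|Re z| <= rnorm z.
Proof. by rewrite rnorm_sqrt -sqrtr_sqr ler_wsqrtr// lerDl sqr_ge0. Qed.

Lemma Im_le_rnorm (z : C) : `|Im z| <= rnorm z.
Proof. by rewrite rnorm_sqrt -sqrtr_sqr ler_wsqrtr// lerDr sqr_ge0. Qed.

Lemma cReD (z w : C) : Re (z + w) = Re z + Re w. Proof. by case: z; case: w. Qed.
Lemma cImD (z w : C) : Im (z + w) = Im z + Im w. Proof. by case: z; case: w. Qed.
Lemma cReN (z : C) : Re (- z) = - Re z. Proof. by case: z. Qed.
Lemma cImN (z : C) : Im (- z) = - Im z. Proof. by case: z. Qed.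
Lemma cReM (z w : C) : Re (z * w) = Re z * Re w - Im z * Im w.
Proof. by case: z; case: w. Qed.
Lemma cImM (z w : C) : Im (z * w) = Re z * Im w + Im z * Re w.
Proof. by case: z; case: w. Qed.
Lemma conjCE (z : C) : z^* = (conjc z : C).
Proof.
have [->|z0] := eqVneq z 0; first by rewrite conjC0 /= oppr0.
apply: (mulfI z0); rewrite -normCK.
by case: z z0 => a b _; rewrite normc_def -rmorphXn sqr_sqrtr ?addr_ge0 ?sqr_ge0//=;
  apply/eqP; rewrite eq_complex; apply/andP; split; apply/eqP; rewrite ?cReM ?cImM/=; ring.
Qed.
Lemma cRe_conj (z : C) : Re z^* = Re z. Proof. by rewrite conjCE; case: z. Qed.
Lemma cIm_conj (z : C) : Im z^* = - Im z. Proof. by rewrite conjCE; case: z. Qed.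

Lemma measurable_coord (f : C -> R) i j :
  (forall z w, `|f z - f w| <= rnorm (z - w)) ->
  measurable_fun (setT : set B) (fun M : B => f (entry M i j)).
Proof.
move=> fL; apply: (measurability _ (measurable_realfun.RGenInftyO.measurableE R)).
move=> _ [_ [x ->] <-]; rewrite setTI; apply: measurable_open.
apply: open_entrywise => M; rewrite /= in_itv/= => Mx.
exists (x - f (M i j)); first by rewrite subr_gt0.
move=> M' /(_ i j) MM'; rewrite in_itv/=.
have := le_lt_trans (fL _ _) MM'; rewrite ltr_distlC => /andP[_].
by rewrite addrC subrK.
Qed.

Definition cmeas (D : set B) (f : B -> C) :=
  measurable_fun D (Re \o f) /\ measurable_fun D (Im \o f).

Variable D : set B.

Lemma cmeas_coord i j : cmeas D (fun M => entry M i j).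
Proof.
split; apply: (@measurable_funTS _ _ _ _ D).
  apply: (@measurable_coord Re) => z w.
  by apply: le_trans (Re_le_rnorm _); rewrite cReD cReN.
apply: (@measurable_coord Im) => z w.
by apply: le_trans (Im_le_rnorm _); rewrite cImD cImN.
Qed.

Lemma cmeas_cst (c : C) : cmeas D (fun=> c).
Proof. by split; exact: measurable_cst. Qed.

Lemma cmeasD (f g : B -> C) : cmeas D f -> cmeas D g -> cmeas D (fun x => f x + g x).
Proof.
move=> [f1 f2] [g1 g2]; split.
  by rewrite (_ : _ \o _ = (Re \o f) \+ (Re \o g)); [exact: measurable_funD|apply/funext => x /=; rewrite cReD].
by rewrite (_ : _ \o _ = (Im \o f) \+ (Im \o g)); [exact: measurable_funD|apply/funext => x /=; rewrite cImD].
Qed.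

Lemma cmeasM (f g : B -> C) : cmeas D f -> cmeas D g -> cmeas D (fun x => f x * g x).
Proof.
move=> [f1 f2] [g1 g2]; split.
  rewrite (_ : _ \o _ = ((Re \o f) \* (Re \o g)) \- ((Im \o f) \* (Im \o g))).
    by apply: measurable_funB; exact: measurable_funM.
  by apply/funext => x /=; rewrite cReM.
rewrite (_ : _ \o _ = ((Re \o f) \* (Im \o g)) \+ ((Im \o f) \* (Re \o g))).
  by apply: measurable_funD; exact: measurable_funM.
by apply/funext => x /=; rewrite cImM.
Qed.

Lemma cmeas_conj (f : B -> C) : cmeas D f -> cmeas D (fun x => (f x)^*).
Proof.
move=> [f1 f2]; split.
  by rewrite (_ : _ \o _ = Re \o f)//; apply/funext => x /=; rewrite cRe_conj.
rewrite (_ : _ \o _ = \- (Im \o f)); first exact: measurable_funN.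
by apply/funext => x /=; rewrite cIm_conj.
Qed.

Lemma cmeas_RtoC (f : B -> R) : measurable_fun D f -> cmeas D (fun x => RtoC (f x)).
Proof. by move=> mf; split => //; exact: measurable_cst. Qed.

Lemma cmeas_sum (I : Type) (s : seq I) (F : I -> B -> C) :
  (forall i, cmeas D (F i)) -> cmeas D (fun x => \sum_(i <- s) F i x).
Proof.
move=> mF; elim: s => [|i s IH].
  by under [X in cmeas _ X]eq_fun do rewrite big_nil; exact: cmeas_cst.
by under [X in cmeas _ X]eq_fun do rewrite big_cons; exact: cmeasD.
Qed.

Lemma cmeas_prod (I : Type) (s : seq I) (F : I -> B -> C) :
  (forall i, cmeas D (F i)) -> cmeas D (fun x => \prod_(i <- s) F i x).
Proof.
move=> mF; elim: s => [|i s IH].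
  by under [X in cmeas _ X]eq_fun do rewrite big_nil; exact: cmeas_cst.
by under [X in cmeas _ X]eq_fun do rewrite big_cons; exact: cmeasM.
Qed.

Lemma measurable_rnorm (f : B -> C) : cmeas D f -> measurable_fun D (fun x => rnorm (f x)).
Proof.
move=> [f1 f2]; rewrite (_ : (fun x => _) = (@powR R ^~ (2^-1)) \o
   (fun x => (Re (f x)) ^+ 2 + (Im (f x)) ^+ 2)).
  apply: measurableT_comp; first exact: measurable_powR.
  by apply: measurable_funD; apply: measurable_funX.
by apply/funext => x /=; rewrite powR12_sqrt ?addr_ge0 ?sqr_ge0// rnorm_sqrt.
Qed.

Lemma cmeas_hpoly d (p : hpoly R d n) : cmeas D p.
Proof.
have [c pE] := hpoly_word_expand p.
rewrite (_ : (p : B -> C) = fun x => \sum_w c w * \prod_k entry x (w k).1 (w k).2); last exact/funext.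
apply: cmeas_sum => w; apply: cmeasM; first exact: cmeas_cst.
by apply: cmeas_prod => k; exact: cmeas_coord.
Qed.

Lemma cmeas_mul (F G : B -> B) i j : (forall i j, cmeas D (fun x => entry (F x) i j)) ->
  (forall i j, cmeas D (fun x => entry (G x) i j)) -> cmeas D (fun x => entry ((F x : 'M[C]_n) *m (G x : 'M[C]_n)) i j).
Proof.
move=> mF mG; under [X in cmeas _ X]eq_fun do rewrite mxE.
by apply: cmeas_sum => k; apply: cmeasM.
Qed.

Lemma cmeas_mxpow k i j : cmeas D (fun x => entry ((x : 'M[C]_n) ^+ k) i j).
Proof.
elim: k i j => [|k IH] i j.
  by under [X in cmeas _ X]eq_fun do rewrite expr0; exact: cmeas_cst.
under [X in cmeas _ X]eq_fun do rewrite exprS.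
by apply: (@cmeas_mul id (fun x => (x : 'M[C]_n) ^+ k)) => // ? ?; exact: cmeas_coord.
Qed.

Lemma cmeas_trpow k : cmeas D (fun x => \tr ((x : 'M[C]_n) ^+ k)).
Proof. by apply: cmeas_sum => i; exact: cmeas_mxpow. Qed.

End ComplexMeasurable.

Definition mxsum (R : realType) (n : nat) (u : 'M[Cplx R]_n) : R := \sum_i \sum_j rnorm (u i j).

Section MxSum.
Variables (R : realType) (n : nat).
Implicit Types u : 'M[Cplx R]_n.

Lemma mxsum_ge0 u : 0 <= mxsum u.
Proof. by apply: sumr_ge0 => i _; apply: sumr_ge0 => j _; exact: rnorm_ge0. Qed.

Lemma entry_le_mxsum u i j : rnorm (u i j) <= mxsum u.
Proof.
rewrite /mxsum (bigD1 i)//= (bigD1 j)//= -addrA lerDl addr_ge0// sumr_ge0// => k _.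
  exact: rnorm_ge0.
by apply: sumr_ge0 => l _; exact: rnorm_ge0.
Qed.

End MxSum.

Section UnitaryMeasurable.
Variables (R : realType) (n : nat).
Local Notation C := (Cplx R).
Local Notation B := (mxBorel R n).
Local Notation U := (@unitary_group R n : set B).

Lemma measurable_unitary_group : measurable U.
Proof.
pose f i j (x : B) : C := ((x : 'M[C]_n) *m (x : 'M[C]_n)^t* - 1%:M) i j.
have mf i j : cmeas setT (f i j).
  under [X in cmeas _ X]eq_fun do rewrite /f mxE.
  apply: cmeasD; last exact: cmeas_cst.
  apply: (@cmeas_mul _ _ _ id (fun x => ((x : 'M[C]_n)^t*) : B)) => k l; first exact: cmeas_coord.
  under [X in cmeas _ X]eq_fun do rewrite !mxE.
  by apply: cmeas_conj; exact: cmeas_coord.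
have -> : U = \bigcap_(i in [set: 'I_n]) \bigcap_(j in [set: 'I_n])
    ((fun x => rnorm (f i j x)) @^-1` [set 0]).
  apply/seteqP; split => [x /unitarymxP xU i _ j _|x xU].
    by rewrite /preimage/= /f xU subrr mxE rnorm0.
  apply/unitarymxP/matrixP => i j; apply/eqP; rewrite -subr_eq0; apply/eqP.
  have := rnorm_eq0 (xU i I j I); rewrite /f => <-.
  by rewrite [RHS]mxE [X in _ = _ + X]mxE.
apply: fin_bigcap_measurable => // i _; apply: fin_bigcap_measurable => // j _.
by rewrite -[X in measurable X]setTI; apply: measurable_rnorm.
Qed.

Lemma measurable_mulmx (u v : 'M[C]_n) :
  measurable_fun (setT : set B) (fun x : B => (u *m (x : 'M[C]_n) *m v) : B).
Proof.
apply: measurable_mx => M.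
pose K : R := \sum_(l < n) \sum_(k < n) mxsum u * mxsum v.
exists (K + 1); first by rewrite ltr_wpDl// sumr_ge0// => l _; rewrite sumr_ge0// => k _;
  rewrite mulr_ge0// mxsum_ge0.
move=> M' r MM' i j.
have r0 : 0 < r by apply: le_lt_trans (MM' i j); exact: rnorm_ge0.
rewrite mulrDl mul1r; apply: le_lt_trans (_ : K * r < _); last by rewrite ltrDl.
have -> : (u *m (M : 'M[C]_n) *m v) i j - (u *m (M' : 'M[C]_n) *m v) i j =
   \sum_l \sum_k u i k * ((M : 'M[C]_n) k l - (M' : 'M[C]_n) k l) * v l j.
  transitivity ((u *m ((M : 'M[C]_n) - M') *m v) i j).
    by rewrite mulmxBr mulmxBl [RHS]mxE [X in _ = _ + X]mxE.
  rewrite mxE; apply: eq_bigr => l _; rewrite mxE mulr_suml; apply: eq_bigr => k _.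
  by rewrite [X in _ * X * _ = _]mxE [X in _ * (_ + X) * _ = _]mxE.
apply: le_trans (rnorm_sum _ _ _) _.
rewrite /K mulr_suml; apply: ler_sum => l _; rewrite mulr_suml.
apply: le_trans (rnorm_sum _ _ _) _; apply: ler_sum => k _.
rewrite !rnormM mulrAC; apply: ler_pM; rewrite ?mulr_ge0 ?rnorm_ge0//.
  by apply: ler_pM; rewrite ?rnorm_ge0 ?entry_le_mxsum.
exact: ltW.
Qed.

End UnitaryMeasurable.

Lemma unitary_groupM (R : realType) (n : nat) (u v : 'M[Cplx R]_n) :
  unitary_group u -> unitary_group v -> unitary_group (u *m v).
Proof. exact: mul_unitarymx. Qed.

Lemma unitary_groupM3 (R : realType) (n : nat) (u x v : 'M[Cplx R]_n) :
  unitary_group u -> unitary_group x -> unitary_group v -> unitary_group (u *m x *m v).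
Proof. by move=> Uu Ux; apply: unitary_groupM; exact: unitary_groupM. Qed.

Lemma unitary_groupV (R : realType) (n : nat) (u : 'M[Cplx R]_n) :
  unitary_group u -> unitary_group (u^t*).
Proof. by move=> Uu; rewrite /unitary_group/= trmxC_unitary. Qed.

Lemma unitary_group1 (R : realType) (n : nat) : unitary_group (1%:M : 'M[Cplx R]_n).
Proof. by apply/unitarymxP; rewrite mul1mx trmx1 map_mx1. Qed.

(** * Expectations of bounded functions under Haar measure *)

Section Expectation.
Variables (R : realType) (n : nat) (mu : probability (mxBorel R n) R).
Hypothesis muP : is_haar mu.
Local Notation C := (Cplx R).
Local Notation B := (mxBorel R n).
Local Notation U := (@unitary_group R n : set B).
Local Notation Re := (@complex.Re R).
Local Notation Im := (@complex.Im R).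

(** Both conditions concern the unitary group only, since nonconstant polynomials are unbounded on
    the space of all matrices. *)
Definition bmeas (f : B -> R) :=
  measurable_fun U f /\ exists M, forall g, U g -> `|f g| <= M.

Definition ER (f : B -> R) : R := \int[mu]_(g in U) f g.

Let mU : measurable U. Proof. exact: measurable_unitary_group. Qed.
Let muU : mu U = 1%E. Proof. by case: muP. Qed.

Lemma bmeas_integrable (f : B -> R) : bmeas f -> mu.-integrable U (EFin \o f).
Proof.
move=> [mf [M fM]]; apply: measurable_bounded_integrable => //.
  by rewrite [X in (X < _)%E]muU ltry.
exists M; split; first exact: num_real.
by move=> x Mx g Ug; apply: le_trans (fM g Ug) (ltW Mx).
Qed.

Lemma ERE (f : B -> R) : bmeas f -> (\int[mu]_(g in U) (f g)%:E)%E = (ER f)%:E.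
Proof.
by move=> /bmeas_integrable fi; rewrite /ER /Rintegral fineK//; exact: integrable_fin_num.
Qed.

Lemma eq_ER (f g : B -> R) : (forall x, U x -> f x = g x) -> ER f = ER g.
Proof. by move=> fg; apply: eq_Rintegral => x /set_mem; exact: fg. Qed.

Lemma bmeas_cst c : bmeas (fun=> c).
Proof. by split; [exact: measurable_cst|exists `|c|]. Qed.

Lemma bmeasD f g : bmeas f -> bmeas g -> bmeas (fun x => f x + g x).
Proof.
move=> [mf [M fM]] [mg [N gN]]; split; first exact: measurable_funD.
by exists (M + N) => x Ux; apply: le_trans (ler_normD _ _) _; rewrite lerD ?fM ?gN.
Qed.

Lemma bmeasM f g : bmeas f -> bmeas g -> bmeas (fun x => f x * g x).
Proof.
move=> [mf [M fM]] [mg [N gN]]; split; first exact: measurable_funM.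
by exists (M * N) => x Ux; rewrite normrM ler_pM ?fM ?gN.
Qed.

Lemma bmeasN f : bmeas f -> bmeas (fun x => - f x).
Proof.
move=> [mf [M fM]]; split; first exact: measurable_funN.
by exists M => x Ux; rewrite normrN fM.
Qed.

Lemma bmeasX f k : bmeas f -> bmeas (fun x => f x ^+ k).
Proof.
move=> bf; elim: k => [|k IH].
  by under [X in bmeas X]eq_fun do rewrite expr0; exact: bmeas_cst.
by under [X in bmeas X]eq_fun do rewrite exprS; exact: bmeasM.
Qed.

Lemma bmeas_sum (I : Type) (s : seq I) (F : I -> B -> R) :
  (forall i, bmeas (F i)) -> bmeas (fun x => \sum_(i <- s) F i x).
Proof.
move=> mF; elim: s => [|i s IH].
  by under [X in bmeas X]eq_fun do rewrite big_nil; exact: bmeas_cst.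
by under [X in bmeas X]eq_fun do rewrite big_cons; exact: bmeasD.
Qed.

Lemma bmeas_indic (A : set B) : measurable A -> bmeas (\1_A : B -> R).
Proof.
move=> mA; split; first exact/measurable_funTS/measurable_indic.
by exists 1 => x _; rewrite indicE; case: (x \in A); rewrite ?normr1 ?normr0.
Qed.

Lemma ER_cst c : ER (fun=> c) = c.
Proof. by rewrite /ER Rintegral_cst// [X in fine X]muU mulr1. Qed.

Lemma ERD f g : bmeas f -> bmeas g -> ER (fun x => f x + g x) = ER f + ER g.
Proof. by move=> /bmeas_integrable fi /bmeas_integrable gi; exact: RintegralD. Qed.

Lemma ERZ c f : bmeas f -> ER (fun x => c * f x) = c * ER f.
Proof. by move=> /bmeas_integrable fi; exact: RintegralZl. Qed.

Lemma ERN f : bmeas f -> ER (fun x => - f x) = - ER f.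
Proof.
move=> bf; rewrite -mulN1r -ERZ//; apply: eq_ER => x _.
by rewrite mulN1r.
Qed.

Lemma ERB f g : bmeas f -> bmeas g -> ER (fun x => f x - g x) = ER f - ER g.
Proof. by move=> bf bg; rewrite ERD ?ERN//; exact: bmeasN. Qed.

Lemma ER_sum (I : Type) (s : seq I) (F : I -> B -> R) :
  (forall i, bmeas (F i)) -> ER (fun x => \sum_(i <- s) F i x) = \sum_(i <- s) ER (F i).
Proof.
move=> mF; elim: s => [|i s IH].
  by rewrite big_nil -[RHS](ER_cst 0); apply: eq_ER => x _; rewrite big_nil.
rewrite big_cons -IH -ERD//; last exact: bmeas_sum.
by apply: eq_ER => x _; rewrite big_cons.
Qed.

Lemma ER_le f g : bmeas f -> bmeas g -> (forall x, U x -> f x <= g x) -> ER f <= ER g.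
Proof. by move=> /bmeas_integrable fi /bmeas_integrable gi fg; exact: le_Rintegral. Qed.

Lemma ER_ge0 f : (forall x, U x -> 0 <= f x) -> 0 <= ER f.
Proof. exact: Rintegral_ge0. Qed.

Lemma bmeas_mulmx (u v : 'M[C]_n) f : U u -> U v -> bmeas f ->
  bmeas (fun x => f (u *m (x : 'M[C]_n) *m v)).
Proof.
move=> Uu Uv [mf [M fM]].
have UU x : U x -> U (u *m (x : 'M[C]_n) *m v) by move=> Ux; exact: unitary_groupM3.
pose L (x : B) : B := u *m (x : 'M[C]_n) *m v.
split; last by exists M => x Ux; apply/fM/UU.
apply: (@measurable_comp _ _ _ _ _ _ U f U L).
- exact: mU.
- by move=> _ [x Ux <-]; exact: UU.
- exact: mf.
- by apply: measurable_funTS; exact: (measurable_mulmx u v).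
Qed.

Lemma ER_mulmx (u v : 'M[C]_n) f : U u -> U v -> bmeas f ->
  ER (fun x => f (u *m (x : 'M[C]_n) *m v)) = ER f.
Proof.
move=> Uu Uv bf; have [mf [M fM]] := bf.
pose L (x : B) : B := u *m (x : 'M[C]_n) *m v.
have mL : measurable_fun setT L := measurable_mulmx u v.
have UU x : U x <-> U (L x).
  split=> [Ux|H]; first exact: unitary_groupM3.
  rewrite (_ : (x : 'M[C]_n) = u^t* *m (u *m (x : 'M[C]_n) *m v) *m v^t*).
    exact: (unitary_groupM3 (unitary_groupV Uu) H (unitary_groupV Uv)).
  rewrite !mulmxA (unitary_mulVmx Uu) mul1mx -mulmxA.
  by rewrite (unitarymxP Uv) mulmx1.
have Lmu (A : set B) : measurable A -> mu (L @^-1` A) = mu A.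
  move=> mA; have [_ lm rm] := muP.
  rewrite -(lm u A Uu mA).
  have mA' : measurable ([set h | A (u *m (h : 'M[C]_n))] : set B).
    have := measurable_mulmx u 1%:M; move=> /(_ measurableT _ mA); rewrite setTI.
    by congr measurable; apply/seteqP; split => h; rewrite /preimage/= mulmx1.
  by rewrite -(rm v _ Uv mA'); congr (mu _); apply/seteqP; split => h; rewrite /L /preimage/= ?mulmxA.
(* The change of variables is applied to nonnegative functions, so [f] is shifted by its bound [M]
   and the constant is cancelled afterwards. *)
suff H (h : B -> R) : measurable_fun U h -> (forall x, U x -> 0 <= h x) -> bmeas h -> ER (h \o L) = ER h.
  have bM : bmeas (fun x => f x + M) by apply: bmeasD => //; exact: bmeas_cst.
  have := H (fun x => f x + M) (proj1 bM).
  have fM0 x : U x -> 0 <= f x + M.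
    by move=> /fM; rewrite ler_norml => /andP[]; rewrite -subr_ge0 opprK.
  move=> /(_ fM0 bM); rewrite [RHS]ERD//; last exact: bmeas_cst.
  rewrite [LHS](ERD (bmeas_mulmx Uu Uv bf)); last exact: bmeas_cst.
  by move/addIr.
move=> mh h0 bh; rewrite /ER /Rintegral; congr fine.
have LU : U = L @^-1` U.
  by apply/seteqP; split => x Ux; [exact: (proj1 (UU x) Ux)|exact: (proj2 (UU x) Ux)].
have mh' : measurable_fun U (EFin \o h) by exact/measurable_EFinP.
have h0' : {in U, forall x, (0 <= (EFin \o h) x)%E}.
  by move=> x /set_mem /h0; rewrite lee_fin.
rewrite [in LHS]LU.
apply: etrans (esym (@ge0_integral_pushforward _ _ _ _ R L mL mu U (EFin \o h) mU mh' h0')) _.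
by apply: eq_measure_integral => A mA _; exact: Lmu.
Qed.

Definition cbm (f : B -> C) := cmeas U f /\ exists M, forall g, U g -> rnorm (f g) <= M.

Definition EC (f : B -> C) : C := Complex (ER (Re \o f)) (ER (Im \o f)).

Lemma cbm_Re f : cbm f -> bmeas (Re \o f).
Proof.
by move=> [[f1 _] [M fM]]; split => //; exists M => g Ug; apply: le_trans (Re_le_rnorm _) (fM g Ug).
Qed.

Lemma cbm_Im f : cbm f -> bmeas (Im \o f).
Proof.
by move=> [[_ f2] [M fM]]; split => //; exists M => g Ug; apply: le_trans (Im_le_rnorm _) (fM g Ug).
Qed.

Lemma cbm_rnorm f : cbm f -> bmeas (fun x => rnorm (f x)).
Proof.
move=> [mf [M fM]]; split; first exact: measurable_rnorm.
by exists M => g Ug; rewrite ger0_norm ?rnorm_ge0 ?fM.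
Qed.

Lemma cbm_cst c : cbm (fun=> c).
Proof. by split; [exact: cmeas_cst|exists (rnorm c)]. Qed.

Lemma cbm_RtoC f : bmeas f -> cbm (fun x => RtoC (f x)).
Proof.
move=> [mf [M fM]]; split; first exact: cmeas_RtoC.
exists M => g Ug; rewrite rnorm_sqrt/= expr0n addr0 sqrtr_sqr; exact: fM.
Qed.

Lemma cbmD f g : cbm f -> cbm g -> cbm (fun x => f x + g x).
Proof.
move=> [mf [M fM]] [mg [N gN]]; split; first exact: cmeasD.
by exists (M + N) => x Ux; apply: le_trans (rnormD _ _) _; rewrite lerD ?fM ?gN.
Qed.

Lemma cbmM f g : cbm f -> cbm g -> cbm (fun x => f x * g x).
Proof.
move=> [mf [M fM]] [mg [N gN]]; split; first exact: cmeasM.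
by exists (M * N) => x Ux; rewrite rnormM ler_pM ?rnorm_ge0 ?fM ?gN.
Qed.

Lemma rnorm_conj (z : C) : rnorm (z^*) = rnorm z.
Proof. by rewrite !rnorm_sqrt cRe_conj cIm_conj sqrrN. Qed.

Lemma cbm_conj f : cbm f -> cbm (fun x => (f x)^*).
Proof.
move=> [mf [M fM]]; split; first exact: cmeas_conj.
by exists M => x Ux; rewrite rnorm_conj fM.
Qed.

Lemma cbm_sum (I : Type) (s : seq I) (F : I -> B -> C) :
  (forall i, cbm (F i)) -> cbm (fun x => \sum_(i <- s) F i x).
Proof.
move=> mF; elim: s => [|i s IH].
  by under [X in cbm X]eq_fun do rewrite big_nil; exact: cbm_cst.
by under [X in cbm X]eq_fun do rewrite big_cons; exact: cbmD.
Qed.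

Lemma cbm_hpoly d (p : hpoly R d n) : cbm p.
Proof.
split; first exact: cmeas_hpoly.
by exists (hpoly_norm p) => g Ug; apply/hpoly_norm_ub/unitary_op_ball.
Qed.

Lemma cbm_mulmx (u v : 'M[C]_n) f : U u -> U v -> cbm f ->
  cbm (fun x => f (u *m (x : 'M[C]_n) *m v)).
Proof.
move=> Uu Uv cf; have [[mf1 mf2] [M fM]] := cf.
split; first by split; [have [] := bmeas_mulmx Uu Uv (cbm_Re cf)|have [] := bmeas_mulmx Uu Uv (cbm_Im cf)].
by exists M => x Ux; apply: fM; exact: unitary_groupM3.
Qed.

Lemma complex_ext (z w : C) : Re z = Re w -> Im z = Im w -> z = w.
Proof. by case: z; case: w => ? ? ? ? /= -> ->. Qed.

Lemma eq_EC f g : (forall x, U x -> f x = g x) -> EC f = EC g.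
Proof.
by move=> fg; apply: complex_ext; apply: eq_ER => x Ux /=; rewrite fg.
Qed.

Lemma EC_mulmx (u v : 'M[C]_n) f : U u -> U v -> cbm f ->
  EC (fun x => f (u *m (x : 'M[C]_n) *m v)) = EC f.
Proof.
move=> Uu Uv cf; apply: complex_ext.
  exact: (ER_mulmx Uu Uv (cbm_Re cf)).
exact: (ER_mulmx Uu Uv (cbm_Im cf)).
Qed.

Lemma EC_cst c : EC (fun=> c) = c.
Proof. by apply: complex_ext; exact: ER_cst. Qed.

Lemma EC_RtoC f : EC (fun x => RtoC (f x)) = RtoC (ER f).
Proof. by apply: complex_ext => //=; exact: ER_cst. Qed.

Lemma ECD f g : cbm f -> cbm g -> EC (fun x => f x + g x) = EC f + EC g.
Proof.
move=> cf cg; apply: complex_ext; rewrite ?cReD ?cImD -ERD/=;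
  try exact: cbm_Re; try exact: cbm_Im; apply: eq_ER => x _ /=; rewrite ?cReD ?cImD//.
Qed.

Lemma ECZ c f : cbm f -> EC (fun x => c * f x) = c * EC f.
Proof.
move=> cf; have fR := cbm_Re cf; have fI := cbm_Im cf.
have Z a b F G : bmeas F -> bmeas G -> bmeas (fun x : B => a * F x) /\ bmeas (fun x : B => b * G x).
  by move=> bF bG; split; apply: bmeasM => //; exact: bmeas_cst.
apply: complex_ext; rewrite ?cReM ?cImM/= -!ERZ// -?ERB -?ERD//; try by case: (Z _ _ _ _ fR fI _ _).
all: try (by apply: bmeasM => //; exact: bmeas_cst).
all: by apply: eq_ER => x _ /=; rewrite ?cReM ?cImM.
Qed.

Lemma EC_sum (I : Type) (s : seq I) (F : I -> B -> C) :
  (forall i, cbm (F i)) -> EC (fun x => \sum_(i <- s) F i x) = \sum_(i <- s) EC (F i).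
Proof.
move=> mF; elim: s => [|i s IH].
  by rewrite big_nil -[RHS](EC_cst 0); apply: eq_EC => x _; rewrite big_nil.
rewrite big_cons -IH -ECD//; last exact: cbm_sum.
by apply: eq_EC => x _; rewrite big_cons.
Qed.

Lemma EC_conj f : cbm f -> EC (fun x => (f x)^*) = (EC f)^*.
Proof.
move=> cf; apply: complex_ext; rewrite ?cRe_conj ?cIm_conj/= -?ERN; try exact: cbm_Im;
 by apply: eq_ER => x _ /=; rewrite ?cRe_conj ?cIm_conj.
Qed.

End Expectation.

(** * Finite sampling of Haar integrals of Lipschitz functions *)

Section Discretization.
Variables (R : realType) (n : nat) (mu : probability (mxBorel R n) R).
Hypothesis muP : is_haar mu.
Local Notation C := (Cplx R).
Local Notation B := (mxBorel R n).
Local Notation U := (@unitary_group R n : set B).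
Local Notation Re := (@complex.Re R).
Local Notation Im := (@complex.Im R).
Implicit Types g h : 'M[C]_n.

Definition rlip (f : 'M[C]_n -> R) (L : R) :=
  0 <= L /\ forall g h, unitary_group g -> unitary_group h -> `|f g - f h| <= L * mxsum (g - h).

Lemma rnorm_le_ReIm (z : C) : rnorm z <= `|Re z| + `|Im z|.
Proof.
rewrite rnorm_sqrt -(ler_pXn2r (n := 2)) ?nnegrE ?sqrtr_ge0 ?addr_ge0//.
rewrite sqr_sqrtr ?addr_ge0 ?sqr_ge0// sqrrD !real_normK ?num_real//.
by rewrite -addrA lerD2l lerDr mulrn_wge0// mulr_ge0.
Qed.

Let coordv (e : 'I_n * 'I_n * bool) g : R :=
  if e.2 then Re (g e.1.1 e.1.2) else Im (g e.1.1 e.1.2).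

Let coordv_le e g : unitary_group g -> -1 <= coordv e g <= 1.
Proof.
move=> /unitary_op_ball/op_ball_coord gb; rewrite -ler_norml /coordv.
case: e.2; [apply: le_trans (Re_le_rnorm _) _|apply: le_trans (Im_le_rnorm _) _]; exact: gb.
Qed.

Let measurable_coordv e : measurable_fun setT (coordv e : B -> R).
Proof.
by rewrite /coordv; case: e.2; have [] := @cmeas_coord R n setT e.1.1 e.1.2.
Qed.

(** The cells are boxes for the real and imaginary parts of all entries, cut down to the group, and
    the weights are their Haar masses. One partition serves all Lipschitz functions at once, whence
    an error of the form [L * delta]. The last clause isolates a single cell; it is what lets a
    vanishing integral yield a pointwise bound. *)
Lemma discretization (delta : R) : 0 < delta ->
  exists (I : finType) (w : I -> R) (x : I -> 'M[C]_n),
  [/\ forall i, 0 <= w i, \sum_i w i = 1, forall i, unitary_group (x i),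
    forall f L, bmeas (f : B -> R) -> rlip f L ->
      `|ER mu f - \sum_i w i * f (x i)| <= L * delta &
    forall f L i, bmeas (f : B -> R) -> (forall g, unitary_group g -> 0 <= f g) -> rlip f L ->
      w i * (f (x i) - L * delta) <= ER mu f].
Proof.
move=> d0.
pose N := (Num.truncn ((n ^ 2)%:R * 2 / delta)).+1.
have N0 : 0 < N%:R :> R by rewrite ltr0n.
have Nd : (n ^ 2)%:R * (2 / N%:R) <= delta.
  by rewrite mulrA ler_pdivrMr// -ler_pdivrMl// mulrC; apply/ltW/truncnS_gt.
(* [N] times the coordinate shifted by 1 ranges over [[0, 2 N]] with the right end included, hence
   [2 N + 1] integer parts. *)
pose I := {ffun 'I_n * 'I_n * bool -> 'I_(2 * N).+1}.
pose A (k : I) : set B := U `&` \bigcap_(e in [set: 'I_n * 'I_n * bool])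
  (coordv e @^-1` `[(k e)%:R / N%:R - 1, (k e).+1%:R / N%:R - 1[%classic).
have mA k : measurable (A k).
  apply: measurableI; first exact: measurable_unitary_group.
  apply: fin_bigcap_measurable => // e _.
  by rewrite -[X in measurable X]setTI; apply: measurable_coordv.
pose q g : I := [ffun e => inord (Num.truncn (N%:R * (coordv e g + 1)))].
have qE g k : U g -> (g \in A k) = (k == q g).
  move=> Ug.
  have v1 e : 0 <= N%:R * (coordv e g + 1) <= (2 * N)%:R.
    have /andP[a b] := coordv_le e Ug; rewrite pmulr_rge0// -lerBlDr sub0r a/=.
    by rewrite mulnC natrM ler_pM2l//; move: b; lra.
  have tE e : q g e = Num.truncn (N%:R * (coordv e g + 1)) :> nat.
    rewrite ffunE inordK// ltnS -(ler_nat R); have /andP[a b] := v1 e.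
    by apply: le_trans b; rewrite truncn_le.
  have itvE e (m : nat) : (m%:R / N%:R - 1 <= coordv e g < m.+1%:R / N%:R - 1) =
      (m == Num.truncn (N%:R * (coordv e g + 1))).
    have /andP[a _] := v1 e.
    by rewrite lerBlDr ltrBrDr ler_pdivrMr// ltr_pdivlMr// ![_ * N%:R]mulrC -truncn_eq// eq_sym.
  apply/idP/eqP => [/set_mem[_ gA]|->].
    apply/ffunP => e; apply/val_inj; rewrite /= tE; apply/eqP; rewrite -itvE.
    by have := gA e Logic.I; rewrite /= in_itv.
  by apply/mem_set; split => // e _; rewrite /preimage/= in_itv/= itvE tE.
(* An empty cell gets the identity as its sample point; its weight is 0. *)
have xE k : exists x : 'M[C]_n, unitary_group x /\ ((exists g, A k g) -> A k x).
  have [[x Ax]|nA] := pselect (exists g, A k g); first by exists x; split => //; case: Ax.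
  by exists 1%:M; split; [exact: unitary_group1|move=> /nA].
have /choice[x {}xE] := xE.
have closeA k g h : A k g -> A k h -> mxsum (g - h) <= delta.
  move=> [_ Ag] [_ Ah]; apply: le_trans Nd.
  have -> : (n ^ 2)%:R * (2 / N%:R) = \sum_(i < n) \sum_(j < n) (2 / N%:R) :> R.
    by rewrite !sumr_const !card_ord -mulrnA mulr_natl.
  apply: ler_sum => i _; apply: ler_sum => j _.
  have cl b : `|coordv (i, j, b) g - coordv (i, j, b) h| <= N%:R^-1.
    have := Ag (i, j, b) Logic.I; have := Ah (i, j, b) Logic.I; rewrite /= !in_itv/=.
    have -> : (k (i, j, b)).+1%:R / N%:R = (k (i, j, b))%:R / N%:R + N%:R^-1 :> R.
      by rewrite -natr1 mulrDl mul1r.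
    by rewrite ler_norml => /andP[a1 a2] /andP[b1 b2]; lra.
  apply: le_trans (rnorm_le_ReIm _) _.
  have := cl true; have := cl false; rewrite /coordv/= => c1 c2.
  rewrite mxE [X in Re (_ + X)]mxE [X in Im (_ + X)]mxE cReD cReN cImD cImN.
  by rewrite mulr_natl mulr2n lerD.
have near f L g : rlip f L -> U g -> `|f g - f (x (q g))| <= L * delta.
  move=> [L0 fL] Ug; have Ag : A (q g) g by apply/set_mem; rewrite qE.
  apply: le_trans (fL _ _ Ug _) _; first by case: (xE (q g)).
  by rewrite ler_wpM2l//; apply: (closeA (q g)) => //; apply: (xE (q g)).2; exists g.
pose w k := ER mu (\1_(A k) : B -> R).
have bA k : bmeas (\1_(A k) : B -> R) by exact: bmeas_indic.
have bAc k c : bmeas (fun g : B => c * \1_(A k) g) by apply: bmeasM; [exact: bmeas_cst|].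
have stepE (F : I -> R) g : U g -> \sum_k F k * \1_(A k) g = F (q g).
  move=> Ug; rewrite (bigD1 (q g))//= indicE qE// eqxx mulr1 big1 ?addr0// => k kq.
  by rewrite indicE qE// (negbTE kq) mulr0.
have ERstep (F : I -> R) : ER mu (fun g => F (q g)) = \sum_k w k * F k.
  rewrite (@eq_ER R n mu _ (fun g => \sum_k F k * \1_(A k) g)); last first.
    by move=> g Ug; rewrite stepE.
  by rewrite ER_sum//; apply: eq_bigr => k _; rewrite ERZ// mulrC.
have bstep (F : I -> R) : bmeas (fun g : B => F (q g)).
  have [ms bs] : bmeas (fun g : B => \sum_k F k * \1_(A k) g) by exact: bmeas_sum.
  split; last first.
    by have [M sM] := bs; exists M => g Ug; rewrite -(stepE F)// sM.
  by apply: eq_measurable_fun ms => g /set_mem Ug; rewrite stepE.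
exists I, w, x; split.
- by move=> k; apply: ER_ge0 => g _; rewrite indicE.
- by rewrite -[RHS](ER_cst muP 1) (ERstep (fun=> 1)); apply: eq_bigr => k _; rewrite mulr1.
- by move=> k; case: (xE k).
- move=> f L bf fL.
  rewrite -(ERstep (fun k => f (x k))) -ERB//; last exact: (bstep (fun k => f (x k))).
  have bd : bmeas (fun g : B => f g - f (x (q g))).
    by apply: bmeasD => //; apply: bmeasN; exact: (bstep (fun k => f (x k))).
  rewrite ler_norml; apply/andP; split.
    rewrite -(ER_cst muP (- (L * delta))); apply: ER_le => //; first exact: bmeas_cst.
    by move=> g Ug; have := near _ _ _ fL Ug; rewrite ler_norml => /andP[].
  rewrite -(ER_cst muP (L * delta)); apply: ER_le => //; first exact: bmeas_cst.
  by move=> g Ug; have := near _ _ _ fL Ug; rewrite ler_norml => /andP[].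
- move=> f L k bf f0 fL; rewrite mulrC -ERZ//; apply: ER_le => // g Ug.
  rewrite indicE qE//; case: eqP => [->|_]; last by rewrite mulr0 f0.
  by rewrite mulr1 lerBlDr -lerBlDl; have := near _ _ _ fL Ug; rewrite distrC ler_norml => /andP[].
Qed.

End Discretization.

Section Lipschitz.
Variables (R : realType) (n : nat).
Local Notation C := (Cplx R).
Local Notation Re := (@complex.Re R).
Local Notation Im := (@complex.Im R).
Implicit Types g h u : 'M[C]_n.

Definition clip (f : 'M[C]_n -> C) (L : R) :=
  0 <= L /\ forall g h, unitary_group g -> unitary_group h -> rnorm (f g - f h) <= L * mxsum (g - h).

Definition clips f := exists L, clip f L.

Lemma rnormN (z : C) : rnorm (- z) = rnorm z. Proof. by rewrite /rnorm normrN. Qed.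

Lemma rnorm_dist (z w : C) : `|rnorm z - rnorm w| <= rnorm (z - w).
Proof.
have H (x y : C) : rnorm x - rnorm y <= rnorm (x - y).
  by rewrite lerBlDr -{1}(subrK y x) rnormD.
by rewrite ler_norml H andbT lerNl opprB -[leRHS]rnormN opprB H.
Qed.

Lemma clip_rnorm f L : clip f L -> rlip (fun g => rnorm (f g)) L.
Proof.
by move=> [L0 fL]; split=> // g h Ug Uh; apply: le_trans (rnorm_dist _ _) (fL g h Ug Uh).
Qed.

Lemma clip_Re f L : clip f L -> rlip (fun g => Re (f g)) L.
Proof.
move=> [L0 fL]; split=> // g h Ug Uh; apply: le_trans (fL g h Ug Uh).
by rewrite -cReN -cReD Re_le_rnorm.
Qed.

Lemma clip_Im f L : clip f L -> rlip (fun g => Im (f g)) L.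
Proof.
move=> [L0 fL]; split=> // g h Ug Uh; apply: le_trans (fL g h Ug Uh).
by rewrite -cImN -cImD Im_le_rnorm.
Qed.

Lemma unitary_mxsum g h : unitary_group g -> unitary_group h -> mxsum (g - h) <= (n ^ 2)%:R * 2.
Proof.
move=> Ug Uh.
have -> : (n ^ 2)%:R * 2 = \sum_(i < n) \sum_(j < n) 2 :> R.
  by rewrite !sumr_const !card_ord -mulrnA mulr_natl.
apply: ler_sum => i _; apply: ler_sum => j _; rewrite mxE [X in _ + X]mxE.
apply: le_trans (rnormD _ _) _; rewrite rnormN.
have -> : 2 = 1 + 1 :> R by [].
by apply: lerD; apply: op_ball_coord; [exact: unitary_op_ball Ug|exact: unitary_op_ball Uh].
Qed.

Lemma clip_bound f L : clip f L -> exists2 M, 0 <= M & forall g, unitary_group g -> rnorm (f g) <= M.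
Proof.
move=> [L0 fL]; exists (rnorm (f 1%:M) + L * ((n ^ 2)%:R * 2)).
  by rewrite addr_ge0 ?rnorm_ge0 ?mulr_ge0.
move=> g Ug; rewrite -{1}(subrK (f 1%:M) (f g)) addrC.
apply: le_trans (rnormD _ _) _; rewrite lerD2l.
have U1 := @unitary_group1 R n.
apply: le_trans (fL _ _ Ug U1) _; rewrite ler_wpM2l//; exact: unitary_mxsum.
Qed.

Lemma clip_entry i j : clip (fun g => g i j) 1.
Proof.
split=> // g h _ _; rewrite mul1r; have := entry_le_mxsum (g - h) i j.
by rewrite mxE [X in rnorm (_ + X)]mxE.
Qed.

Lemma clip_cst c : clip (fun=> c) 0.
Proof. by split=> // g h _ _; rewrite subrr rnorm0 mul0r. Qed.

Lemma clipsD f1 f2 : clips f1 -> clips f2 -> clips (fun g => f1 g + f2 g).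
Proof.
move=> [L1 [L10 f1L]] [L2 [L20 f2L]]; exists (L1 + L2); split; first exact: addr_ge0.
move=> g h Ug Uh; rewrite opprD addrACA mulrDl.
apply: le_trans (rnormD _ _) _. apply: lerD; [exact: f1L|exact: f2L].
Qed.

Lemma clipsM f1 f2 : clips f1 -> clips f2 -> clips (fun g => f1 g * f2 g).
Proof.
move=> [L1 c1] [L2 c2]; have [M1 M10 b1] := clip_bound c1; have [M2 M20 b2] := clip_bound c2.
have [L10 f1L] := c1; have [L20 f2L] := c2.
exists (L1 * M2 + M1 * L2); split; first by rewrite addr_ge0 ?mulr_ge0.
move=> g h Ug Uh.
have -> : f1 g * f2 g - f1 h * f2 h = (f1 g - f1 h) * f2 g + f1 h * (f2 g - f2 h).
  by rewrite mulrBl mulrBr addrA subrK.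
apply: le_trans (rnormD _ _) _; rewrite [leRHS]mulrDl !rnormM; apply: lerD.
  by rewrite mulrAC ler_pM ?rnorm_ge0 ?f1L ?b2.
by rewrite -mulrA ler_pM ?rnorm_ge0 ?f2L ?b1.
Qed.

Lemma clips_cst c : clips (fun=> c). Proof. by exists 0; exact: clip_cst. Qed.

Lemma clips_conj f : clips f -> clips (fun g => (f g)^*).
Proof.
move=> [L [L0 fL]]; exists L; split=> // g h Ug Uh.
by rewrite -rmorphB rnorm_conj; exact: fL.
Qed.

Lemma clips_sum (I : Type) (s : seq I) (F : I -> 'M[C]_n -> C) :
  (forall i, clips (F i)) -> clips (fun x => \sum_(i <- s) F i x).
Proof.
move=> mF; elim: s => [|i s IH].
  by under [X in clips X]eq_fun do rewrite big_nil; exact: clips_cst.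
by under [X in clips X]eq_fun do rewrite big_cons; exact: clipsD.
Qed.

Lemma clips_prod (I : Type) (s : seq I) (F : I -> 'M[C]_n -> C) :
  (forall i, clips (F i)) -> clips (fun x => \prod_(i <- s) F i x).
Proof.
move=> mF; elim: s => [|i s IH].
  by under [X in clips X]eq_fun do rewrite big_nil; exact: clips_cst.
by under [X in clips X]eq_fun do rewrite big_cons; exact: clipsM.
Qed.

Lemma clips_hpoly d (p : hpoly R d n) : clips p.
Proof.
have [c pE] := hpoly_word_expand p.
rewrite (_ : (p : _ -> C) = fun x => \sum_w c w * \prod_k x (w k).1 (w k).2); last exact/funext.
apply: clips_sum => w; apply: clipsM; first exact: clips_cst.
by apply: clips_prod => k; exists 1; exact: clip_entry.
Qed.

Lemma mxsum_unitary_mul u g : unitary_group u -> mxsum (u *m g) <= n%:R * mxsum g.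
Proof.
move=> /unitary_op_ball/op_ball_coord ub.
have -> : n%:R * mxsum g = \sum_(i < n) mxsum g by rewrite sumr_const card_ord mulr_natl.
apply: ler_sum => i _; rewrite /mxsum exchange_big; apply: ler_sum => j _.
rewrite mxE; apply: le_trans (rnorm_sum _ _ _) _; apply: ler_sum => k _.
by rewrite rnormM ler_piMl ?rnorm_ge0 ?ub.
Qed.

Lemma clip_mulmx f L u : unitary_group u -> clip f L -> clip (fun g => f (u *m g)) (L * n%:R).
Proof.
move=> Uu [L0 fL]; split=> [|g h Ug Uh]; first exact: mulr_ge0.
apply: le_trans (fL _ _ (unitary_groupM Uu Ug) (unitary_groupM Uu Uh)) _.
by rewrite -mulmxBr -mulrA ler_wpM2l// mxsum_unitary_mul.
Qed.

End Lipschitz.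

(** * The reproducing kernel *)

Section Kernel.
Variables (R : realType) (n : nat) (mu : probability (mxBorel R n) R).
Hypothesis muP : is_haar mu.
Variable d : nat.
Local Notation C := (Cplx R).
Local Notation B := (mxBorel R n).
Local Notation U := (@unitary_group R n : set B).
Local Notation X := (hpoly R d n).
Local Notation T := (mindex n d).
Implicit Types (p q f : X) (g h u v : 'M[C]_n).

Lemma bmeas_rnorm2 p : bmeas (fun g : B => rnorm (p g : C) ^+ 2).
Proof. by apply: bmeasX; apply: cbm_rnorm; exact: cbm_hpoly. Qed.

Lemma hpoly_norm_attained p (M : R) : M < hpoly_norm p ->
  exists2 g, unitary_group g & M < rnorm (p g : C).
Proof.
move=> Mp; apply/not_exists2P => H.
have : hpoly_norm p <= M; last by rewrite leNgt Mp.
apply: hpoly_norm_le => A; apply: maximum_principle => g Ug.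
by rewrite leNgt; apply/negP; case: (H g).
Qed.

(* Haar measure charges some cell of a fine partition, and translating that cell to a
   point where p is large shows that p cannot vanish almost everywhere. *)
Lemma hpoly_definite p : ER mu (fun g => rnorm (p g : C) ^+ 2) = 0 -> p = 0.
Proof.
move=> p0; apply/eqP; apply/negPn/negP => pN0.
have n0 : 0 < hpoly_norm p.
  rewrite lt_def hpoly_norm_ge0 andbT; apply: contra pN0 => /eqP np0.
  by apply/eqP/hpoly_norm_eq0; rewrite /hpoly_normC np0.
pose M := hpoly_norm p / 2.
have M0 : 0 < M by rewrite divr_gt0.
have [u0 Uu0 pu0] : exists2 g, unitary_group g & M < rnorm (p g : C).
  by apply: hpoly_norm_attained; rewrite /M ltr_pdivrMr// ltr_pMr// ltr1n.
have [L pL] : clips (fun g => p g * (p g)^*).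
  by apply: clipsM; [|apply: clips_conj]; exact: clips_hpoly.
have pL' := clip_mulmx _ pL.
(* Left translation multiplies the Lipschitz constant by [n], so with this tolerance the
   discretisation error is at most [M ^+ 2], which is below the value at [u0]. The added 1 keeps the
   denominator positive. *)
have d0 : 0 < M ^+ 2 / (L * n%:R + 1).
  by rewrite divr_gt0 ?exprn_gt0// ltr_wpDl// mulr_ge0//; case: pL.
have [I [w [x [w0 w1 Ux _ wE]]]] := discretization muP d0.
have [i wi] : exists i, 0 < w i.
  apply/not_existsP => nw; have : \sum_i w i = 0.
    by rewrite big1// => i _; apply/eqP; rewrite eq_le w0 andbT leNgt; apply/negP/nw.
  by rewrite w1; apply/eqP; rewrite oner_eq0.
have Uu := unitary_groupM Uu0 (unitary_groupV (Ux i)).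
pose f g := complex.Re (p (u0 *m (x i)^t* *m g) * (p (u0 *m (x i)^t* *m g))^*).
have fE g : f g = rnorm (p (u0 *m (x i)^t* *m g) : C) ^+ 2.
  by rewrite /f -RtoC_rnorm_sq.
have bf : bmeas (f : B -> R).
  have := bmeas_mulmx Uu (@unitary_group1 R n) (bmeas_rnorm2 p).
  by rewrite (_ : (fun x : B => _) = f)//; apply/funext => g; rewrite fE mulmx1.
have f0 g : unitary_group g -> 0 <= f g by move=> _; rewrite fE sqr_ge0.
have := wE f _ i bf f0 (clip_Re (pL' _ Uu)).
rewrite (_ : ER mu f = 0); last first.
  rewrite -p0 -(ER_mulmx muP Uu (@unitary_group1 R n) (bmeas_rnorm2 p)).
  by apply: eq_ER => g _; rewrite fE mulmx1.
rewrite fE -mulmxA (unitary_mulVmx (Ux i)) mulmx1 pmulr_rle0// subr_le0.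
rewrite leNgt => /negP; apply.
apply: le_lt_trans (_ : M ^+ 2 < _).
  have [L0 _] := pL' _ Uu.
  by rewrite mulrCA ger_pMr ?exprn_gt0// ler_pdivrMr ?ltr_wpDl// mul1r lerDl.
by rewrite ltrXn2r// ?nnegrE ?rnorm_ge0// ltW.
Qed.

End Kernel.

Section ReproducingKernel.
Variables (R : realType) (n : nat) (mu : probability (mxBorel R n) R).
Hypothesis muP : is_haar mu.
Variable d : nat.
Local Notation C := (Cplx R).
Local Notation B := (mxBorel R n).
Local Notation U := (@unitary_group R n : set B).
Local Notation X := (hpoly R d n).
Local Notation T := (mindex n d).
Local Notation mono := (@mono R n d).
Implicit Types (p q f : X) (g h u v x y : 'M[C]_n).

Lemma cbm_hpoly_conj p q : cbm (fun g : B => p g * (q g)^*).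
Proof. by apply: cbmM; [|apply: cbm_conj]; exact: cbm_hpoly. Qed.

(** The Gram matrix of the monomials is invertible: a row vector killed by it gives a polynomial of
    L^2-norm 0, which vanishes by [hpoly_definite] together with its coefficients. The conjugated
    inverse supplies the coordinates of the dual basis. *)
Lemma dual_basis : exists D : T -> X,
  forall a b, EC mu (fun g : B => mono b g * (D a g)^*) = (a == b)%:R.
Proof.
pose b (i : 'I_#|{: T}|) : X := mono (enum_val i).
pose G : 'M[C]_#|{: T}| := \matrix_(i, j) EC mu (fun g : B => b i g * (b j g)^*).
have Gu : G \in unitmx.
  rewrite -row_free_unit; apply/inj_row_free => v vG.
  pose f : X := \sum_i v 0 i *: b i.
  have fE g : f g = \sum_i v 0 i * b i g.
    by rewrite /f hpoly_sum; apply: eq_bigr.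
  have ff : EC mu (fun g : B => f g * (f g)^*) = 0.
    rewrite (@eq_EC _ _ mu _ (fun g : B => \sum_j (v 0 j)^* * (\sum_i v 0 i * (b i g * (b j g)^*)))); last first.
      move=> g _; rewrite fE rmorph_sum mulr_sumr; apply: eq_bigr => j _.
      rewrite mulr_suml mulr_sumr; apply: eq_bigr => i _.
      by rewrite rmorphM mulrCA; congr (_ * _); rewrite mulrA.
    have cb i j : cbm (fun g : B => v 0 i * (b i g * (b j g)^*)).
      by apply: cbmM; [exact: cbm_cst|exact: cbm_hpoly_conj].
    rewrite (EC_sum muP)// => [|j]; last first.
      by apply: cbmM; [exact: cbm_cst|apply: cbm_sum => i].
    rewrite big1// => j _; rewrite (ECZ muP); last by apply: cbm_sum => i.
    rewrite (EC_sum muP)//; move/rowP/(_ j): vG; rewrite !mxE => vG.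
    rewrite (eq_bigr (fun i => v 0 i * G i j)); first by rewrite vG mulr0.
    by move=> i _; rewrite (ECZ muP) ?mxE//; exact: cbm_hpoly_conj.
  have f0 : f = 0.
    apply: (hpoly_definite muP); apply: (@RtoC_inj R); rewrite -(EC_RtoC muP).
    by rewrite [RHS]RtoC0 -ff; apply: eq_EC => g _; rewrite RtoC_rnorm_sq.
  apply/rowP => i; rewrite mxE.
  have fE' : (f : _ -> C) = fun A => \sum_i v 0 i * b i A by apply/funext.
  have : mcoef (enum_val i) f = v 0 i.
    rewrite fE' mcoef_sum (bigD1 i)//= [X in _ + X]big1 => [|j ji].
      have -> : mcoef (enum_val i) (fun A => b i A) = 1.
        by have := mcoef_mono R (enum_val i) (enum_val i); rewrite eqxx.
      by rewrite mulr1 addr0.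
    have := mcoef_mono R (enum_val i) (enum_val j); rewrite (inj_eq enum_val_inj) eq_sym (negbTE ji).
    by move=> H; rewrite [X in _ * X]H mulr0.
  move=> <-; rewrite f0 /mcoef big1 ?mulr0// => k _.
  by rewrite mul0r.
exists (fun a => \sum_j ((invmx G) j (enum_rank a))^* *: b j) => a c.
rewrite (@eq_EC _ _ mu _ (fun g : B => \sum_j invmx G j (enum_rank a) * (mono c g * (b j g)^*))); last first.
  move=> g _; rewrite hpoly_sum rmorph_sum mulr_sumr; apply: eq_bigr => j _.
  by rewrite hpolyZ rmorphM mulrCA; congr (_ * _); exact: conjCK.
have cb j : cbm (fun g : B => invmx G j (enum_rank a) * (mono c g * (b j g)^*)).
  by apply: cbmM; [exact: cbm_cst|exact: cbm_hpoly_conj].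
rewrite (EC_sum muP)//.
transitivity ((G *m invmx G) (enum_rank c) (enum_rank a)).
  rewrite mxE; apply: eq_bigr => j _; rewrite (ECZ muP); last exact: cbm_hpoly_conj.
  by rewrite mulrC mxE /b enum_rankK.
by rewrite mulmxV// mxE eq_sym (inj_eq enum_rank_inj).
Qed.

Definition dual : T -> X := sval (cid dual_basis).

Lemma dualP a b : EC mu (fun g : B => mono b g * (dual a g)^*) = (a == b)%:R.
Proof. by rewrite /dual; case: cid. Qed.

Lemma mcoef_dual a p : mcoef a p = EC mu (fun g : B => p g * (dual a g)^*).
Proof.
have pE g : p g = \sum_b mcoef b p * mono b g.
  by rewrite {1}(mono_expand p) hpoly_sum; apply: eq_bigr.
rewrite (@eq_EC _ _ mu _ (fun g : B => \sum_b mcoef b p * (mono b g * (dual a g)^*))); last first.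
  by move=> g _; rewrite pE mulr_suml; apply: eq_bigr => b _; rewrite mulrA.
rewrite (EC_sum muP) => [|b]; last by apply: cbmM; [exact: cbm_cst|exact: cbm_hpoly_conj].
rewrite (bigD1 a) // big1 => [|b ba].
  rewrite [RHS]addr0 (ECZ muP); [by rewrite dualP eqxx mulr1|exact: cbm_hpoly_conj].
by rewrite (ECZ muP); [rewrite dualP eq_sym (negbTE ba) mulr0|exact: cbm_hpoly_conj].
Qed.

(** The kernel is written through two biorthogonal bases because the monomials need not be
    orthogonal. It is polynomial in [x] and conjugate polynomial in [y]. *)
Definition ker x y : C := \sum_a mono a x * (dual a y)^*.

Definition kerl y : X := \sum_a (dual a y)^* *: mono a.
Definition kerr x : X := \sum_a (mono a x)^* *: dual a.

Lemma kerlE x y : kerl y x = ker x y.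
Proof. by rewrite hpoly_sum; apply: eq_bigr => a _; rewrite hpolyZ mulrC. Qed.

Lemma kerrE x y : kerr x y = (ker x y)^*.
Proof.
rewrite hpoly_sum rmorph_sum; apply: eq_bigr => a _.
by rewrite hpolyZ rmorphM; congr (_ * _); exact: (esym (conjCK _)).
Qed.

Lemma cbm_ker x : cbm (fun y : B => ker x y).
Proof.
have := cbm_conj (cbm_hpoly (kerr x)).
by under [X in cbm X]eq_fun do rewrite kerrE conjCK.
Qed.

Lemma kerP p x : EC mu (fun y : B => p y * ker x y) = p x.
Proof.
rewrite [in RHS](mono_expand p) hpoly_sum.
rewrite (@eq_EC _ _ mu _ (fun y : B => \sum_a mono a x * (p y * (dual a y)^*))); last first.
  by move=> y _; rewrite mulr_sumr; apply: eq_bigr => a _; rewrite mulrCA.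
rewrite (EC_sum muP) => [|a]; last by apply: cbmM; [exact: cbm_cst|exact: cbm_hpoly_conj].
apply: eq_bigr => a _; rewrite (ECZ muP); last exact: cbm_hpoly_conj.
by rewrite hpolyZ mcoef_dual mulrC.
Qed.

(** The representer [kerr x] is integrated against both kernels, each of which reproduces the other.
    Uniqueness is used twice: applied to [ker] itself it gives Hermitian symmetry, applied to a
    translate it gives invariance. *)
Lemma ker_unique (k : 'M[C]_n -> 'M[C]_n -> C) :
  (forall x, exists p, forall y, (k x y)^* = p y) ->
  (forall p x, EC mu (fun y : B => p y * k x y) = p x) ->
  forall x y, k x y = (ker y x)^*.
Proof.
move=> kX kR z x; have [q qE] := kX z.
have e1 := kR (kerr x) z; have e2 := kerP q x.
rewrite -kerrE -e1 -[LHS]conjCK qE -e2 -(EC_conj muP); last first.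
  by apply: cbmM; [exact: cbm_hpoly|exact: cbm_ker].
apply: eq_EC => y _.
by rewrite kerrE rmorphM -qE mulrC; congr (_ * _); exact: conjCK.
Qed.

Lemma ker_sym x y : ker x y = (ker y x)^*.
Proof.
apply: ker_unique => [z|]; last exact: kerP.
by exists (kerr z) => w; rewrite kerrE.
Qed.

(** Haar measure being invariant, the translated kernel reproduces as well, and uniqueness
    identifies it with the original. *)
Lemma ker_inv u v x y : unitary_group u -> unitary_group v ->
  ker (u *m x *m v) (u *m y *m v) = ker x y.
Proof.
move=> Uu Uv; rewrite [RHS]ker_sym.
pose k z w := ker (u *m z *m v) (u *m w *m v); rewrite -[LHS]/(k x y).
apply: ker_unique => [z|p z].
  by exists (htrans u v (kerr (u *m z *m v))) => w; rewrite htransE kerrE.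
rewrite -(_ : htrans (u^t*) (v^t*) p (u *m z *m v) = p z); last first.
  rewrite htransE !mulmxA (unitary_mulVmx Uu) mul1mx -mulmxA.
  by rewrite (unitarymxP Uv) mulmx1.
rewrite -kerP.
rewrite -[RHS](EC_mulmx muP Uu Uv); last by apply: cbmM; [exact: cbm_hpoly|exact: cbm_ker].
apply: eq_EC => w _; rewrite htransE /k; congr (p _ * _).
by rewrite !mulmxA (unitary_mulVmx Uu) mul1mx -mulmxA (unitarymxP Uv) mulmx1.
Qed.

Definition kappa : X := kerl 1%:M.

Lemma ker_kappa x g : unitary_group g -> ker x g = kappa (x *m g^t*).
Proof.
move=> Ug; rewrite /kappa kerlE -(@ker_inv 1%:M (g^t*)); last exact: unitary_groupV.
  by rewrite !mul1mx (unitarymxP Ug).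
exact: unitary_group1.
Qed.

Lemma kappa_conj u g : unitary_group u -> kappa (u *m g *m u^t*) = kappa g.
Proof.
move=> Uu; rewrite /kappa !kerlE -[RHS](@ker_inv u (u^t*) _ _ Uu (unitary_groupV Uu)).
by rewrite mulmx1 (unitarymxP Uu).
Qed.

(** On the group, [kappa] is the character of right translation on X. The integrands of the
    coefficients add up to [ker (y *m g) y], which is independent of [y] by left invariance, so the
    integral is the constant itself. *)
Lemma kappa_trace g : unitary_group g ->
  \sum_a mcoef a (htrans 1%:M g (mono a) : X) = kappa g.
Proof.
move=> Ug; under eq_bigr do rewrite mcoef_dual.
rewrite -(EC_sum muP) => [|a]; last exact: cbm_hpoly_conj.
rewrite -(EC_cst muP (kappa g)); apply: eq_EC => y Uy.
rewrite /kappa kerlE -(@ker_inv y 1%:M _ _ Uy (@unitary_group1 R n)).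
by rewrite !mulmx1 /ker; apply: eq_bigr => a _; rewrite htransE mul1mx.
Qed.

(** Right multiplication by a diagonal matrix scales the columns, so every monomial is an
    eigenvector and the trace is the sum of the eigenvalues. Only the column index [e.2] enters,
    which repeats each diagonal entry [n] times. *)
Lemma kappa_diag (D : 'rV[C]_n) : unitary_group (diag_mx D) ->
  kappa (diag_mx D) = \sum_(a : T) \prod_e D 0 e.2 ^+ val a e.
Proof.
move=> UD; rewrite -kappa_trace//; apply: eq_bigr => a _.
have E A : (htrans 1%:M (diag_mx D) (mono a) : X) A = (\prod_e D 0 e.2 ^+ val a e) * mono a A.
  rewrite htransE mul1mx !monoE -big_split; apply: eq_bigr => e _ /=.
  by rewrite mul_mx_diag mxE -exprMn mulrC.
have -> : (htrans 1%:M (diag_mx D) (mono a) : _ -> C) =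
    fun A => \sum_(i < 1) (\prod_e D 0 e.2 ^+ val a e) * (mono a : X) A.
  by apply/funext => A; rewrite big_ord1 E.
rewrite (mcoef_sum a (fun _ : 'I_1 => _) (fun _ => (mono a : X))).
by rewrite big_ord1 mcoef_mono eqxx mulr1.
Qed.

Lemma ER_rnorm_ker x : unitary_group x ->
  ER mu (fun g : B => rnorm (ker x g)) = ER mu (fun g => rnorm (kappa g : C)).
Proof.
move=> Ux; have U1 := @unitary_group1 R n.
have bk : bmeas (fun g : B => rnorm (kappa g : C)) by apply: cbm_rnorm; exact: cbm_hpoly.
rewrite -(ER_mulmx muP U1 (unitary_groupV Ux) bk); apply: eq_ER => g Ug.
by rewrite ker_sym rnorm_conj ker_kappa// mul1mx.
Qed.

(** The reproducing property is applied to [kappa] itself at the identity. *)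
Lemma ER_kappa_sq : RtoC (ER mu (fun g => rnorm (kappa g : C) ^+ 2)) = kappa 1%:M.
Proof.
rewrite -(EC_RtoC muP) -kerP; apply: eq_EC => g _.
by rewrite RtoC_rnorm_sq ker_sym /kappa kerlE.
Qed.

End ReproducingKernel.

(** * Newton's identities and the sum over partitions *)

Section LogDerivative.
Variables (F : numFieldType) (N : nat).
Implicit Types (A B P : {poly F}).

(** [P] is the logarithmic derivative of [A] up to degree [N]. The truncation lets geometric and
    exponential series be handled as polynomials, with products turning into sums. *)
Definition logder A P := A`_0 = 1 /\ forall k, (k < N)%N -> A^`()`_k = (P * A)`_k.

Lemma logderM A B P Q : logder A P -> logder B Q -> logder (A * B) (P + Q).
Proof.
move=> [A0 AP] [B0 BQ]; split; first by rewrite coefM big_ord1 A0 B0 mulr1.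
move=> k kN; rewrite derivM coefD mulrDl [RHS]coefD; congr (_ + _).
  rewrite mulrA !coefM; apply: eq_bigr => i _; rewrite AP//.
  by apply: leq_ltn_trans kN; rewrite -ltnS.
rewrite mulrCA !coefM; apply: eq_bigr => i _; rewrite BQ//.
by apply: leq_ltn_trans kN; exact: leq_subr.
Qed.

Lemma logder1 : logder 1 0.
Proof. by split=> [|k _]; rewrite ?coef1// -polyC1 derivC mul0r. Qed.

Lemma logder_prod (I : Type) (s : seq I) (A : I -> {poly F}) (P : I -> {poly F}) :
  (forall i, logder (A i) (P i)) -> logder (\prod_(i <- s) A i) (\sum_(i <- s) P i).
Proof.
move=> AP; elim: s => [|i s IH]; first by rewrite !big_nil; exact: logder1.
by rewrite !big_cons; exact: logderM.
Qed.

(** The equation [A' = P A] expresses [k + 1] times the coefficient of degree [k + 1] through lower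
    ones, and [k + 1] is invertible in characteristic 0. *)
Lemma logder_unique A B P Q : logder A P -> logder B Q ->
  (forall k, (k < N)%N -> P`_k = Q`_k) -> forall k, (k <= N)%N -> A`_k = B`_k.
Proof.
move=> [A0 AP] [B0 BQ] PQ; elim/ltn_ind => -[|k] IH kN; first by rewrite A0 B0.
have : A^`()`_k = B^`()`_k.
  rewrite AP// BQ// !coefM; apply: eq_bigr => i _; have ik : (i <= k)%N by rewrite -ltnS.
  rewrite PQ ?(leq_ltn_trans ik)// IH//; first by rewrite ltnS leq_subr.
  by apply: leq_trans (ltnW kN); exact: leq_subr.
rewrite !coef_deriv => /eqP; rewrite -subr_eq0 -mulrnBl mulrn_eq0 subr_eq0.
by move=> /eqP.
Qed.

(** The first polynomial truncates [1 / (1 - x X)]. *)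
Lemma logder_geom (x : F) :
  logder (\poly_(k < N.+1) x ^+ k) (\poly_(k < N) x ^+ k.+1).
Proof.
split=> [|k kN]; first by rewrite coef_poly expr0.
rewrite coef_deriv coef_poly ltnS kN coefM.
rewrite (eq_bigr (fun=> x ^+ k.+1)) ?sumr_const ?card_ord// => i _.
have ik : (i <= k)%N by rewrite -ltnS.
rewrite !coef_poly (leq_ltn_trans ik kN) ltnS (leq_trans (leq_subr _ _) (ltnW kN)).
by rewrite -exprD addSn subnKC.
Qed.

(** The first polynomial truncates [exp (c X^(i+1) / (i+1))]. *)
Lemma logder_exp (i : nat) (c : F) :
  logder (\sum_(k < N.+1) (c / i.+1%:R) ^+ k / k`!%:R *: 'X^(i.+1 * k)) (c *: 'X^i).
Proof.
set b := c / i.+1%:R.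
have bE : c = b * i.+1%:R by rewrite divfK// pnatr_eq0.
split=> [|k kN].
  rewrite coef_sum big_ord_recl /= muln0 coefZ coefXn eqxx expr0 fact0 divr1 mulr1.
  rewrite big1 ?addr0// => j _.
  by rewrite coefZ coefXn /= mulr0.
have step j : ((b ^+ j.+1 / (j.+1)`!%:R) *: 'X^(i.+1 * j.+1))^`() =
    (c *: 'X^i) * ((b ^+ j / j`!%:R) *: 'X^(i.+1 * j)).
  rewrite derivZ derivXn -[RHS]scalerAl -[X in _ = c *: X]scalerAr -exprD scalerA.
  have -> : (i.+1 * j.+1).-1 = (i + i.+1 * j)%N by rewrite mulnS addSn.
  rewrite -[X in _ *: X = _]scaler_nat scalerA; congr (_ *: _).
  rewrite natrM factS natrM exprS bE; field.
  by rewrite addrC natr1 !pnatr_eq0 -lt0n fact_gt0.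
rewrite raddf_sum coef_sum big_ord_recl /= derivZ muln0 derivXn mulr0n scaler0 coef0 add0r.
(* The constant term on the left has derivative 0, and the last term on the right has degree at
   least [N], beyond the coefficients compared; the remaining terms match one by one. *)
rewrite mulr_sumr coef_sum [RHS]big_ord_recr/= [X in _ = _ + X](_ : _ = 0) ?addr0.
  by apply: eq_bigr => j _; rewrite -step.
rewrite -scalerAl -scalerAr -exprD !coefZ coefXn ltn_eqF ?mulr0//.
by apply: (leq_trans kN); rewrite mulSn addnCA leq_addr.
Qed.

End LogDerivative.

Section PowerSums.
Variables (F : numFieldType) (d : nat) (E : finType) (x : E -> F).
Let p k := \sum_e x e ^+ k.

(** [c i] stands for the number of parts equal to [i + 1], so this is the size of the partition with
    these multiplicities. *)
Definition weight (c : {ffun 'I_d -> 'I_d.+1}) : nat := (\sum_(i < d) i.+1 * c i)%N.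

(** Both sides are the coefficient of degree [d] in the product of the series [1 / (1 - x_e X)]:
    expanded directly on the left, and as the exponential of the sum of [p_i X^i / i] on the right.
    The truncations agree because their logarithmic derivatives do. *)
Lemma complete_sym_power_sums :
  \sum_(a : {ffun E -> 'I_d.+1} | (\sum_e a e == d)%N) \prod_e x e ^+ a e =
  \sum_(c : {ffun 'I_d -> 'I_d.+1} | weight c == d)
    \prod_(i < d) ((p i.+1 / i.+1%:R) ^+ c i / (c i)`!%:R).
Proof.
pose A : {poly F} := \prod_e \poly_(k < d.+1) x e ^+ k.
pose B : {poly F} := \prod_(i < d) \sum_(k < d.+1) (p i.+1 / i.+1%:R) ^+ k / k`!%:R *: 'X^(i.+1 * k).
have AB : A`_d = B`_d.
  apply: (logder_unique (N := d) (logder_prod _ (fun e => logder_geom d (x e)))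
    (logder_prod _ (fun i : 'I_d => logder_exp d i (p i.+1)))) => // k kd.
  rewrite !coef_sum [RHS](bigD1 (Ordinal kd))//= coefZ coefXn eqxx mulr1 [X in _ + X]big1 ?addr0.
    by apply: eq_bigr => e _; rewrite coef_poly kd.
  by move=> i ik; rewrite coefZ coefXn eq_sym -[_ == _]/(i == Ordinal kd) (negbTE ik) mulr0.
transitivity A`_d; last rewrite AB.
  rewrite /A; under eq_bigr do rewrite poly_def.
  rewrite bigA_distr_bigA coef_sum big_mkcond/=; apply: eq_bigr => a _.
  rewrite (eq_bigr (fun e => (x e ^+ a e)%:P * 'X^(a e))) => [|e _]; last by rewrite mul_polyC.
  rewrite big_split/= -rmorph_prod coefCM -expr_sum coefXn eq_sym.
  by case: eqP => _; rewrite ?mulr1 ?mulr0.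
rewrite /B bigA_distr_bigA coef_sum [RHS]big_mkcond/=; apply: eq_bigr => c _.
rewrite (eq_bigr (fun i : 'I_d => ((p i.+1 / i.+1%:R) ^+ c i / (c i)`!%:R)%:P *
    'X^(i.+1 * c i))) => [|i _]; last by rewrite mul_polyC.
rewrite big_split/= -rmorph_prod coefCM -expr_sum coefXn eq_sym.
by rewrite /weight; case: eqP => _; rewrite ?mulr1 ?mulr0.
Qed.

End PowerSums.

(** * Partitions and their multiplicity vectors *)

Section Partitions.
Variable d : nat.
Implicit Types (m : {ffun 'I_d -> 'I_d.+1}) (c : {ffun 'I_d -> 'I_d.+1}).

Let parts m : seq nat := [seq (m j : nat) | j <- enum 'I_d].

Let count_parts m r : count_mem r (parts m) = pmult m r.
Proof.
rewrite /parts count_map /pmult cardE -size_filter; congr size.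
by rewrite enumT; apply: eq_filter => j; rewrite inE.
Qed.

Let pmult_le m r : (pmult m r <= d)%N.
Proof. by rewrite -[leqRHS]card_ord max_card. Qed.

Let nth_parts m (j : 'I_d) : nth 0%N (parts m) j = m j.
Proof. by rewrite (nth_map j) ?size_enum_ord// nth_ord_enum. Qed.

Let sorted_parts m : is_partition m -> sorted geq (parts m).
Proof.
move=> /andP[/forallP mm _].
have tr : transitive geq by move=> a b c ab bc; exact: leq_trans bc ab.
apply/(sortedP 0%N) => i; rewrite size_map size_enum_ord => id.
have id' : (i < d)%N := ltnW id.
rewrite (nth_parts m (Ordinal id)) (nth_parts m (Ordinal id')).
by have /forallP/(_ (Ordinal id)) := mm (Ordinal id'); rewrite /= leqnSn.
Qed.

Definition mults m : {ffun 'I_d -> 'I_d.+1} := [ffun i : 'I_d => inord (pmult m i.+1)].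

Lemma multsE m i : mults m i = pmult m i.+1 :> nat.
Proof. by rewrite ffunE inordK// ltnS pmult_le. Qed.

(** The multiplicities of the positive parts determine that of 0, as there are [d] entries in all,
    and two sorted sequences with equal multiplicities coincide. *)
Lemma mults_inj m m' : is_partition m -> is_partition m' -> mults m = mults m' -> m = m'.
Proof.
move=> mP mP' mm'.
have pm r : pmult m r.+1 = pmult m' r.+1.
  have [rd|rd] := ltnP r d; first by rewrite -!(multsE _ (Ordinal rd)) mm'.
  have H m0 : pmult m0 r.+1 = 0%N.
    by apply: eq_card0 => j; rewrite !inE; apply/negbTE; rewrite neq_ltn (leq_trans (ltn_ord (m0 j))).
  by rewrite !H.
have sz m0 : (pmult m0 0 + \sum_(r < d) pmult m0 r.+1 = d)%N.
  rewrite -[RHS]card_ord -sum1_card [RHS](partition_big m0 predT)//= [RHS]big_ord_recl.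
  congr (_ + _)%N; first by rewrite /pmult -sum1_card; apply: eq_bigl => j; rewrite inE.
  apply: eq_bigr => r _; rewrite /pmult -sum1_card; apply: eq_bigl => j; rewrite inE.
  by rewrite -val_eqE.
have pm0 : pmult m 0 = pmult m' 0.
  apply: (@addIn (\sum_(r < d) pmult m r.+1)); rewrite sz -[LHS](sz m').
  by congr (_ + _)%N; apply: eq_bigr => r _; rewrite pm.
have : parts m = parts m'.
  apply: (@sorted_eq _ geq); [|by move=> a b /andP[ab ba]; apply/anti_leq/andP| | |].
  - by move=> a b c ab bc; exact: leq_trans bc ab.
  - exact: sorted_parts.
  - exact: sorted_parts.
  - by apply/allP => r _; rewrite /= !count_parts; case: r => [|r]; rewrite ?pm ?pm0.
by move=> E; apply/ffunP => j; apply/val_inj; apply: etrans (esym (nth_parts m j)) _; rewrite E; exact: nth_parts.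
Qed.

(** List each part as often as prescribed, sort decreasingly and pad with zeros. The list has length
    at most [d] because its entries are positive with sum [d]. *)
Lemma mults_surj c : weight c = d -> exists2 m, is_partition m & mults m = c.
Proof.
move=> cd; pose s0 : seq nat := flatten [seq nseq (c i) i.+1 | i <- enum 'I_d].
have count_s0 (i : 'I_d) : count_mem i.+1 s0 = c i.
  rewrite /s0 count_flatten -map_comp sumnE big_map big_enum/=.
  rewrite (bigD1 i)//= count_nseq /= eqxx mul1n big1 ?addn0// => j ji.
  by rewrite count_nseq /= eqSS -[_ == _]/(j == i) (negbTE ji).
have sum_s0 : sumn s0 = d.
  rewrite /s0 sumn_flatten -map_comp sumnE big_map big_enum/=.
  by rewrite -[RHS]cd; apply: eq_big => // i _; rewrite sumn_nseq.
have pos_s0 r : r \in s0 -> (0 < r)%N.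
  by move=> /flattenP[_ /mapP[i _ ->]]; rewrite mem_nseq => /andP[_ /eqP ->].
pose s := sort geq s0.
have perm_s : perm_eq s s0 by rewrite perm_sort.
have tot : total geq by move=> a b; exact: leq_total.
have tr : transitive geq by move=> a b e ab be; exact: leq_trans be ab.
have sorted_s : sorted geq s by exact: sort_sorted.
have size_s : (size s <= d)%N.
  rewrite -sum_s0 size_sort -sum1_size sumnE big_seq [leqRHS]big_seq.
  by apply: leq_sum => r /pos_s0.
have nth_le j : (nth 0%N s j <= d)%N.
  have [js|js] := ltnP j (size s); last by rewrite nth_default.
  rewrite -sum_s0 -(perm_sumn perm_s) sumnE (big_nth 0%N) big_mkord.
  by rewrite (bigD1 (Ordinal js))//= leq_addr.
pose m : {ffun 'I_d -> 'I_d.+1} := [ffun j : 'I_d => inord (nth 0%N s j)].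
have mE j : m j = nth 0%N s j :> nat by rewrite ffunE inordK// ltnS nth_le.
have partsE : parts m = s ++ nseq (d - size s) 0%N.
  apply: (@eq_from_nth _ 0%N).
    by rewrite size_map size_enum_ord size_cat size_nseq subnKC.
  rewrite size_map size_enum_ord => j jd; rewrite (nth_parts m (Ordinal jd)) mE nth_cat/=.
  by case: ltnP => // js; rewrite nth_default// nth_nseq; case: ifP.
exists m.
  apply/andP; split.
    apply/forallP => i; apply/forallP => j; apply/implyP => ij; rewrite !mE.
    have [js|js] := ltnP j (size s); last by rewrite nth_default.
    have := sorted_leq_nth tr (fun a => leqnn a) 0%N sorted_s.
    by apply; rewrite ?inE//; exact: leq_ltn_trans js.
  apply/eqP; transitivity (sumn (parts m)).
    by rewrite /parts sumnE big_map big_enum.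
  by rewrite partsE sumn_cat sumn_nseq mul0n addn0 (perm_sumn perm_s).
apply/ffunP => i; apply/val_inj; rewrite /= multsE -count_parts partsE count_cat count_nseq mul0n addn0.
by rewrite (permP perm_s) count_s0.
Qed.

Lemma plengthP m (j : 'I_d) : is_partition m -> (j < plength m)%N = (0 < m j)%N.
Proof.
move=> /andP[/forallP mm _].
have mono (i k : 'I_d) : (i <= k)%N -> (m k <= m i)%N.
  by move=> ik; have /forallP/(_ k) := mm i; rewrite ik.
have card_lt (k : nat) : (k <= d)%N -> #|[pred i : 'I_d | (i < k)%N]| = k.
  move=> kd; rewrite -sum1_card -[LHS](big_ord_widen d (fun=> 1%N) kd).
  by rewrite sum1_card card_ord.
have [mj|mj] := ltnP 0 (m j).
  rewrite -[X in (X <= _)%N]card_lt// /plength.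
  apply/subset_leq_card/fintype.subsetP => i; rewrite !inE ltnS => ij.
  by apply: leq_trans mj _; exact: mono.
apply/negbTE; rewrite -leqNgt -[X in (_ <= X)%N]card_lt; last exact: ltnW.
apply/subset_leq_card/fintype.subsetP => i; rewrite !inE => mi; rewrite ltnNge; apply/negP => ji.
by have := leq_trans mi (leq_trans (mono _ _ ji) mj).
Qed.

Lemma pzE m : pz m = (\prod_(i < d) (i.+1 ^ mults m i * (mults m i)`!))%N.
Proof.
rewrite /pz big_add1 big_mkord; apply: eq_bigr => i _.
by rewrite multsE.
Qed.

Lemma prod_parts (F : comNzRingType) (P : nat -> F) m : is_partition m ->
  \prod_(j < d | (j < plength m)%N) P (m j) = \prod_(i < d) P i.+1 ^+ mults m i.
Proof.
move=> mP; rewrite (eq_bigl (fun j => (0 < m j)%N)) => [|j]; last exact: plengthP.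
pose pr (j : 'I_d) : 'I_d := odflt j (insub (m j).-1).
have prE j : (0 < m j)%N -> pr j = (m j).-1 :> nat.
  by move=> mj; rewrite /pr insubT ?prednK// -ltnS (ltn_ord (m j)).
rewrite (partition_big pr predT)//=; apply: eq_bigr => i _.
rewrite multsE /pmult -prodr_const.
apply: eq_big => [j|j /andP[mj /eqP <-]]; last by rewrite prE// prednK.
rewrite inE; apply/andP/eqP => [[mj /eqP <-]|mj]; first by rewrite prE// prednK.
by rewrite mj; split => //; rewrite -val_eqE /= prE mj.
Qed.

Lemma weight_mults m : is_partition m -> weight (mults m) = d.
Proof.
move=> mP; have /andP[_ /eqP ms] := mP.
rewrite /weight -[RHS]ms [RHS](bigID (fun j => (0 < m j)%N))/= [X in _ = (_ + X)%N]big1 ?addn0; last first.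
  by move=> j; rewrite lt0n negbK => /eqP.
pose pr (j : 'I_d) : 'I_d := odflt j (insub (m j).-1).
have prE j : (0 < m j)%N -> pr j = (m j).-1 :> nat.
  by move=> mj; rewrite /pr insubT ?prednK// -ltnS (ltn_ord (m j)).
rewrite [RHS](partition_big pr predT)//=; apply: eq_bigr => i _.
rewrite multsE /pmult mulnC -sum_nat_const.
apply: eq_big => [j|j]; last by rewrite inE => /eqP.
rewrite inE; apply/eqP/andP => [mj|[mj /eqP <-]]; last by rewrite prE// prednK.
by rewrite mj; split => //; rewrite -val_eqE /= prE mj.
Qed.

Lemma sum_partitions (F : numFieldType) (P : nat -> F) :
  \sum_(m | is_partition m) (pz m)%:R^-1 * \prod_(j < d | (j < plength m)%N) P (m j) =
  \sum_(c : {ffun 'I_d -> 'I_d.+1} | weight c == d)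
    \prod_(i < d) ((P i.+1 / i.+1%:R) ^+ c i / (c i)`!%:R).
Proof.
(* The default [c] is a dummy: for weight [d], [mults_surj] provides a partition to pick. *)
pose inv c : {ffun 'I_d -> 'I_d.+1} := if [pick m | is_partition m && (mults m == c)] is Some m then m else c.
have invK c : weight c == d -> is_partition (inv c) /\ mults (inv c) = c.
  move=> /eqP /mults_surj[m mP mc]; rewrite /inv; case: pickP => [m' /andP[? /eqP]//|/(_ m)].
  by rewrite mP mc eqxx.
rewrite [RHS](reindex_onto mults inv) => [|c /invK[]//].
apply: eq_big => [m|m mP].
  apply/idP/andP => [mP|[mw /eqP <-]]; last by have [] := invK _ mw.
  have mw : weight (mults m) == d by rewrite weight_mults.
  by split=> //; apply/eqP/mults_inj => //; have [] := invK _ mw.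
rewrite prod_parts// pzE natr_prod -prodfV -big_split/=; apply: eq_bigr => i _.
by rewrite natrM natrX invfM expr_div_n [LHS]mulrC mulrA.
Qed.

End Partitions.

Lemma complete_sym_partitions (F : numFieldType) (d : nat) (E : finType) (x : E -> F) :
  \sum_(a : {ffun E -> 'I_d.+1} | (\sum_e a e == d)%N) \prod_e x e ^+ a e =
  \sum_(m : {ffun 'I_d -> 'I_d.+1} | is_partition m)
    (pz m)%:R^-1 * \prod_(j < d | (j < plength m)%N) \sum_e x e ^+ m j.
Proof.
by rewrite complete_sym_power_sums -(sum_partitions d (fun k => \sum_e x e ^+ k)).
Qed.

Section KappaFormula.
Variables (R : realType) (n : nat) (mu : probability (mxBorel R n) R).
Hypothesis muP : is_haar mu.
Variable d : nat.
Local Notation C := (Cplx R).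

Definition charsum (g : 'M[C]_n) : C :=
  \sum_(m : {ffun 'I_d -> 'I_d.+1} | is_partition m)
    (n ^ plength m)%N%:R / (pz m)%:R * \prod_(j < d | (j < plength m)%N) \tr (g ^+ m j).

Lemma charsumE (g : 'M[C]_n) : charsum g =
  \sum_(m : {ffun 'I_d -> 'I_d.+1} | is_partition m)
    (pz m)%:R^-1 * \prod_(j < d | (j < plength m)%N) (n%:R * \tr (g ^+ m j)).
Proof.
apply: eq_bigr => m mP; rewrite [(n ^ _)%N%:R / _]mulrC -mulrA big_split/= prodr_const.
congr (_ * (_ * _)); rewrite natrX; congr (_ ^+ _).
apply/eq_card => j; rewrite -!topredE/=; exact/esym/plengthP.
Qed.

Lemma expmx_diag (D : 'rV[C]_n) k : (diag_mx D) ^+ k = diag_mx (\row_j D 0 j ^+ k).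
Proof.
elim: k => [|k IH].
  rewrite expr0; apply/matrixP => i j; rewrite !mxE expr0; by case: eqP.
rewrite exprS IH [_ * _]mulmx_diag; congr diag_mx.
by apply/rowP => j; rewrite !mxE exprS.
Qed.

Lemma expmx_conj (u g : 'M[C]_n) k : unitary_group u ->
  (u^t* *m g *m u) ^+ k = u^t* *m g ^+ k *m u.
Proof.
move=> Uu; elim: k => [|k IH]; first by rewrite !expr0 [_ *m 1]mulmx1 (unitary_mulVmx Uu).
rewrite exprS IH exprS; rewrite -[_ * _]/(_ *m _) -[g * _]/(g *m _).
by rewrite !mulmxA -(mulmxA _ u) (unitarymxP Uu) mulmx1.
Qed.

Lemma kappaE g : unitary_group g -> kappa muP d g = charsum g.
Proof.
move=> Ug; rewrite charsumE.
have gn : g \is normalmx by apply/normalmxP; rewrite (unitarymxP Ug) (unitary_mulVmx Ug).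
pose u := spectralmx g; have Uu : unitary_group u by exact: spectral_unitarymx.
pose D := spectral_diag g.
have gE : g = u^t* *m diag_mx D *m u.
  by have /orthomx_spectralP {1}-> := gn; rewrite invmx_unitary.
have UD : unitary_group (diag_mx D).
  have -> : diag_mx D = u *m g *m u^t*.
    by rewrite {1}gE !mulmxA (unitarymxP Uu) mul1mx -mulmxA (unitarymxP Uu) mulmx1.
  exact: (unitary_groupM3 Uu Ug (unitary_groupV Uu)).
rewrite [in LHS]gE -{2}(trmxCK u) (kappa_conj muP _ _ (unitary_groupV Uu)).
rewrite (kappa_diag muP _ UD).
have trE k : \sum_(e : 'I_n * 'I_n) D 0 e.2 ^+ k = n%:R * \tr (g ^+ k).
  rewrite gE expmx_conj// expmx_diag mxtrace_mulC mulmxA (unitarymxP Uu) mul1mx.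
  rewrite -(pair_bigA _ (fun _ j => D 0 j ^+ k))/= sumr_const card_ord mulr_natl.
  by congr (_ *+ _); apply: eq_bigr => j _; rewrite !mxE eqxx.
have -> : \sum_(a : mindex n d) \prod_e D 0 e.2 ^+ val a e =
  \sum_(a : {ffun 'I_n * 'I_n -> 'I_d.+1} | (\sum_e a e == d)%N) \prod_e D 0 e.2 ^+ a e.
  (* The retraction onto the subtype needs an element of it. Without exponent vectors, as for
     [n = 0] and [d > 0], both sums are empty. *)
  have [a0|nT] := pickP (fun a : {ffun 'I_n * 'I_n -> 'I_d.+1} => \sum_e a e == d)%N; last first.
    rewrite [RHS]big_pred0//; apply: big1 => a _; have := nT (val a).
    by rewrite (valP a).
  move=> a0P; pose A0 : mindex n d := exist _ a0 a0P.
  rewrite [RHS](reindex_onto (fun a : mindex n d => val a) (insubd A0)) => [|a aP]; last first.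
    by rewrite insubdK.
  apply: eq_bigl => a; rewrite (valP a) /=; apply/esym/eqP.
  exact: valKd.
rewrite (complete_sym_partitions _ (fun e : 'I_n * 'I_n => D 0 e.2)).
by apply: eq_bigr => m _; congr (_ * _); apply: eq_bigr => j _; rewrite trE.
Qed.

End KappaFormula.

(** * The upper bound *)

Section HahnBanach.
Variables (R : realType) (W : lmodType (Cplx R)) (V : normedModType (Cplx R)).
Local Notation C := (Cplx R).
Variables (j : {linear W -> V}) (phi : W -> C) (K : R).
Hypothesis K0 : 0 <= K.
Hypothesis phiL : forall (a : C) x y, phi (a *: x + y) = a * phi x + phi y.
Hypothesis phiK : forall x, rnorm (phi x) <= K * rnorm (j x).
Local Notation Re := (@complex.Re R).
Local Notation Im := (@complex.Im R).

Let p (v : V) : R := K * rnorm v.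

Lemma rnormZ (a : C) (v : V) : rnorm (a *: v) = rnorm a * rnorm v.
Proof. by apply: (@RtoC_inj R); rewrite RtoCM !rnormE normrZ. Qed.

Let pD v w : p (v + w) <= p v + p w.
Proof. by rewrite /p -mulrDr ler_wpM2l// rnormD. Qed.

Let pZ (a : R) v : 0 <= a -> p (RtoC a *: v) = a * p v.
Proof. by move=> a0; rewrite /p rnormZ rnorm_real// mulrCA. Qed.

(** A partial extension is encoded by its graph, closed under real linear combinations. Domination
    also makes it single-valued: a pair [(0, r)] forces [r <= 0], and its negative forces
    [r >= 0]. *)
Definition dominated (G : set (V * R)) :=
  [/\ forall x, G (j x, Re (phi x)),
      forall a v r w s, G (v, r) -> G (w, s) -> G (RtoC a *: v + w, a * r + s) &
      forall v r, G (v, r) -> r <= p v].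

Let G0 : set (V * R) := [set (j x, Re (phi x)) | x in setT].

Let ReRtoC (a : R) (z : C) : Re (RtoC a * z) = a * Re z.
Proof. by rewrite cReM /= mul0r subr0. Qed.

Let G0_dominated : dominated G0.
Proof.
split=> [x|a v r w s [x _ [<- <-]] [y _ [<- <-]]|v r [x _ [<- <-]]]; first by exists x.
  by exists (RtoC a *: x + y) => //; rewrite linearP phiL cReD ReRtoC.
exact: le_trans (ler_norm _) (le_trans (Re_le_rnorm _) (phiK x)).
Qed.

Let phi0 : phi 0 = 0.
Proof.
have := phiL 1 0 0; rewrite scaler0 addr0 mul1r.
by rewrite -{1}[phi 0]addr0 => /addrI.
Qed.

Let dominated0 G : dominated G -> G (0, 0).
Proof.
move=> [G1 _ _]; have := G1 0; rewrite linear0.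
by rewrite phi0.
Qed.

Let dominatedZ G a v r : dominated G -> G (v, r) -> G (RtoC a *: v, a * r).
Proof.
move=> GP Gv; have [_ GL _] := GP.
by have := GL a _ _ _ _ Gv (dominated0 GP); rewrite !addr0.
Qed.

Lemma exists_maximal_dominated : exists G, dominated G /\
  forall G', dominated G' -> G `<=` G' -> G' `<=` G.
Proof.
pose P (G : set (V * R)) := G = set0 \/ dominated G.
have [|G [GP Gmax]] := @Zorn_bigcup (V * R)%type P.
  move=> F FP Ftot; have [[G [FG GP]]|nG] := pselect (exists G, F G /\ dominated G); last first.
    left; apply/seteqP; split=> // x [G FG Gx]; have [G0'|GP] := FP _ FG; first by rewrite G0' in Gx.
    by apply: nG; exists G.
  right; split.
  - by move=> x; exists G => //; case: GP.
  - move=> a v r w s [G1 FG1 G1v] [G2 FG2 G2w].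
    have dom G' y : F G' -> G' y -> dominated G'.
      by move=> /FP[->//|].
    case: (Ftot _ _ FG1 FG2) => G12.
      by exists G2 => //; case: (dom _ _ FG2 G2w) => _ + _; apply => //; exact: G12.
    by exists G1 => //; case: (dom _ _ FG1 G1v) => _ + _; apply => //; exact: G12.
  - move=> v r [G1 FG1 G1v]; have [G10|[_ _]] := FP _ FG1; last by apply.
    by rewrite G10 in G1v.
have G0N0 : G0 (j 0, Re (phi 0)) by exists 0.
have {}GP : dominated G.
  case: GP => // GE; exfalso; apply: (Gmax G0); last by right; exact: G0_dominated.
  by rewrite GE; split => // /(_ _ G0N0).
exists G; split => // G' G'P GG'.
apply/not_notP => nG'; apply: (Gmax G'); last by right.
by split.
Qed.

(** Since [v + w = (v - v0) + (w + v0)], subadditivity of [p] puts every lower bound below every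
    upper bound, and the supremum of the lower bounds is a possible value at [v0]. *)
Lemma exists_extension_value G v0 : dominated G ->
  exists c, forall v r, G (v, r) -> r - p (v - v0) <= c /\ c <= p (v + v0) - r.
Proof.
move=> GP; have [_ GL Gp] := GP.
have le2 v r w s : G (v, r) -> G (w, s) -> r - p (v - v0) <= p (w + v0) - s.
  move=> Gv Gw; have := Gp _ _ (GL 1 _ _ _ _ Gv Gw); rewrite RtoC1 scale1r mul1r => H.
  have := le_trans H (_ : _ <= p (v - v0) + p (w + v0)).
  have -> : v + w = (v - v0) + (w + v0) by rewrite addrACA [- v0 + _]addrC subrr addr0.
  by move=> /(_ (pD _ _)); lra.
pose S := [set x | exists v r, G (v, r) /\ x = r - p (v - v0)].
have S0 : S !=set0 by exists (0 - p (0 - v0)), 0, 0; split => //; exact: dominated0.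
exists (sup S) => v r Gv; split.
  apply: ub_le_sup; last by exists v, r.
  by exists (p (0 + v0) - 0) => _ [w [s [Gw ->]]]; apply: le2 => //; exact: dominated0.
by apply: ge_sup => // _ [w [s [Gw ->]]]; exact: le2.
Qed.

Lemma exists_real_extension : exists u : V -> R,
  [/\ forall a v w, u (RtoC a *: v + w) = a * u v + u w,
      forall x, u (j x) = Re (phi x) & forall v, u v <= p v].
Proof.
have [G [GP Gmax]] := exists_maximal_dominated.
have [G1 GL Gp] := GP.
have Gfun v r s : G (v, r) -> G (v, s) -> r = s.
  suff H r' s' : G (v, r') -> G (v, s') -> r' <= s'.
    by move=> Gr Gs; apply/eqP; rewrite eq_le !H.
  move=> Gr Gs; have := Gp _ _ (GL (-1) _ _ _ _ Gs Gr).
  have -> : RtoC (-1) *: v + v = 0.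
    rewrite -[RtoC (- 1)]/(real_complex R (- 1)) rmorphN1 scaleN1r.
    by rewrite addrC subrr.
  by rewrite /p rnorm0 mulr0; lra.
have Gtot v0 : exists r, G (v0, r).
  have [c cP] := exists_extension_value v0 GP.
  pose G' : set (V * R) := [set x | exists v r a, G (v, r) /\ x = (v + RtoC a *: v0, r + a * c)].
  have G'P : dominated G'.
    split.
    - by move=> x; exists (j x), (Re (phi x)), 0; rewrite RtoC0 scale0r mul0r !addr0.
    - move=> a _ _ _ _ [v [r [b [Gv [-> ->]]]]] [w [s [b' [Gw [-> ->]]]]].
      exists (RtoC a *: v + w), (a * r + s), (a * b + b'); split; first exact: GL.
      congr (_, _); last by ring.
      by rewrite scalerDr scalerA RtoCD RtoCM scalerDl addrACA.
    - move=> _ _ [v [r [a [Gv [-> ->]]]]].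
      have Gv' b := dominatedZ b GP Gv.
      (* The sign of [a] selects which of the two bounds on [c] is used, applied to the element of
         [G] scaled by [1 / |a|]. *)
      have [a0|a0|->] := ltgtP a 0.
      + have b0 : 0 < - a by rewrite oppr_gt0.
        have [+ _] := cP _ _ (Gv' (- a)^-1).
        have -> : v + RtoC a *: v0 = RtoC (- a) *: (RtoC ((- a)^-1) *: v - v0).
          rewrite scalerBr scalerA -RtoCM mulfV ?gt_eqF// RtoC1 scale1r.
          by rewrite -[RtoC (- a)]/(real_complex R (- a)) rmorphN scaleNr opprK.
        rewrite (pZ _ (ltW b0)); move: (p _) => q0 H.
        have := ler_wpM2l (ltW b0) H.
        by rewrite mulrBr mulrA mulfV ?gt_eqF// mul1r; lra.
      + have [_ +] := cP _ _ (Gv' a^-1).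
        have -> : v + RtoC a *: v0 = RtoC a *: (RtoC (a^-1) *: v + v0).
          by rewrite scalerDr scalerA -RtoCM mulfV ?gt_eqF// RtoC1 scale1r.
        rewrite (pZ _ (ltW a0)); move: (p _) => q0 H.
        have := ler_wpM2l (ltW a0) H.
        by rewrite mulrBr mulrA mulfV ?gt_eqF// mul1r; lra.
      + by rewrite RtoC0 scale0r mul0r !addr0; exact: Gp.
  exists c; apply: (Gmax G' G'P).
    by move=> [v r] Gv; exists v, r, 0; rewrite RtoC0 scale0r mul0r !addr0.
  by exists 0, 0, 1; rewrite RtoC1 scale1r mul1r !add0r; split => //; exact: dominated0.
have /choice[u uG] := Gtot; exists u; split.
- by move=> a v w; apply: (Gfun (RtoC a *: v + w)) => //; exact: GL.
- by move=> x; apply: (Gfun (j x)).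
- by move=> v; exact: Gp.
Qed.

(** A complex functional is recovered from its real part [u] as [u v - i u (i v)]. The subspace
    enters through the map [j], so that a functional given on X extends without passing to the image
    of X. *)
Lemma hahn_banach : exists Phi : V -> C,
  [/\ forall a v w, Phi (a *: v + w) = a * Phi v + Phi w,
      forall x, Phi (j x) = phi x & forall v, rnorm (Phi v) <= K * rnorm v].
Proof.
have [u [uL uj up]] := exists_real_extension.
pose ci : C := Complex 0 1.
have uD v w : u (v + w) = u v + u w by rewrite -{1}[v]scale1r -RtoC1 uL mul1r.
have u0 : u 0 = 0 by have := uD 0 0; rewrite addr0; lra.
have uZ a v : u (RtoC a *: v) = a * u v by rewrite -[_ *: v]addr0 uL u0 addr0.
have uC (a : C) v : u (a *: v) = Re a * u v + Im a * u (ci *: v).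
  have {1}-> : a = RtoC (Re a) + RtoC (Im a) * ci.
    by apply: complex_ext; rewrite ?cReD ?cImD ?cReM ?cImM/= !(mulr0, mul0r, mulr1, subr0, addr0, add0r).
  by rewrite scalerDl uD -scalerA !uZ.
pose Phi v : C := Complex (u v) (- u (ci *: v)).
have PhiL a v w : Phi (a *: v + w) = a * Phi v + Phi w.
  apply: complex_ext; rewrite ?cReD ?cImD ?cReM ?cImM/=; first by rewrite uD (uC a v); ring.
  by rewrite scalerDr uD scalerA (uC (ci * a) v) cReM cImM/=; ring.
exists Phi; split => //.
  move=> x; apply: complex_ext => /=; first exact: uj.
  rewrite -linearZ uj -[ci *: x]addr0 phiL.
  by rewrite phi0 addr0 cReM/=; ring.
move=> v; set z := Phi v.
have [z0|z0] := eqVneq (rnorm z) 0; first by rewrite z0 mulr_ge0 ?rnorm_ge0.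
have {}z0 : 0 < rnorm z by rewrite lt_def z0 rnorm_ge0.
rewrite -(ler_pM2l z0) -expr2.
(* Multiplying [v] by the conjugate of [z] turns the value into [|z|^2], which is real, so the bound
   on the real part bounds the modulus. *)
have -> : rnorm z ^+ 2 = u (z^* *: v).
  transitivity (Re (Phi (z^* *: v))) => //.
  rewrite -[z^* *: v]addr0 PhiL /Phi.
  have -> : Complex (u 0) (- u (ci *: 0)) = 0 :> C by rewrite scaler0 u0 oppr0.
  by rewrite addr0 -/(Phi v) -/z mulrC -RtoC_rnorm_sq.
by apply: le_trans (up _) _; rewrite /p rnormZ rnorm_conj mulrCA.
Qed.

End HahnBanach.

Section KernelEstimates.
Variables (R : realType) (n : nat) (mu : probability (mxBorel R n) R).
Hypothesis muP : is_haar mu.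
Variable d : nat.
Local Notation C := (Cplx R).
Local Notation B := (mxBorel R n).
Local Notation X := (hpoly R d n).
Local Notation T := (mindex n d).
Local Notation mono := (@mono R n d).
Local Notation dual := (@dual R n mu muP d).
Local Notation ker := (@ker R n mu muP d).
Local Notation kerl := (@kerl R n mu muP d).

Lemma rnorm_hpoly (p : X) : rnorm p = hpoly_norm p. Proof. by []. Qed.

Lemma hpoly_le_norm (p : X) g : unitary_group g -> rnorm (p g : C) <= hpoly_norm p.
Proof. by move=> Ug; exact: hpoly_norm_ub (unitary_op_ball Ug). Qed.

Lemma hpoly_norm_unitary (p : X) M :
  (forall g, unitary_group g -> rnorm (p g : C) <= M) -> hpoly_norm p <= M.
Proof. by move=> pM; apply: hpoly_norm_le => A; exact: maximum_principle. Qed.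

(** The factor 2 comes from treating real and imaginary parts separately; it reaches only error
    terms, which are made arbitrarily small. *)
Lemma rnorm_EC (f : B -> C) M : cbm f -> (forall g, unitary_group g -> rnorm (f g) <= M) ->
  rnorm (EC mu f) <= 2 * M.
Proof.
move=> cf fM; apply: le_trans (rnorm_le_ReIm _) _.
have H (h : B -> R) : bmeas h -> (forall g, unitary_group g -> `|h g| <= M) -> `|ER mu h| <= M.
  move=> bh hM; rewrite ler_norml -{1}(ER_cst muP M) -(ER_cst muP M).
  rewrite -(ERN muP); last exact: bmeas_cst.
  apply/andP; split; apply: (ER_le muP); rewrite ?ER_cst//; try exact: bmeas_cst;
   by move=> g /hM; rewrite ler_norml => /andP[].
rewrite [leRHS]mulr_natl mulr2n; apply: lerD; apply: H.
- exact: cbm_Re.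
- by move=> g /fM; apply: le_trans; exact: Re_le_rnorm.
- exact: cbm_Im.
- by move=> g /fM; apply: le_trans; exact: Im_le_rnorm.
Qed.

Lemma mcoef_bound (a : T) (p : X) : rnorm (mcoef a p) <= 2 * hpoly_norm (dual a) * rnorm p.
Proof.
rewrite (mcoef_dual muP) -mulrA; apply: rnorm_EC => [|g Ug].
  exact: cbm_hpoly_conj.
by rewrite rnormM rnorm_conj mulrC ler_pM ?rnorm_ge0 ?hpoly_le_norm.
Qed.

Lemma mcoef_linear (a : T) (c : C) (p q : X) :
  mcoef a (c *: p + q : X) = c * mcoef a p + mcoef a q.
Proof.
rewrite !(mcoef_dual muP) -(ECZ muP); last exact: cbm_hpoly_conj.
rewrite -(ECD muP); last exact: cbm_hpoly_conj.
  by apply: eq_EC => g _; rewrite hpolyD hpolyZ mulrDl mulrA.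
by apply: cbmM; [exact: cbm_cst|exact: cbm_hpoly_conj].
Qed.

(** The constant is uniform over [x] in the group, because the sample points are fixed before
    [x]. *)
Lemma clip_family (s : T -> 'M[C]_n -> C) : (forall b, clips (s b)) ->
  exists L, forall x, unitary_group x -> clip (fun g => \sum_b mono b x * s b g) L.
Proof.
move=> /choice[L sL]; exists (\sum_b hpoly_norm (mono b) * L b) => x Ux; split.
  by apply: sumr_ge0 => b _; rewrite mulr_ge0 ?hpoly_norm_ge0//; case: (sL b).
move=> g h Ug Uh; rewrite -sumrB; apply: le_trans (rnorm_sum _ _ _) _.
rewrite mulr_suml; apply: ler_sum => b _; rewrite -mulrBr rnormM -mulrA.
by apply: ler_pM; rewrite ?rnorm_ge0 ?hpoly_le_norm//; case: (sL b) => _; apply.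
Qed.

Lemma clip_ker : exists L, forall x, unitary_group x -> clip (ker x) L.
Proof.
by apply: clip_family => b; apply: clips_conj; exact: clips_hpoly.
Qed.

Lemma clip_mul_ker (p : X) : exists L, forall x, unitary_group x -> clip (fun g => p g * ker x g) L.
Proof.
have [|L LP] := @clip_family (fun b g => p g * (dual b g)^*).
  by move=> b; apply: clipsM; [|apply: clips_conj]; exact: clips_hpoly.
exists L => x Ux; rewrite (_ : (fun _ => _) = fun g => \sum_b mono b x * (p g * (dual b g)^*)).
  exact: LP.
by apply/funext => g; rewrite mulr_sumr; apply: eq_bigr => b _; rewrite mulrCA.
Qed.

Lemma discretization_EC (I : finType) (w : I -> R) (x : I -> 'M[C]_n) (delta : R) :
  (forall (f : B -> R) L, bmeas f -> rlip f L -> `|ER mu f - \sum_i w i * f (x i)| <= L * delta) ->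
  forall (f : B -> C) L, cbm f -> clip f L ->
    rnorm (EC mu f - \sum_i RtoC (w i) * f (x i)) <= 2 * (L * delta).
Proof.
move=> disc f L cf fL; apply: le_trans (rnorm_le_ReIm _) _.
rewrite [leRHS]mulr_natl mulr2n; apply: lerD.
  have E1 : complex.Re (\sum_i RtoC (w i) * f (x i)) = \sum_i w i * complex.Re (f (x i)).
    rewrite (big_morph _ (@cReD R) (_ : complex.Re (0 : C) = 0))//.
    by apply: eq_bigr => i _; rewrite cReM/= mul0r subr0.
  by rewrite cReD cReN E1; exact: disc (cbm_Re cf) (clip_Re fL).
have E2 : complex.Im (\sum_i RtoC (w i) * f (x i)) = \sum_i w i * complex.Im (f (x i)).
  rewrite (big_morph _ (@cImD R) (_ : complex.Im (0 : C) = 0))//.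
  by apply: eq_bigr => i _; rewrite cImM/= mul0r addr0.
by rewrite cImD cImN E2; exact: disc (cbm_Im cf) (clip_Im fL).
Qed.

End KernelEstimates.

Section UpperBound.
Variables (R : realType) (n : nat) (mu : probability (mxBorel R n) R).
Hypothesis muP : is_haar mu.
Variable d : nat.
Local Notation C := (Cplx R).
Local Notation B := (mxBorel R n).
Local Notation X := (hpoly R d n).
Local Notation T := (mindex n d).
Local Notation mono := (@mono R n d).
Local Notation ker := (@ker R n mu muP d).
Local Notation kerl := (@kerl R n mu muP d).
Local Notation lambda := (ER mu (fun g => rnorm (kappa muP d g : C))).
Variables (Y : completeNormedModType C) (j : {linear X -> Y}).
Hypothesis jI : forall x, `|j x| = `|x|.

Let rnorm_j x : rnorm (j x) = rnorm x. Proof. by rewrite /rnorm jI. Qed.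

(** Evaluations at the sample points extend to [Y], and the discretised convolution built from them
    has norm close to [lambda], but it fixes X only approximately. The second sum of [F] adds the
    defects [Q a] of the monomials along extended coefficient functionals, so that [F] inverts [j]
    exactly; the defects are discretisation errors and hence small. *)
Lemma approximate_projection (e : R) : 0 < e -> exists F : Y -> X,
  [/\ forall a y z, F (a *: y + z) = a *: F y + F z,
      forall x, F (j x) = x & forall y, rnorm (F y) <= (lambda + e) * rnorm y].
Proof.
move=> e0.
have [L1 L1P] := clip_ker muP d.
have /choice[L2 L2P] := fun a => clip_mul_ker muP (mono a).
pose Kc a := 2 * hpoly_norm (@dual R n mu muP d a).
have Kc0 a : 0 <= Kc a by rewrite mulr_ge0 ?hpoly_norm_ge0.
(* [D] collects the factors of [delta] in all errors: [L1] for the norm of the discretised kernel,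
   the sum for the correction. The 1 in [e / (D + 1)] covers the case [D = 0]. *)
pose D := L1 + \sum_a Kc a * (2 * L2 a).
have L10 : 0 <= L1 by case: (L1P _ (@unitary_group1 R n)).
have L20 a : 0 <= L2 a by case: (L2P a _ (@unitary_group1 R n)).
have D0 : 0 <= D.
  by rewrite addr_ge0// sumr_ge0// => a _; exact: mulr_ge0 (Kc0 a) (mulr_ge0 (ler0n R 2) (L20 a)).
pose delta := e / (D + 1).
have d0 : 0 < delta by rewrite divr_gt0// ltr_wpDl.
have De : D * delta <= e.
  by rewrite /delta mulrCA ger_pMr// ler_pdivrMr ?ltr_wpDl// mul1r lerDl.
have [I [w [x [w0 w1 Ux disc _]]]] := discretization muP d0.
have /choice[phi phiP] : forall i, exists Phi : Y -> C,
    [/\ forall a v w, Phi (a *: v + w) = a * Phi v + Phi w,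
      forall p : X, Phi (j p) = p (x i) & forall v, rnorm (Phi v) <= 1 * rnorm v].
  move=> i; apply: (hahn_banach (phi := fun p : X => p (x i) : C)) => // p.
  by rewrite rnorm_j mul1r; exact: hpoly_le_norm.
have /choice[cc ccP] : forall a, exists Phi : Y -> C,
    [/\ forall a v w, Phi (a *: v + w) = a * Phi v + Phi w,
      forall p : X, Phi (j p) = mcoef a p & forall v, rnorm (Phi v) <= Kc a * rnorm v].
  move=> a; apply: (hahn_banach (phi := fun p : X => mcoef a p : C)) => //.
    by move=> c p q; exact: (mcoef_linear muP).
  by move=> p; rewrite rnorm_j; exact: mcoef_bound.
pose Q a : X := mono a - \sum_i (RtoC (w i) * mono a (x i)) *: kerl (x i).
pose F y : X := \sum_i (RtoC (w i) * phi i y) *: kerl (x i) + \sum_a cc a y *: Q a.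
exists F; split.
- move=> a y z; rewrite /F scalerDr !scaler_sumr addrACA -!big_split/=.
  congr (_ + _); apply: eq_bigr => i _.
    have [-> _ _] := phiP i; rewrite scalerA -scalerDl; congr (_ *: _).
    by rewrite mulrDr mulrCA.
  by have [-> _ _] := ccP i; rewrite scalerA -scalerDl.
- move=> p; rewrite /F.
  under [X in _ + X]eq_bigr => a _.
    have [_ -> _] := ccP a; rewrite /Q scalerBr scaler_sumr; over.
  rewrite sumrB -(mono_expand p) exchange_big/= addrCA -sumrB.
  rewrite big1 ?addr0// => i _.
  have [_ -> _] := phiP i.
  under [X in _ - X]eq_bigr do rewrite scalerA.
  rewrite -scaler_suml -scalerBl (_ : _ - _ = 0) ?scale0r//.
  rewrite {1}(mono_expand p) hpoly_sum mulr_sumr -sumrB big1// => a _.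
  by rewrite hpolyZ mulrCA subrr.
- move=> y; apply: hpoly_norm_unitary => g Ug.
  rewrite /F hpolyD !hpoly_sum; apply: le_trans (rnormD _ _) _.
  have y0 := rnorm_ge0 y.
  have H1 : rnorm (\sum_i ((RtoC (w i) * phi i y) *: kerl (x i)) g : C) <= (lambda + L1 * delta) * rnorm y.
    apply: (@le_trans _ _ ((\sum_i w i * rnorm (ker g (x i))) * rnorm y)).
      apply: le_trans (rnorm_sum _ _ _) _; rewrite mulr_suml; apply: ler_sum => i _.
      rewrite hpolyZ kerlE !rnormM rnorm_real// -!mulrA ler_wpM2l// mulrC ler_wpM2l ?rnorm_ge0//.
      by have [_ _ /(_ y)] := phiP i; rewrite mul1r.
    rewrite ler_wpM2r// -lerBlDl.
    have bk : bmeas (fun h : B => rnorm (ker g h)) by apply: cbm_rnorm; exact: cbm_ker.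
    have := disc _ _ bk (clip_rnorm (L1P g Ug)).
    by rewrite (ER_rnorm_ker muP d Ug) distrC => /(le_trans (ler_norm _)).
  have H2 : rnorm (\sum_a (cc a y *: Q a) g : C) <= (\sum_a Kc a * (2 * L2 a)) * delta * rnorm y.
    apply: le_trans (rnorm_sum _ _ _) _; rewrite !mulr_suml; apply: ler_sum => a _.
    have -> : Kc a * (2 * L2 a) * delta * rnorm y = (Kc a * rnorm y) * (2 * (L2 a * delta)) by ring.
    rewrite hpolyZ rnormM; apply: ler_pM; rewrite ?rnorm_ge0//.
      by have [_ _] := ccP a.
    have cm : cbm (fun h : B => mono a h * ker g h).
      by apply: cbmM; [exact: cbm_hpoly|exact: cbm_ker].
    have := discretization_EC disc cm (L2P a g Ug).
    rewrite kerP; congr (rnorm _ <= _); rewrite /Q hpolyD; congr (_ + _).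
    transitivity (- (\sum_i (RtoC (w i) * mono a (x i)) *: kerl (x i) : X) g : C) => //.
    rewrite hpoly_sum; congr (- _); apply: eq_bigr => i _.
    by rewrite hpolyZ kerlE mulrA.
  apply: le_trans (lerD H1 H2) _; rewrite -mulrDl ler_wpM2r// -addrA lerD2l.
  by rewrite -mulrDl.
Qed.

Lemma rel_proj_const_le : (rel_proj_const (range j) <= lambda%:E)%E.
Proof.
apply/lee_addgt0Pr => e e0.
have [F [FL Fj Fb]] := approximate_projection e0.
have jFL : linear (j \o F) by move=> a y z; rewrite /= FL linearP.
pose P : {linear Y -> Y} := HB.pack (j \o F) (GRing.isLinear.Build C Y Y _ (j \o F) jFL).
have PE y : P y = j (F y) by [].
have Pb y : rnorm (P y) <= (lambda + e) * rnorm y by rewrite PE rnorm_j.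
have l0 : 0 <= lambda by apply: ER_ge0 => g _; exact: rnorm_ge0.
apply: ge_ereal_inf; exists (opnorm (@rnorm R Y) (@rnorm R Y) P).
  exists P => //; split.
  - apply: bounded_linear_continuous; apply/ex_bound; exists (RtoC (lambda + e)).
    near=> y; rewrite /= -rnormE RtoC_le; apply: le_trans (Pb y) _.
    rewrite ler_piMr ?addr_ge0 ?(ltW e0)//.
    rewrite -RtoC_le rnormE RtoC1.
    near: y; apply/nbhs_ballP; exists 1 => //= y; rewrite -ball_normE/= sub0r normrN.
    exact: ltW.
  - by move=> y; rewrite !PE Fj.
  - apply/seteqP; split => [_ [y _ <-]|_ [x _ <-]]; first by exists (F y).
    by exists (j x) => //; rewrite PE Fj.
apply: ge_ereal_sup => _ [y y1 <-]; rewrite -EFinD lee_fin.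
by apply: le_trans (Pb y) _; rewrite ler_piMr ?addr_ge0 ?(ltW e0).
Unshelve. all: by end_near. Qed.

End UpperBound.

Lemma proj_const_le (R : realType) (n : nat) (mu : probability (mxBorel R n) R)
  (muP : is_haar mu) (d : nat) :
  (proj_const (hpoly R d n) <= (ER mu (fun g => rnorm (kappa muP d g : Cplx R)))%:E)%E.
Proof. by apply: ge_ereal_sup => _ [Y [j [jI ->]]]; exact: rel_proj_const_le. Qed.

(** * The lower bound *)

Section BoundedFunctions.
Variables (R : realType) (T : pointedType).
Local Notation C := (Cplx R).

(** Admitting all bounded functions makes completeness easy: a pointwise limit only has to be
    checked to be bounded. *)
Definition bfun_pred : {pred T -> C^o} :=
  fun f => `[< exists M : R, forall s, rnorm (f s : C) <= M >].

Lemma bfun_closed : subsemimod_closed bfun_pred.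
Proof.
split; first split.
- by apply/asboolP; exists 0 => s; rewrite rnorm0.
- move=> f g /asboolP[M fM] /asboolP[N gN]; apply/asboolP; exists (M + N) => s.
  exact: le_trans (rnormD _ _) (lerD (fM s) (gN s)).
- move=> c f /asboolP[M fM]; apply/asboolP; exists (rnorm c * M) => s.
  rewrite -[X in rnorm X]/(c * (f s : C)) rnormM; apply: ler_wpM2l (fM s); exact: rnorm_ge0.
Qed.

HB.instance Definition _ :=
  GRing.isSubSemiModClosed.Build C (T -> C^o) bfun_pred bfun_closed.

Record bfun := BFun { bfun_fun :> T -> C^o; bfunP : bfun_fun \in bfun_pred }.

HB.instance Definition _ := [isSub for bfun_fun].
HB.instance Definition _ := [Choice of bfun by <:].
HB.instance Definition _ := [SubChoice_isSubLmodule of bfun by <:].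

Definition bfun_norm (f : bfun) : R := sup [set rnorm (f s : C) | s in setT].

Lemma bfun_norm_ub (f : bfun) s : rnorm (f s : C) <= bfun_norm f.
Proof.
apply: ub_le_sup; last by exists s.
by have /asboolP[M fM] := bfunP f; exists M => _ [s' _ <-].
Qed.

Lemma bfun_norm_le (f : bfun) M : (forall s, rnorm (f s : C) <= M) -> bfun_norm f <= M.
Proof.
by move=> fM; apply: ge_sup; [exists (rnorm (f point : C)), point|move=> _ [s _ <-]].
Qed.

Lemma bfun_norm_ge0 (f : bfun) : 0 <= bfun_norm f.
Proof. exact: le_trans (rnorm_ge0 _) (bfun_norm_ub f point). Qed.

Definition bfun_normC (f : bfun) : C := RtoC (bfun_norm f).

Lemma bfun_normD f g : bfun_normC (f + g) <= bfun_normC f + bfun_normC g.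
Proof.
rewrite /bfun_normC -RtoCD RtoC_le; apply: bfun_norm_le => s.
exact: le_trans (rnormD _ _) (lerD (bfun_norm_ub f s) (bfun_norm_ub g s)).
Qed.

Lemma bfunZ (c : C) (f : bfun) s : (c *: f) s = c * f s. Proof. by []. Qed.

Lemma bfun_normZ (c : C) f : bfun_normC (c *: f) = `|c| * bfun_normC f.
Proof.
rewrite /bfun_normC -rnormE -RtoCM; congr RtoC.
have cfE s : rnorm ((c *: f) s : C) = rnorm c * rnorm (f s : C) by rewrite bfunZ rnormM.
apply/eqP; rewrite eq_le; apply/andP; split.
  by apply: bfun_norm_le => s; rewrite cfE ler_wpM2l ?rnorm_ge0 ?bfun_norm_ub.
have [c0|c0] := eqVneq (rnorm c) 0; first by rewrite c0 mul0r bfun_norm_ge0.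
have {}c0 : 0 < rnorm c by rewrite lt_def c0 rnorm_ge0.
rewrite -ler_pdivlMl//; apply: bfun_norm_le => s.
by rewrite ler_pdivlMl// -cfE bfun_norm_ub.
Qed.

Lemma bfun_norm_eq0 f : bfun_normC f = 0 -> f = 0.
Proof.
move=> /(@RtoC_inj R) f0; apply/val_inj/funext => s.
by apply: (@rnorm_eq0 R C); apply/eqP; rewrite eq_le rnorm_ge0 andbT -f0 bfun_norm_ub.
Qed.

HB.instance Definition _ := Lmodule_isNormed.Build C bfun
  bfun_normD bfun_normZ bfun_norm_eq0.

Lemma bfun_rnormE (f : bfun) : rnorm f = bfun_norm f. Proof. by []. Qed.

Lemma bfunB (f g : bfun) s : (f - g) s = f s - g s. Proof. by []. Qed.

(** With [h] the real or the imaginary part, completeness is inherited from the real line, one point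
    [s] at a time. *)
Lemma real_part_cvg (F : set_system bfun) (h : C -> R) (s : T) : ProperFilter F -> cauchy F ->
  (forall z w, `|h z - h w| <= rnorm (z - w)) ->
  exists a : R, forall e, 0 < e -> \forall f \near F, `|a - h ((f : bfun) s)| < e.
Proof.
move=> FF Fc hL.
have hc : cauchy ((fun f : bfun => h (f s)) @ F).
  apply/cauchy_ballP => e e0.
  have := @cauchy_ballP _ _ F FF; move=> [_ /(_ Fc (RtoC e))].
  rewrite -RtoC0 ltcR => /(_ e0); rewrite near_simpl => H.
  rewrite near_simpl near_map2; apply: filterS H => -[f g] /=.
  rewrite -!ball_normE/= -rnormE ltcR => fg.
  apply: le_lt_trans (hL _ _) _; apply: le_lt_trans fg.
  by rewrite -bfunB bfun_rnormE; exact: bfun_norm_ub.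
have /cvg_ex[a ha] : cvg ((fun f : bfun => h (f s)) @ F) by exact: cauchy_cvg.
exists a => e e0; have /cvgrPdist_lt/(_ e e0) := ha.
by rewrite near_map.
Qed.

Lemma bfun_complete (F : set_system bfun) : ProperFilter F -> cauchy F -> cvg F.
Proof.
move=> FF Fc.
have ReL (z w : C) : `|complex.Re z - complex.Re w| <= rnorm (z - w).
  by rewrite -cReN -cReD Re_le_rnorm.
have ImL (z w : C) : `|complex.Im z - complex.Im w| <= rnorm (z - w).
  by rewrite -cImN -cImD Im_le_rnorm.
have /choice[l lP] : forall s, exists l : C, forall e, 0 < e -> \forall f \near F, rnorm (l - (f : bfun) s) < e.
  move=> s; have [a aP] := real_part_cvg s FF Fc ReL; have [b bP] := real_part_cvg s FF Fc ImL.
  exists (Complex a b) => e e0; have e20 : 0 < e / 2 by rewrite divr_gt0.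
  near=> f; apply: le_lt_trans (rnorm_le_ReIm _) _.
  rewrite cReD cReN cImD cImN/= (splitr e); apply: ltrD.
    by near: f; exact: aP.
  by near: f; exact: bP.
(* The Cauchy condition is uniform in [s], pointwise convergence is not. At each [s] a third
   function [g] is inserted, Cauchy-close to [f] and [eta]-close to the limit at [s], and then [eta]
   tends to 0. *)
have close e : 0 < e -> \forall f \near F, forall s, rnorm (l s - (f : bfun) s) <= e.
  move=> e0; have := @cauchy_ballP _ _ F FF; move=> [_ /(_ Fc (RtoC e))].
  rewrite -RtoC0 ltcR => /(_ e0); rewrite near_simpl => /nearP_dep H.
  apply: filterS H => f Hf s.
  apply/ler_addgt0Pr => eta eta0.
  have := @filter_ex _ F FF _ (filterI Hf (lP s eta eta0)) => -[g [fg lg]].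
  have -> : l s - f s = (l s - g s) + - (f s - g s) by rewrite opprB addrA subrK.
  apply: le_trans (rnormD _ _) _; rewrite addrC; apply: lerD; last exact: ltW.
  move: fg; rewrite -ball_normE/= -rnormE ltcR => /ltW; apply: le_trans.
  have -> : rnorm (- (f s - g s) : C) = rnorm ((f - g) s : C) by rewrite /rnorm normrN.
  exact: bfun_norm_ub.
have lb : (l : T -> C^o) \in bfun_pred.
  have [f fl] := @filter_ex _ F FF _ (close 1 ltr01).
  have /asboolP[M fM] := bfunP f; apply/asboolP; exists (1 + M) => s.
  by rewrite -(subrK (f s) (l s)); exact: le_trans (rnormD _ _) (lerD (fl s) (fM s)).
apply/cvg_ex; exists (BFun lb); apply/cvgrPdist_le => e e0.
have [e1 eE] : exists e1, e = RtoC e1 by have /ltW/ger0_real/complex_realP := e0.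
subst e; rewrite -RtoC0 ltcR in e0.
apply: filterS (close e1 e0) => f fl; rewrite -rnormE lecR.
by rewrite bfun_rnormE; apply: bfun_norm_le => s; exact: fl.
Unshelve. all: by end_near. Qed.

HB.instance Definition _ := Uniform_isComplete.Build bfun bfun_complete.

End BoundedFunctions.

Section LowerBound.
Variables (R : realType) (n : nat) (mu : probability (mxBorel R n) R).
Hypothesis muP : is_haar mu.
Variable d : nat.
Local Notation C := (Cplx R).
Local Notation B := (mxBorel R n).
Local Notation X := (hpoly R d n).
Local Notation T := (mindex n d).
Local Notation mono := (@mono R n d).
Local Notation kap := (kappa muP d).
Local Notation lambda := (ER mu (fun g => rnorm (kap g : C))).
Local Notation Y := (bfun R 'M[C]_n).

Let inU (x : 'M[C]_n) : bool := x \is unitarymx.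

Lemma ubfun_subproof (f : 'M[C]_n -> C) (M : R) :
  0 <= M -> (forall g, unitary_group g -> rnorm (f g) <= M) ->
  ((fun g => if inU g then f g else 0) : 'M[C]_n -> C^o) \in @bfun_pred R 'M[C]_n.
Proof.
move=> M0 fM; apply/asboolP; exists M => g.
by case: ifPn => [Ug|_]; [exact: fM|rewrite rnorm0].
Qed.

(** Functions on the group are stored as functions on all matrices vanishing off the group, so the
    supremum norm sees the group alone. The maximum principle makes this restriction isometric. *)
Definition restr_unitary (p : X) : Y :=
  BFun (ubfun_subproof (hpoly_norm_ge0 p) (fun g => @hpoly_le_norm R n d p g)).

Lemma restr_unitary_linear : linear restr_unitary.
Proof.
move=> a p q; apply/val_inj/funext => g.
change ((if inU g then (a *: p + q) g else 0) = a * (if inU g then p g else 0) + (if inU g then q g else 0)).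
by case: ifPn => // _; rewrite mulr0 addr0.
Qed.

Lemma rnorm_restr_unitary p : rnorm (restr_unitary p) = rnorm p.
Proof.
rewrite bfun_rnormE rnorm_hpoly; apply/eqP; rewrite eq_le; apply/andP; split.
  apply: bfun_norm_le => g.
  change (rnorm (if inU g then p g else 0 : C) <= hpoly_norm p).
  by case: ifPn => [Ug|_]; [exact: hpoly_le_norm|rewrite rnorm0 hpoly_norm_ge0].
apply: hpoly_norm_unitary => g Ug.
by have := bfun_norm_ub (restr_unitary p) g; rewrite /= /inU (Ug : is_true (g \is unitarymx)).
Qed.

(* A bounded multiple of the phase of the conjugate of kappa, regularised to be Lipschitz. *)
Definition phase (e : R) (g : 'M[C]_n) : C := (kap g)^* * RtoC ((rnorm (kap g : C) + e)^-1).

Section Phase.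
Variable e : R.
Hypothesis e0 : 0 < e.

Let den0 g : 0 < rnorm (kap g : C) + e. Proof. by rewrite ltr_wpDl ?rnorm_ge0. Qed.

Lemma rnorm_phase g : rnorm (phase e g) <= 1.
Proof.
rewrite rnormM rnorm_conj rnorm_real ?invr_ge0 ?(ltW (den0 g))//.
by rewrite ler_pdivrMr// mul1r lerDl ltW.
Qed.

Lemma cbm_phase : cbm (phase e : B -> C).
Proof.
apply: cbmM; first by apply: cbm_conj; exact: cbm_hpoly.
apply: cbm_RtoC; split; last first.
  exists e^-1 => g _; rewrite ger0_norm ?invr_ge0 ?(ltW (den0 g))//.
  by rewrite lef_pV2 ?posrE// lerDr rnorm_ge0.
rewrite (_ : (fun _ => _) = (@powR R ^~ (-1)) \o (fun g : B => rnorm (kap g : C) + e)).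
  apply: measurableT_comp; first exact: measurable_powR.
  by apply: measurable_funD => //; apply: measurable_rnorm; exact: cmeas_hpoly.
by apply/funext => g /=; rewrite powR_inv1// ltW.
Qed.

Lemma clips_phase : clips (phase e).
Proof.
apply: clipsM; first by apply: clips_conj; exact: clips_hpoly.
have [L [L0 kL]] := clips_hpoly kap; exists (L / e ^+ 2); split; first by rewrite divr_ge0// sqr_ge0.
move=> g h Ug Uh.
have -> : RtoC ((rnorm (kap g : C) + e)^-1) - RtoC ((rnorm (kap h : C) + e)^-1) =
  RtoC ((rnorm (kap h : C) - rnorm (kap g : C)) / ((rnorm (kap g : C) + e) * (rnorm (kap h : C) + e))).
  rewrite -[LHS](rmorphB (real_complex R)); congr RtoC.
  have := den0 g; have := den0 h; move: (rnorm _) => a; move: (rnorm _) => b hb ha.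
  by field; rewrite !gt_eqF.
rewrite -[RtoC _]/(Complex _ 0) rnorm_sqrt/= expr0n addr0 sqrtr_sqr normrM mulrAC.
have p0 : 0 < (rnorm (kap g : C) + e) * (rnorm (kap h : C) + e) by rewrite mulr_gt0.
apply: ler_pM; rewrite ?normr_ge0//.
  apply: le_trans (rnorm_dist _ _) _; rewrite -[leLHS]rnormN opprB; exact: kL.
rewrite ger0_norm ?invr_ge0 ?(ltW p0)// lef_pV2 ?posrE ?exprn_gt0// expr2.
by apply: ler_pM; rewrite ?(ltW e0)// lerDr rnorm_ge0.
Qed.

Lemma phase_kappa : lambda - e <= ER mu (fun g => rnorm (kap g : C) ^+ 2 / (rnorm (kap g : C) + e)) /\
  EC mu (fun g => kap g * phase e g) =
    RtoC (ER mu (fun g => rnorm (kap g : C) ^+ 2 / (rnorm (kap g : C) + e))).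
Proof.
split; last first.
  rewrite -(EC_RtoC muP); apply: eq_EC => g _.
  by rewrite /phase RtoCM RtoC_rnorm_sq mulrA.
have bk : bmeas (fun g : B => rnorm (kap g : C)) by apply: cbm_rnorm; exact: cbm_hpoly.
rewrite -[X in _ - X](ER_cst muP) -(ERB muP)//; last exact: bmeas_cst.
apply: (ER_le muP).
- by apply: bmeasD => //; exact: bmeas_cst.
- have := cbm_Re (cbmM (cbm_hpoly kap) cbm_phase).
  rewrite (_ : _ \o _ = fun g => rnorm (kap g : C) ^+ 2 / (rnorm (kap g : C) + e))//.
  apply/funext => g /=.
  by rewrite /phase mulrA -RtoC_rnorm_sq -RtoCM.
(* As [(a - e) (a + e) <= a^2], regularising the phase costs at most [e]. *)
- move=> g _; rewrite ler_pdivlMr//; have := rnorm_ge0 (kap g : C).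
  move: (rnorm _) => a a0; have := sqr_ge0 e; nra.
Qed.

End Phase.

Lemma clipM_const (f1 f2 : 'M[C]_n -> C) L1 L2 M1 M2 : clip f1 L1 -> clip f2 L2 ->
  0 <= M1 -> 0 <= M2 ->
  (forall g, unitary_group g -> rnorm (f1 g) <= M1) ->
  (forall g, unitary_group g -> rnorm (f2 g) <= M2) ->
  clip (fun g => f1 g * f2 g) (L1 * M2 + M1 * L2).
Proof.
move=> [L10 f1L] [L20 f2L] M10 M20 b1 b2; split; first by rewrite addr_ge0 ?mulr_ge0.
move=> g h Ug Uh.
have -> : f1 g * f2 g - f1 h * f2 h = (f1 g - f1 h) * f2 g + f1 h * (f2 g - f2 h).
  by rewrite mulrBl mulrBr addrA subrK.
apply: le_trans (rnormD _ _) _; rewrite [leRHS]mulrDl !rnormM; apply: lerD.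
  by rewrite mulrAC ler_pM ?rnorm_ge0 ?f1L ?b2.
by rewrite -mulrA ler_pM ?rnorm_ge0 ?f2L ?b1.
Qed.

Lemma cbm_mcoef_trans (b : T) (p : X) : cbm (fun g : B => mcoef b (htrans 1%:M g p : X)).
Proof.
apply: cbmM; first exact: cbm_cst.
apply: cbm_sum => k; apply: cbmM; last exact: cbm_cst.
set M := (\matrix_(i, j) _ : 'M[C]_n).
rewrite (_ : (fun _ => _) = (htrans M 1%:M p : X)); first exact: cbm_hpoly.
by apply/funext => g; rewrite !htransE mul1mx mulmx1.
Qed.

Section Trace.
Variable F : 'M[C]_n -> C.
Hypotheses (cF : cbm (F : B -> C)) (F1 : forall g, rnorm (F g) <= 1) (FL : clips F).

(** The convolution of [p] with [F] is assembled coefficient by coefficient, which puts it in X by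
    construction; [convE] recovers the integral. *)
Definition conv (p : X) : X := \sum_b EC mu (fun g => mcoef b (htrans 1%:M g p : X) * F g) *: mono b.

Lemma convE p x : conv p x = EC mu (fun g => p (x *m g) * F g).
Proof.
have cm (b : T) : cbm (fun g : B => mcoef b (htrans 1%:M g p : X) * F g).
  exact: cbmM (cbm_mcoef_trans b p) cF.
transitivity (EC mu (fun g => \sum_(b : T) (mono b x : C) * (mcoef b (htrans 1%:M g p : X) * F g))).
  rewrite (EC_sum muP) => [|b]; last exact: cbmM (cbm_cst _ _) (cm b).
  rewrite hpoly_sum; apply: eq_bigr => b _.
  by rewrite hpolyZ (ECZ muP); [exact: mulrC|exact: cm].
apply: eq_EC => g _.
have -> : p (x *m g) = (htrans 1%:M g p : X) x by rewrite htransE mul1mx.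
rewrite [in RHS](mono_expand (htrans 1%:M g p)) hpoly_sum mulr_suml.
by apply: eq_bigr => b _; rewrite hpolyZ mulrA [mono b x * _]mulrC.
Qed.

(** Invariance moves the translation from [p] to [F]. In this form the operator reads only values of
    [p] on the group, so sampling yields a finite-rank map into [Y]. *)
Lemma conv_unitary p x : unitary_group x -> conv p x = EC mu (fun g => p g * F (x^t* *m g)).
Proof.
move=> Ux; rewrite convE.
have cm : cbm (fun g : B => p (x *m (g : 'M[C]_n)) * F g).
  apply: cbmM cF; rewrite (_ : (fun _ => _) = (htrans x 1%:M p : X)); first exact: cbm_hpoly.
  by apply/funext => g; rewrite htransE mulmx1.
rewrite -(EC_mulmx muP (unitary_groupV Ux) (@unitary_group1 R n) cm).
by apply: eq_EC => g _; rewrite mulmx1 mulmxA (unitarymxP Ux) mul1mx.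
Qed.

Lemma mcoef_conv (a : T) p : mcoef a (conv p) = EC mu (fun g => mcoef a (htrans 1%:M g p : X) * F g).
Proof.
have -> : (conv p : _ -> C) = fun A => \sum_b EC mu (fun g => mcoef b (htrans 1%:M g p : X) * F g) * mono b A.
  by apply/funext => A; rewrite hpoly_sum.
rewrite mcoef_sum (bigD1 a) // big1 => [|b ba].
  rewrite [LHS]addr0; have -> : mcoef a (fun A => mono a A) = 1.
    by have := mcoef_mono R a a; rewrite eqxx.
  exact: mulr1.
have -> : mcoef a (fun A => mono b A) = 0.
  by have := mcoef_mono R a b; rewrite eq_sym (negbTE ba).
exact: mulr0.
Qed.

(** Convolution averages right translations with weight [F], and the trace of translation by [g] is
    [kappa g]. *)
Lemma trace_conv : \sum_a mcoef a (conv (mono a)) = EC mu (fun g => kap g * F g).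
Proof.
under eq_bigr do rewrite mcoef_conv.
rewrite -(EC_sum muP) => [|b]; last exact: cbmM (cbm_mcoef_trans _ _) cF.
by apply: eq_EC => g Ug; rewrite -mulr_suml (kappa_trace muP).
Qed.

Variables (P : {linear Y -> Y}) (r : R).
Hypotheses (r0 : 0 <= r) (Pr : forall y, rnorm (P y) <= r * rnorm y).
Hypothesis Prange : range P = range restr_unitary.
Hypothesis PP : forall y, P (P y) = P y.

(** [P] is read as a map [q] from [Y] onto X that inverts the restriction. Convolution with [F] is
    nearly the finite-rank map [S'], so its trace on X is nearly that of [q] after [S']. The latter
    is an average of the numbers [q (Fy i) (x i)], each of modulus at most [r]. *)
Lemma trace_bound : rnorm (EC mu (fun g => kap g * F g)) <= r.
Proof.
have /choice[q qE] : forall y, exists p, restr_unitary p = P y.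
  move=> y; have : range P (P y) by exists y.
  by rewrite Prange => -[p _ <-]; exists p.
have jinj p p' : restr_unitary p = restr_unitary p' -> p = p'.
  move=> pp; apply/eqP; rewrite -subr_eq0; apply/eqP/(@rnorm_eq0 R X).
  rewrite -rnorm_restr_unitary.
  have -> : p - p' = (-1) *: p' + p by rewrite scaleN1r addrC.
  by rewrite restr_unitary_linear pp scaleN1r addNr rnorm0.
have qL a y z : q (a *: y + z) = a *: q y + q z.
  by apply: jinj; rewrite restr_unitary_linear !qE linearP.
have qB y z : q (y - z) = q y - q z.
  by have -> : y - z = (-1) *: z + y; [rewrite scaleN1r addrC|rewrite qL scaleN1r addrC].
have qj p : q (restr_unitary p) = p.
  apply: jinj; rewrite qE.
  have : range restr_unitary (restr_unitary p) by exists p.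
  by rewrite -Prange => -[y _ <-]; exact: PP.
have qr y : rnorm (q y) <= r * rnorm y by rewrite -rnorm_restr_unitary qE.
have q0 : q 0 = 0.
  by apply: (@rnorm_eq0 R X); apply/eqP; rewrite eq_le rnorm_ge0 andbT (le_trans (qr 0))// rnorm0 mulr0.
have qsum (I : finType) (c : I -> C) (y : I -> Y) : q (\sum_i c i *: y i) = \sum_i c i *: q (y i).
  by elim/big_rec2 : _ => // i y1 y2 _ <-; rewrite qL.
have [LF LFP] := FL; have /choice[Lm LmP] := fun a => clips_hpoly (mono a).
have Lm0 a : 0 <= Lm a by case: (LmP a).
have LF0 : 0 <= LF by case: LFP.
pose L a := Lm a * 1 + hpoly_norm (mono a) * (LF * n%:R).
have L0 a : 0 <= L a.
  exact: addr_ge0 (mulr_ge0 (Lm0 a) ler01) (mulr_ge0 (hpoly_norm_ge0 _) (mulr_ge0 LF0 (ler0n _ _))).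
have LP a x : unitary_group x -> clip (fun g => mono a g * F (x^t* *m g)) (L a).
  move=> Ux; apply: (clipM_const (LmP a) (clip_mulmx (unitary_groupV Ux) LFP) (hpoly_norm_ge0 _) ler01).
    by move=> g Ug; exact: hpoly_le_norm.
  by move=> g _; exact: F1.
pose Kc a := 2 * hpoly_norm (@dual R n mu muP d a).
have Kc0 a : 0 <= Kc a by rewrite mulr_ge0 ?hpoly_norm_ge0.
pose D := \sum_a Kc a * (r * (2 * L a)).
have D0 : 0 <= D.
  apply: sumr_ge0 => a _.
  exact: mulr_ge0 (Kc0 a) (mulr_ge0 r0 (mulr_ge0 (ler0n R 2) (L0 a))).
apply/ler_addgt0Pr => e e0.
pose delta := e / (D + 1).
have d0 : 0 < delta by rewrite divr_gt0// ltr_wpDl.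
have De : D * delta <= e.
  by rewrite /delta mulrCA ger_pMr// ler_pdivrMr ?ltr_wpDl// mul1r lerDl.
have [I [w [x [w0 w1 Ux disc _]]]] := discretization muP d0.
(* The factor with which the sample point [x i] contributes to the convolution at [g]; the bound on
   [F] puts it in the unit ball of [Y]. *)
pose Fy i : Y := BFun (ubfun_subproof ler01 (fun g (_ : unitary_group g) => F1 (g^t* *m x i))).
have Fy1 i : rnorm (Fy i) <= 1.
  rewrite bfun_rnormE; apply: bfun_norm_le => g.
  change (rnorm (if inU g then F (g^t* *m x i) else 0 : C) <= 1).
  by case: ifPn => _; rewrite ?F1// rnorm0.
pose S' p : Y := \sum_i (RtoC (w i) * p (x i)) *: Fy i.
have close a : rnorm (restr_unitary (conv (mono a)) - S' (mono a)) <= 2 * (L a * delta).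
  rewrite bfun_rnormE; apply: bfun_norm_le => g; rewrite bfunB.
  have S'E : S' (mono a) g = \sum_i (RtoC (w i) * mono a (x i)) * Fy i g.
    exact: (big_morph (fun f : Y => f g : C) (id1 := 0) (op1 := +%R)).
  rewrite S'E.
  have FyE i : Fy i g = if inU g then F (g^t* *m x i) else 0 by [].
  have jE p : restr_unitary p g = if inU g then p g else 0 by [].
  rewrite jE; under eq_bigr do rewrite FyE.
  case: ifPn => [Ug|_]; last first.
    rewrite big1 => [|i _]; last exact: mulr0.
    rewrite subrr rnorm0; exact: mulr_ge0 (ler0n R 2) (mulr_ge0 (L0 a) (ltW d0)).
  have cm : cbm (fun h : B => mono a h * F (g^t* *m (h : 'M[C]_n))).
    apply: cbmM; first exact: cbm_hpoly.
    have := cbm_mulmx (unitary_groupV (Ug : unitary_group g)) (@unitary_group1 R n) cF.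
    by under eq_fun do rewrite mulmx1.
  have := discretization_EC disc cm (LP a g Ug).
  rewrite conv_unitary//; congr (rnorm (_ - _) <= _).
  by apply: eq_bigr => i _; rewrite mulrA.
(* Cyclicity of the trace for a sum of rank-one maps, with [mono] and [mcoef] as dual bases. *)
have trS' : \sum_a mcoef a (q (S' (mono a))) = \sum_i RtoC (w i) * q (Fy i) (x i).
  under eq_bigr => a _.
    rewrite qsum (_ : mcoef a _ = \sum_i (RtoC (w i) * mono a (x i)) * mcoef a (q (Fy i))).
      over.
    rewrite -(mcoef_sum a (fun i => RtoC (w i) * mono a (x i)) (fun i => (q (Fy i) : _ -> C))).
    by congr mcoef; apply/funext => A; rewrite hpoly_sum.
  rewrite exchange_big; apply: eq_bigr => i _ /=.
  rewrite [in RHS](mono_expand (q (Fy i))) hpoly_sum mulr_sumr; apply: eq_bigr => a _.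
  by rewrite hpolyZ -mulrA; congr (_ * _); exact: mulrC.
have mcoefB (a : T) (p1 p2 : X) : mcoef a p1 = mcoef a p2 + mcoef a (p1 - p2 : X).
  have := mcoef_linear muP a 1 (p1 - p2) p2; rewrite scale1r mul1r subrK => ->.
  exact: addrC.
rewrite -trace_conv.
have -> : \sum_a mcoef a (conv (mono a)) = \sum_i RtoC (w i) * q (Fy i) (x i) +
   \sum_a mcoef a (q (restr_unitary (conv (mono a)) - S' (mono a))).
  rewrite -trS' -big_split; apply: eq_bigr => a _ /=.
  rewrite (mcoefB a _ (q (S' (mono a)))); congr (_ + mcoef a _).
  by rewrite qB qj.
apply: le_trans (rnormD _ _) _; apply: lerD.
  apply: le_trans (rnorm_sum _ _ _) _.
  rewrite -[leRHS]mul1r -w1 mulr_suml; apply: ler_sum => i _.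
  rewrite rnormM rnorm_real// ler_wpM2l//.
  apply: le_trans (hpoly_le_norm _ (Ux i)) _; rewrite -rnorm_hpoly.
  by apply: le_trans (qr _) _; rewrite -[leRHS]mulr1 ler_wpM2l.
apply: le_trans (rnorm_sum _ _ _) _; apply: le_trans De; rewrite mulr_suml.
apply: ler_sum => a _.
apply: le_trans (mcoef_bound muP a _) _; rewrite -/(Kc a) -mulrA ler_wpM2l//.
apply: le_trans (qr _) _; rewrite -!mulrA ler_wpM2l//; exact: close.
Qed.

End Trace.

Lemma lambda_le (P : {linear Y -> Y}) (r : R) : 0 <= r ->
  (forall y, rnorm (P y) <= r * rnorm y) ->
  range P = range restr_unitary -> (forall y, P (P y) = P y) -> lambda <= r.
Proof.
move=> r0 Pr Prange PP; apply/ler_addgt0Pr => e e0; rewrite -lerBlDr.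
have [H1 H2] := phase_kappa e0.
apply: le_trans H1 _.
have := trace_bound (cbm_phase e0) (rnorm_phase e0) (clips_phase e0) r0 Pr Prange PP.
rewrite H2 rnorm_real//; apply: ER_ge0 => g _.
by rewrite divr_ge0 ?sqr_ge0// ltW// ltr_wpDl ?rnorm_ge0.
Qed.

Lemma proj_const_ge : (lambda%:E <= proj_const (hpoly R d n))%E.
Proof.
pose jl : {linear X -> Y} := HB.pack restr_unitary (GRing.isLinear.Build C X Y _ restr_unitary restr_unitary_linear).
have jlE x : jl x = restr_unitary x by [].
apply: (@le_trans _ _ (rel_proj_const (range jl))); last first.
  apply: ereal_sup_ubound; exists Y, jl; split => // x.
  by rewrite -!rnormE jlE rnorm_restr_unitary.
apply: le_ereal_inf_tmp => _ [P [_ PP Prange] <-].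
have Pnorm y : rnorm y <= 1 -> ((rnorm (P y))%:E <= opnorm (@rnorm R Y) (@rnorm R Y) P)%E.
  by move=> y1; apply: ereal_sup_ubound; exists y.
case E : (opnorm _ _ _) => [r| |]; [|exact: leey|]; last first.
  have := Pnorm 0; rewrite rnorm0 ler01 E => /(_ isT).
  by rewrite leeNy_eq.
rewrite lee_fin; apply: (@lambda_le P) => //.
- have := Pnorm 0; rewrite rnorm0 ler01 E lee_fin => /(_ isT); apply: le_trans.
  exact: rnorm_ge0.
- move=> y; have [y0|y0] := eqVneq (rnorm y) 0.
    by rewrite (rnorm_eq0 y0) linear0 rnorm0 mulr0.
  have {}y0 : 0 < rnorm y by rewrite lt_def y0 rnorm_ge0.
  have := Pnorm (RtoC (rnorm y)^-1 *: y); rewrite rnormZ rnorm_real ?invr_ge0 ?(ltW y0)//.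
  rewrite mulVf ?gt_eqF// lexx E lee_fin => /(_ isT).
  by rewrite linearZ/= rnormZ rnorm_real ?invr_ge0 ?(ltW y0)// mulrC ler_pdivrMr.
Qed.

End LowerBound.

(** * Moments of traces *)

Section TracePowers.
Variables (R : realType) (n : nat).
Local Notation C := (Cplx R).
Implicit Types g : 'M[C]_n.

Lemma unitary_groupX g k : unitary_group g -> unitary_group (g ^+ k).
Proof.
move=> Ug; elim: k => [|k IH]; first exact: unitary_group1.
by rewrite exprS; exact: unitary_groupM.
Qed.

Lemma rnorm_tr_le g k : unitary_group g -> rnorm (\tr (g ^+ k)) <= n%:R.
Proof.
move=> /(unitary_groupX k)/unitary_op_ball/op_ball_coord gb.
apply: le_trans (rnorm_sum _ _ _) _.
have -> : n%:R = \sum_(i < n) 1 :> R by rewrite sumr_const card_ord.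
by apply: ler_sum => i _.
Qed.

Lemma cbm_trpow k : cbm (fun g : mxBorel R n => \tr ((g : 'M[C]_n) ^+ k)).
Proof.
by split; [exact: cmeas_trpow|exists n%:R => g Ug; exact: rnorm_tr_le].
Qed.

Lemma rnorm_prod (I : Type) (s : seq I) (P : pred I) (F : I -> C) :
  rnorm (\prod_(i <- s | P i) F i) = \prod_(i <- s | P i) rnorm (F i).
Proof. by apply: (big_morph _ (@rnormM R)); rewrite /rnorm normr1. Qed.

Variable d : nat.
Definition ones : {ffun 'I_d -> 'I_d.+1} := [ffun=> inord 1].

Lemma onesE j : ones j = 1%N :> nat.
Proof. by rewrite ffunE inordK//; case: d j => // -[]. Qed.

Lemma ones_partition : is_partition ones.
Proof.
apply/andP; split.
  by apply/forallP => i; apply/forallP => j; apply/implyP => _; rewrite !onesE.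
apply/eqP; rewrite (eq_bigr (fun=> 1%N)) => [|j _]; last by rewrite onesE.
by rewrite sum1_card card_ord.
Qed.

Lemma plength_ones : plength ones = d.
Proof.
rewrite -[RHS]card_ord /plength; apply: eq_card => j.
by rewrite !inE onesE.
Qed.

Lemma pmult_ones r : pmult ones r = ((r == 1%N) * d)%N.
Proof.
case: eqP => [->|r1]; last by apply: eq_card0 => j; rewrite !inE onesE; apply/eqP => /esym.
by rewrite mul1n -[RHS]card_ord; apply: eq_card => j; rewrite !inE onesE.
Qed.

Lemma pz_ones : pz ones = d`!.
Proof.
rewrite /pz; have [d0|d0] := posnP d; first by rewrite big_geq ?d0.
rewrite big_ltn ?ltnS// pmult_ones mul1n exp1n mul1n big_nat_cond big1 ?muln1// => r.
by move=> /andP[/andP[r1 _] _]; rewrite pmult_ones gtn_eqF.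
Qed.

Variable m : {ffun 'I_d -> 'I_d.+1}.
Hypotheses (mP : is_partition m) (mN : m != ones).

Lemma exists_big_part : exists j : 'I_d, (1 < m j)%N.
Proof.
apply/existsP; apply: contraT; rewrite negb_exists => /forallP m1.
move/negP: mN; case; apply/eqP/ffunP => j; apply/val_inj; rewrite /= onesE.
have le1 i : (m i <= 1)%N by rewrite leqNgt m1.
apply/eqP; rewrite eqn_leq le1/= lt0n; apply/eqP => mj0.
have /andP[_ /eqP] := mP; rewrite (bigD1 j)//= mj0 add0n => E.
have : (\sum_(i < d | i != j) m i <= \sum_(i < d | i != j) 1)%N by apply: leq_sum.
rewrite E sum1_card => H.
have := cardC1 j; rewrite card_ord => cE.
have : (d <= d.-1)%N by rewrite -cE; apply: leq_trans H _; apply/eq_leq/eq_card.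
have := leq_ltn_trans (leq0n j) (ltn_ord j); lia.
Qed.

(** A part of size at least 2 uses up two units of [d], which leaves at most [d - 2] parts equal to
    1. *)
Lemma card_small_parts : (#|[pred j | nat_of_ord (m j) == 1%N]| <= d.-2)%N.
Proof.
have [j0 mj0] := exists_big_part.
have /andP[_ /eqP] := mP; rewrite (bigD1 j0)//= => E.
have : (#|[pred j | nat_of_ord (m j) == 1%N]| <= \sum_(i < d | i != j0) m i)%N.
  rewrite -sum1_card big_mkcond [leqRHS]big_mkcond; apply: leq_sum => i _ /=.
  rewrite inE; have [mi|//] := eqVneq (nat_of_ord (m i)) 1%N.
  by have [ij|_] := eqVneq i j0; [move: mj0; rewrite -ij mi|rewrite mi].
move=> H; apply: leq_trans H _; rewrite -[X in (_ <= X.-2)%N]E.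
by case: (nat_of_ord (m j0)) mj0 => [|[|k]] // _; rewrite !addSn leq_addl.
Qed.

(** A common bound for [|tr (g^k)| / n^(k-1)] over all [k >= 2]: the case [k = 2] is the first
    summand, and for [k >= 3] the quotient is at most [n / n^2]. *)
Definition tr2v (g : 'M[C]_n) : R := (rnorm (\tr (g ^+ 2)) + 1) / n%:R.

(** As the parts sum to [d], the factor [n^d] comes out and leaves the product of the quotients
    [u j]. Parts equal to 1 give at most [d - 2] factors [|tr g|], one larger part gives [tr2v g],
    and the other larger parts give at most 1. *)
Lemma partition_term_le g : (0 < n)%N -> unitary_group g ->
  rnorm ((n ^ plength m)%N%:R / (pz m)%:R * \prod_(j < d | (j < plength m)%N) \tr (g ^+ m j)) <=
  n%:R ^+ d * ((1 + rnorm (\tr g) ^+ d.-2) * tr2v g).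
Proof.
move=> n0 Ug.
have N0 : 0 < n%:R :> R by rewrite ltr0n.
have N1 : 1 <= n%:R :> R by rewrite ler1n.
pose t := rnorm (\tr g); have t0 : 0 <= t by exact: rnorm_ge0.
pose v := tr2v g; have v0 : 0 <= v by rewrite divr_ge0 ?addr_ge0 ?rnorm_ge0 ?ler0n.
have zle : (pz m)%:R^-1 <= 1 :> R.
  rewrite invf_le1 ?ler1n ?ltr0n; rewrite pzE; apply: prodn_gt0 => i;
  by rewrite muln_gt0 expn_gt0 fact_gt0.
have tk k : rnorm (\tr (g ^+ k)) <= n%:R by exact: rnorm_tr_le.
pose u (j : 'I_d) : R := rnorm (\tr (g ^+ m j)) / n%:R ^+ (m j).-1.
have u0 j : 0 <= u j by rewrite divr_ge0 ?rnorm_ge0// exprn_ge0// ltW.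
have u1 j : (1 < m j)%N -> u j <= 1.
  move=> mj; rewrite ler_pdivrMr ?exprn_gt0// mul1r; apply: le_trans (tk _) _.
  rewrite -[leLHS]expr1; apply: ler_weXn2l => //; by rewrite -ltnS prednK// ltnW.
have uv j : (1 < m j)%N -> u j <= v.
  move=> mj; rewrite /u /v /tr2v; have [->|m3] := eqVneq (nat_of_ord (m j)) 2%N.
    by rewrite expr1 ler_pM2r ?invr_gt0// lerDl.
  apply: (@le_trans _ _ (1 / n%:R)); last first.
    by rewrite ler_pM2r ?invr_gt0// lerDr rnorm_ge0.
  rewrite ler_pdivrMr ?exprn_gt0// mul1r mulrC; apply: le_trans (tk _) _.
  have -> : (m j).-1 = ((m j).-2.-1.+1 + 1)%N.
    by move: mj m3; move: (nat_of_ord (m j)) => [|[|[|k]]]// _ _; rewrite addn1.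
  rewrite exprD expr1 mulfK ?gt_eqF// -[leLHS]expr1; exact: ler_weXn2l.
have bnd : \prod_(j < d | (0 < m j)%N) u j <= (1 + t ^+ d.-2) * v.
  have [j0 mj0] := exists_big_part.
  rewrite (bigID (fun j : 'I_d => nat_of_ord (m j) == 1%N))/=; apply: ler_pM.
  - by apply: prodr_ge0.
  - by apply: prodr_ge0.
  - rewrite (eq_bigr (fun=> t)); last first.
      by move=> j /andP[_ /eqP mj]; rewrite /u mj expr0 divr1 expr1.
    rewrite (eq_bigl [pred j | nat_of_ord (m j) == 1%N]); last first.
      by move=> j; rewrite inE; case: eqP => [->|]; rewrite ?andbF.
    rewrite prodr_const; have := card_small_parts; set a := #|_| => ad.
    have [t1|t1] := leP t 1.
      by apply: (@le_trans _ _ 1); [rewrite exprn_ile1|rewrite lerDl exprn_ge0].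
    by apply: (@le_trans _ _ (t ^+ d.-2)); [apply: ler_weXn2l => //; exact: ltW|rewrite lerDr].
  - rewrite (bigD1 j0)/=; last by rewrite (ltnW mj0) gtn_eqF.
    rewrite -[leRHS]mulr1; apply: ler_pM => //; first by apply: prodr_ge0.
      exact: uv.
    suff /andP[] : 0 <= \prod_(j < d | ((0 < m j)%N && (nat_of_ord (m j) != 1%N)) && (j != j0)) u j <= 1 by [].
    apply: (big_rec (fun x => 0 <= x <= 1)) => [|j x /andP[/andP[mj mj1] _] /andP[x0 x1]].
      by rewrite ler01 lexx.
    rewrite mulr_ge0//= mulr_ile1// u1//.
    by rewrite ltn_neqAle eq_sym mj1.
have E : rnorm (\prod_(j < d | (j < plength m)%N) \tr (g ^+ m j)) * n%:R ^+ plength m =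
    n%:R ^+ d * \prod_(j < d | (0 < m j)%N) u j.
  have -> : n%:R ^+ d = \prod_(j < d | (0 < m j)%N) n%:R ^+ m j :> R.
    have /andP[_ /eqP {1}<-] := mP.
    rewrite expr_sum (bigID (fun j => (0 < m j)%N))/= [X in _ * X]big1 ?mulr1// => j.
    by rewrite -eqn0Ngt => /eqP ->.
  rewrite rnorm_prod (eq_bigl (fun j => (0 < m j)%N)) => [|j]; last exact: plengthP.
  have -> : n%:R ^+ plength m = \prod_(j < d | (0 < m j)%N) n%:R :> R.
    by rewrite prodr_const; congr (_ ^+ _); apply: eq_card => j; rewrite !inE.
  rewrite -!big_split/=; apply: eq_bigr => j mj; rewrite /u mulrCA; congr (_ * _).
  rewrite -[in n%:R ^+ m j](prednK mj) exprS mulfK// expf_neq0// gt_eqF//.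
rewrite !rnormM rnormV !rnorm_nat natrX mulrAC [X in X / _]mulrC E -mulrA.
rewrite ler_wpM2l ?exprn_ge0 ?(ltW N0)//.
rewrite -[leRHS]mulr1; apply: ler_pM => //.
  by apply: prodr_ge0.
Qed.

End TracePowers.

Section Remainder.
Variables (R : realType) (d : nat).

Definition main_term n (g : 'M[Cplx R]_n) : Cplx R :=
  (d`!)%:R^-1 * \tr g ^+ d.

Lemma charsum_main n (g : 'M[Cplx R]_n) : (0 < n)%N -> unitary_group g ->
  rnorm (charsum d g / n%:R ^+ d - main_term g) <=
  (#|{: {ffun 'I_d -> 'I_d.+1}}|)%:R * ((1 + rnorm (\tr g) ^+ d.-2) * tr2v g).
Proof.
move=> n0 Ug; have N0 : 0 < n%:R :> R by rewrite ltr0n.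
have nd0 : 0 < n%:R ^+ d :> R by rewrite exprn_gt0.
have nN0 : n%:R ^+ d != 0 :> Cplx R by rewrite expf_neq0// pnatr_eq0 -lt0n.
rewrite /charsum (bigD1 (ones d)) ?ones_partition//= plength_ones pz_ones.
have -> : \prod_(j < d | (j < d)%N) \tr (g ^+ ones d j) = \tr g ^+ d.
  rewrite (eq_bigl predT) => [|j]; last exact: ltn_ord.
  by rewrite (eq_bigr (fun=> \tr g)) ?prodr_const ?card_ord// => j _; rewrite onesE expr1.
rewrite natrX mulrDl [X in X + _ - _](_ : _ = main_term g); last first.
  rewrite /main_term [_ / (d`!)%:R]mulrC -!mulrA; congr (_ * _).
  by rewrite [X in _ * X]mulrC mulVKf.
rewrite [main_term g + _]addrC addrK rnormM rnormV rnormX rnorm_nat.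
rewrite ler_pdivrMr//; apply: le_trans (rnorm_sum _ _ _) _.
have -> : #|{: {ffun 'I_d -> 'I_d.+1}}|%:R * ((1 + rnorm (\tr g) ^+ d.-2) * tr2v g) * n%:R ^+ d =
  \sum_(m : {ffun 'I_d -> 'I_d.+1}) n%:R ^+ d * ((1 + rnorm (\tr g) ^+ d.-2) * tr2v g).
  by rewrite sumr_const mulr_natl mulrnAl mulrC.
rewrite big_mkcond; apply: ler_sum => m _; case: ifPn => [/andP[mP mN]|_].
  exact: partition_term_le.
have v0 : 0 <= tr2v g by rewrite divr_ge0 ?addr_ge0 ?rnorm_ge0 ?ler0n.
by rewrite !mulr_ge0 ?addr_ge0 ?exprn_ge0 ?rnorm_ge0// ltW.
Qed.

End Remainder.

Section SquareTrace.
Variables (R : realType) (n : nat) (mu : probability (mxBorel R n) R).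
Hypothesis muP : is_haar mu.
Local Notation C := (Cplx R).
Implicit Types g : 'M[C]_n.

Lemma cbm_coord i j : cbm (fun g : mxBorel R n => (g : 'M[C]_n) i j).
Proof.
split; first exact: cmeas_coord.
by exists 1 => g /unitary_op_ball/op_ball_coord.
Qed.

Definition two_cycle (p : 'I_n * 'I_n) (g : mxBorel R n) : C :=
  (g : 'M[C]_n) p.1 p.2 * (g : 'M[C]_n) p.2 p.1.

Lemma cbm_two_cycle p : cbm (two_cycle p).
Proof. by apply: cbmM; exact: cbm_coord. Qed.

Lemma tr_sqrE g : \tr (g ^+ 2) = \sum_p two_cycle p g.
Proof.
rewrite expr2 -(pair_bigA _ (fun i j => g i j * g j i)).
by apply: eq_bigr => i _; rewrite mxE.
Qed.

Lemma i_neq1 : 'i != 1 :> C.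
Proof.
apply/eqP => E; have := sqrCi C; rewrite E expr1n => /eqP.
by rewrite -subr_eq0 opprK -mulr2n pnatr_eq0.
Qed.

(** ['i] has order 4 and the exponents differ by 1 or 2, so the phase is not 1. *)
Lemma phase_eq (a b : nat) (z : C) : (a < 3)%N -> (b < 3)%N -> a != b ->
  z = 'i ^+ a * ('i^*) ^+ b * z -> z = 0.
Proof.
move=> a3 b3 ab /eqP; rewrite -{1}[z]mul1r -subr_eq0 -mulrBl mulf_eq0 => /orP[|/eqP//].
have ii : 'i * 'i = -1 :> C by rewrite -expr2 sqrCi.
have N11 : -1 != 1 :> C.
  by rewrite -subr_eq0 -opprD oppr_eq0 -mulr2n pnatr_eq0.
have Ni1 : - 'i != 1 :> C.
  apply/eqP => E; have := sqrCi C; rewrite -sqrrN E expr1n => /eqP.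
  by rewrite eq_sym (negbTE N11).
rewrite conjCi subr_eq0 eq_sym => /eqP E; exfalso; move: E ab a3 b3.
case: a => [|[|[|a]]]; case: b => [|[|[|b]]] //; rewrite ?expr0 ?expr1 ?expr2 ?mul1r ?mulr1 ?mulrNN ?ii ?mulrN1 ?mulrN ?mulN1r ?opprK => /eqP; rewrite ?(negbTE i_neq1) ?(negbTE N11) ?(negbTE Ni1)//.
Qed.

Lemma two_cycle_mul_diag p (D : 'rV[C]_n) g :
  two_cycle p (g *m diag_mx D) = D 0 p.1 * D 0 p.2 * two_cycle p g.
Proof.
rewrite /two_cycle mul_mx_diag !mxE [g _ _ * D _ _]mulrC [g _ _ * D _ _]mulrC.
by rewrite mulrACA [D 0 p.2 * _]mulrC.
Qed.

(* Right multiplication by the diagonal matrix with a single entry 'i preserves the Haar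
   measure and multiplies the integrand by a phase different from 1. *)
Lemma EC_two_cycle_conj p q : q != p -> q != (p.2, p.1) ->
  EC mu (fun g => two_cycle p g * (two_cycle q g)^*) = 0.
Proof.
move=> qp qp'.
(* Two different unordered pairs have an index that occurs a different number of times in them. *)
have [s sN] : exists s, ((s == p.1) + (s == p.2) != (s == q.1) + (s == q.2))%N.
  move: qp qp'; case: p => i j; case: q => k l /=.
  rewrite !xpair_eqE => qp qp'.
  have [ij|ij] := eqVneq i j.
    exists i; move: qp; rewrite ij !eqxx [j == k]eq_sym [j == l]eq_sym.
    by case: eqP => _; case: eqP.
  have := negbTE ij; rewrite eq_sym => ji.
  have [N|E] := eqVneq ((i == i) + (i == j))%N ((i == k) + (i == l))%N; last by exists i.
  exists j; move: N qp qp'; rewrite !eqxx (negbTE ij) ji.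
  have [ik|ik] := eqVneq i k; have [il|il] := eqVneq i l => //.
    by rewrite -ik ji /= eq_sym; case: eqP.
  by rewrite -il ji /= andbT eq_sym; case: eqP.
pose D : 'rV[C]_n := \row_j 'i ^+ (s == j).
have Du : unitary_group (diag_mx D).
  apply: diag_unitary => j; rewrite mxE rnormX.
  suff -> : rnorm ('i : C) = 1 by rewrite expr1n.
  by rewrite /rnorm normCi.
have bf : cbm (fun g : mxBorel R n => two_cycle p g * (two_cycle q g)^*).
  by apply: cbmM; [|apply: cbm_conj]; exact: cbm_two_cycle.
have E := EC_mulmx muP (@unitary_group1 R n) Du bf.
apply: (@phase_eq ((s == p.1) + (s == p.2)) ((s == q.1) + (s == q.2)) _ _ _ sN).
- by case: eqP; case: eqP.
- by case: eqP; case: eqP.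
rewrite -{1}E -(ECZ muP)//; apply: eq_EC => g _.
rewrite mul1mx !two_cycle_mul_diag !mxE -!exprD rmorphM rmorphXn.
by rewrite mulrACA.
Qed.

(** Once the square is expanded, only [q] equal to [p] or to its reversal survives, whence the
    factor 2. Each surviving mean is at most that of [|g_ij|^2], as entries are bounded by 1, and
    the [n] rows of a unitary matrix have norm 1. *)
Lemma ER_tr_sq_le :
  ER mu (fun g => rnorm (\tr ((g : 'M[C]_n) ^+ 2)) ^+ 2) <= 2 * n%:R.
Proof.
have bh p : bmeas (fun g : mxBorel R n => rnorm (two_cycle p g) ^+ 2).
  by apply: bmeasX; apply: cbm_rnorm; exact: cbm_two_cycle.
have be (p : 'I_n * 'I_n) : bmeas (fun g : mxBorel R n => rnorm ((g : 'M[C]_n) p.1 p.2) ^+ 2).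
  by apply: bmeasX; apply: cbm_rnorm; exact: cbm_coord.
pose a p := ER mu (fun g => rnorm (two_cycle p g) ^+ 2).
have a0 p : 0 <= a p by apply: ER_ge0 => g _; rewrite exprn_ge0 ?rnorm_ge0.
have -> : ER mu (fun g => rnorm (\tr ((g : 'M[C]_n) ^+ 2)) ^+ 2) =
    \sum_p \sum_q (if (q == p) || (q == (p.2, p.1)) then a p else 0).
  apply: RtoC_inj; rewrite [RHS]RtoC_sum -[LHS](EC_RtoC muP).
  have cb p q : cbm (fun g : mxBorel R n => two_cycle p g * (two_cycle q g)^*).
    by apply: cbmM; [|apply: cbm_conj]; exact: cbm_two_cycle.
  rewrite (@eq_EC _ _ _ _ (fun g => \sum_p \sum_q two_cycle p g * (two_cycle q g)^*)); last first.
    move=> g _; rewrite RtoC_rnorm_sq tr_sqrE rmorph_sum mulr_suml; apply: eq_bigr => p _.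
    by rewrite mulr_sumr.
  rewrite (EC_sum muP) => [|p]; last by apply: cbm_sum => q.
  apply: eq_bigr => p _; rewrite (EC_sum muP)// [RHS]RtoC_sum; apply: eq_bigr => q _.
  case: ifPn => [pq|]; last by rewrite negb_or => /andP[qp qp']; exact: EC_two_cycle_conj.
  rewrite /a -[RHS](EC_RtoC muP); apply: eq_EC => g _; rewrite RtoC_rnorm_sq; congr (_ * _^*).
  by case/orP: pq => /eqP -> //; rewrite /two_cycle mulrC.
apply: (@le_trans _ _ (\sum_p (a p + a p))).
  apply: ler_sum => p _.
  apply: (@le_trans _ _ (\sum_q ((if q == p then a p else 0) + (if q == (p.2, p.1) then a p else 0)))).
    apply: ler_sum => q _; case: eqP => _ /=; case: eqP => _; rewrite ?addr0 ?add0r// lerDl//.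
  by rewrite big_split/= -!big_mkcond !big_pred1_eq.
rewrite big_split/= -mulr2n -[leLHS]mulr_natl ler_pM2l//.
apply: (@le_trans _ _ (\sum_p ER mu (fun g => rnorm ((g : 'M[C]_n) p.1 p.2) ^+ 2))).
  apply: ler_sum => p _; apply: (ER_le muP) => // g /unitary_op_ball/op_ball_coord gb.
  rewrite /two_cycle rnormM exprMn ler_piMr ?exprn_ge0 ?rnorm_ge0//.
  by rewrite exprn_ile1 ?rnorm_ge0.
rewrite -(ER_sum muP)// -[leRHS](ER_cst muP).
apply: (ER_le muP) => [||g Ug]; [exact: bmeas_sum|exact: bmeas_cst|].
have E i : \sum_j rnorm (g i j) ^+ 2 = 1.
  apply: RtoC_inj; rewrite RtoC_sum; have /unitarymxP/matrixP/(_ i i) := Ug.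
  rewrite !mxE eqxx => H; apply: etrans H; apply: eq_bigr => j _.
  by rewrite RtoC_rnorm_sq !mxE.
rewrite -(pair_bigA _ (fun i j => rnorm ((g : 'M[C]_n) i j) ^+ 2))/=.
by rewrite (eq_bigr (fun=> 1)) ?sumr_const ?card_ord.
Qed.

End SquareTrace.

Section RealLimits.
Variable R : realType.
Implicit Types u v w : R^nat.

Lemma cvg0_invn u (c : R) :
  (forall n, (0 < n)%N -> 0 <= u n <= c / n%:R) -> u @ \oo --> 0.
Proof.
move=> uc; apply/cvgrPdist_le => e e0; near=> n.
have n0 : (0 < n)%N by near: n; exact: nbhs_infty_gt.
have /andP[u0 uc'] := uc n n0.
rewrite sub0r normrN ger0_norm// (le_trans uc')// ler_pdivrMr ?ltr0n// mulrC -ler_pdivrMr//.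
by near: n; exact: nbhs_infty_ger.
Unshelve. all: by end_near. Qed.

(** Tailored to second moments: a small multiple of the bounded [v] is traded against a large
    multiple of the vanishing [w]. The multiple is fixed from the limit of [v] before [n] is taken
    large. *)
Lemma cvg_of_quad_dist u v w (l : R) : v @ \oo --> l -> w @ \oo --> 0 ->
  (forall n, 0 <= v n) ->
  (forall e n, 0 < e -> (0 < n)%N -> `|u n - v n| <= e * v n + (e^-1 + 1) * w n) ->
  u @ \oo --> l.
Proof.
move=> vl w0 v0 H; apply/cvgrPdist_le => e e0.
pose k := e / (4 * (`|l| + 1)).
have l1 : 0 < `|l| + 1 by rewrite ltr_wpDl.
have k0 : 0 < k by rewrite divr_gt0// mulr_gt0.
have c0 : 0 < k^-1 + 1 by rewrite addr_gt0// invr_gt0.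
near=> n.
have n0 : (0 < n)%N by near: n; exact: nbhs_infty_gt.
have h1 : `|l - v n| <= Num.min 1 (e / 4).
  by near: n; move/cvgrPdist_le : vl; apply; rewrite lt_min ltr01 divr_gt0.
have h2 : `|0 - w n| <= e / 4 / (k^-1 + 1).
  by near: n; move/cvgrPdist_le : w0; apply; rewrite !divr_gt0.
have {h2} h2 : (k^-1 + 1) * w n <= e / 4.
  rewrite mulrC -ler_pdivlMr//; apply: le_trans h2; by rewrite sub0r normrN ler_norm.
move: h1; rewrite le_min => /andP[h1 h3].
have h4 : k * v n <= e / 4.
  have : v n <= `|l| + 1.
    by move: h1 (ler_norm l); rewrite distrC => /ler_normlP[_]; lra.
  move=> vl1; apply: (@le_trans _ _ (k * (`|l| + 1))); first by rewrite ler_pM2l.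
  by rewrite /k invfM mulrA -[X in X <= _]mulrA mulVf ?mulr1// gt_eqF.
have := H k n k0 n0; have := ler_distD (v n) l (u n); rewrite [`|v n - u n|]distrC.
lra.
Unshelve. all: by end_near. Qed.

End RealLimits.

Lemma cbm_ext (R : realType) n (f h : mxBorel R n -> Cplx R) : cbm f ->
  (forall g, unitary_group g -> f g = h g) -> cbm h.
Proof.
move=> [[f1 f2] [M fM]] fh; split; last by exists M => g Ug; rewrite -fh// fM.
split; [move: f1|move: f2]; apply: eq_measurable_fun => g /set_mem Ug /=; by rewrite fh.
Qed.

Section Moments.
Variables (R : realType) (haar : forall n : nat, probability (mxBorel R n) R).
Hypothesis haarP : forall n, is_haar (haar n).
Local Notation C := (Cplx R).

Definition trn n (g : mxBorel R n) : R := rnorm (\tr (g : 'M[C]_n)).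

Definition tmoment d n : R := ER (haar n) (fun g => trn g ^+ d).

Lemma bmeas_trn n : bmeas (@trn n).
Proof. exact: (cbm_rnorm (@cbm_trpow R n 1)). Qed.

Lemma trn_ge0 n (g : mxBorel R n) : 0 <= trn g.
Proof. exact: rnorm_ge0. Qed.

Lemma bmeas_tr2v n : bmeas (fun g : mxBorel R n => tr2v (g : 'M[C]_n)).
Proof.
apply: bmeasM; last exact: bmeas_cst.
by apply: bmeasD; [exact: (cbm_rnorm (@cbm_trpow R n 2))|exact: bmeas_cst].
Qed.

Lemma tr2v_ge0 n (g : 'M[C]_n) : 0 <= tr2v g.
Proof. by rewrite divr_ge0 ?addr_ge0 ?rnorm_ge0 ?ler0n. Qed.

Lemma tr2v_le2 n (g : 'M[C]_n) : (0 < n)%N -> unitary_group g -> tr2v g <= 2.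
Proof.
move=> n0 Ug; rewrite ler_pdivrMr ?ltr0n//.
have := rnorm_tr_le 2 Ug; have : 1 <= n%:R :> R by rewrite ler1n.
lra.
Qed.

Lemma tr2v_sq_cvg : (fun n => ER (haar n) (fun g => tr2v (g : 'M[C]_n) ^+ 2)) @ \oo --> 0.
Proof.
(* With [t = |tr g^2|], [(t + 1)^2 <= 2 (t^2 + 1)] and the mean of [t^2] is at most [2 n], so the
   bound is [2 (2 n + 1) / n^2 <= 6 / n]. *)
apply: (@cvg0_invn _ _ 6) => n n0; have N0 : 0 < n%:R :> R by rewrite ltr0n.
have N1 : 1 <= n%:R :> R by rewrite ler1n.
rewrite ER_ge0 => [|g _]/=; last by rewrite exprn_ge0 ?tr2v_ge0.
have b2 : bmeas (fun g : mxBorel R n => rnorm (\tr ((g : 'M[C]_n) ^+ 2)) ^+ 2).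
  by apply: bmeasX; exact: (cbm_rnorm (@cbm_trpow R n 2)).
have b3 : bmeas (fun g : mxBorel R n => rnorm (\tr ((g : 'M[C]_n) ^+ 2)) ^+ 2 + 1).
  by apply: bmeasD => //; exact: bmeas_cst.
apply: (@le_trans _ _ (2 / n%:R ^+ 2 * (ER (haar n) (fun g => rnorm (\tr ((g : 'M[C]_n) ^+ 2)) ^+ 2) + 1))).
  rewrite -[X in _ * (_ + X)](ER_cst (haarP n) 1) -(ERD (haarP n))//; last exact: bmeas_cst.
  rewrite -(ERZ (haarP n))//; apply: (ER_le (haarP n)) => [||g Ug].
  - by apply: bmeasX; exact: bmeas_tr2v.
  - by apply: bmeasM => //; exact: bmeas_cst.
  rewrite /tr2v exprMn exprVn [leRHS]mulrAC ler_pM2r ?invr_gt0 ?exprn_gt0//.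
  by have := sqr_ge0 (rnorm (\tr (g ^+ 2)) - 1); nra.
apply: (@le_trans _ _ (2 / n%:R ^+ 2 * (2 * n%:R + 1))).
  by rewrite ler_pM2l ?divr_gt0 ?exprn_gt0// lerD2r; exact: ER_tr_sq_le.
rewrite mulrAC ler_pdivrMr ?exprn_gt0// expr2 mulrA divfK ?gt_eqF//; lra.
Qed.

Definition remainder d n (g : mxBorel R n) : R :=
  rnorm (charsum d (g : 'M[C]_n) / n%:R ^+ d - main_term d (g : 'M[C]_n)).

Lemma cbm_charsum d n : cbm (fun g : mxBorel R n => charsum d (g : 'M[C]_n)).
Proof.
apply: (cbm_ext (cbm_hpoly (kappa (haarP n) d))) => g Ug.
exact: kappaE.
Qed.

Lemma cbm_main_term d n : cbm (fun g : mxBorel R n => main_term d (g : 'M[C]_n)).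
Proof.
apply: cbmM; first exact: cbm_cst.
elim: d => [|d IH]; first exact: (cbm_cst _ 1).
apply: (cbm_ext (cbmM (@cbm_trpow R n 1) IH)) => g _; exact: (esym (exprS _ _)).
Qed.

Lemma bmeas_remainder d n : bmeas (@remainder d n).
Proof.
apply: cbm_rnorm; apply: cbmD; first by apply: cbmM; [exact: cbm_charsum|exact: cbm_cst].
apply: (cbm_ext (cbmM (cbm_cst n (-1)) (cbm_main_term d n))) => g _; exact: mulN1r.
Qed.

Lemma remainder_sq_le d n (g : 'M[C]_n) : (0 < n)%N -> unitary_group g ->
  remainder d g ^+ 2 <= 2 * (#|{: {ffun 'I_d -> 'I_d.+1}}|)%:R ^+ 2 *
    (tr2v g ^+ 2 + trn g ^+ (2 * d.-2) * tr2v g ^+ 2).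
Proof.
move=> n0 Ug; have := charsum_main d n0 Ug; rewrite -/(remainder d g).
set K := _%:R; set v := tr2v g; set x := _ ^+ d.-2 => H.
have K0 : 0 <= K by exact: ler0n.
apply: (@le_trans _ _ ((K * ((1 + x) * v)) ^+ 2)).
  by rewrite lerXn2r ?nnegrE ?rnorm_ge0// !mulr_ge0 ?tr2v_ge0// addr_ge0 ?exprn_ge0 ?rnorm_ge0.
rewrite mulnC exprM -[trn g ^+ d.-2]/x; clearbody x v K; rewrite !exprMn [2 * _]mulrC -[leRHS]mulrA ler_wpM2l ?exprn_ge0//.
have -> : 2 * (v ^+ 2 + x ^+ 2 * v ^+ 2) = (1 + x) ^+ 2 * v ^+ 2 + v ^+ 2 * (1 - x) ^+ 2 by ring.
by rewrite lerDl mulr_ge0 ?sqr_ge0.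
Qed.

(* Split at trn g ^+ 2 <= M: below, use tr2v_sq_cvg; above, pay one more moment for a factor 1 / M. *)
Lemma tail_cvg a (l : R) : (fun n => tmoment (2 * a.+1) n) @ \oo --> l ->
  (fun n => ER (haar n) (fun g => trn g ^+ (2 * a) * tr2v (g : 'M[C]_n) ^+ 2)) @ \oo --> 0.
Proof.
move=> ml; apply/cvgrPdist_le => e e0.
(* [4 / M] times the eventual bound [|l| + 1] of the higher moment has to be at most [e / 2]; the 4
   is the square of the bound 2 on [tr2v]. *)
pose M := 8 * (`|l| + 1) / e + 1.
have l1 : 0 < `|l| + 1 by rewrite ltr_wpDl.
have M1 : 1 < M by rewrite ltrDr divr_gt0// mulr_gt0.
have M0 : 0 < M := lt_trans ltr01 M1.
have Ma0 : 0 < M ^+ a by rewrite exprn_gt0.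
near=> n.
have n0 : (0 < n)%N by near: n; exact: nbhs_infty_gt.
have h1 : `|l - tmoment (2 * a.+1) n| <= 1 by near: n; move/cvgrPdist_le : ml; apply.
have h2 : `|0 - ER (haar n) (fun g => tr2v (g : 'M[C]_n) ^+ 2)| <= e / 2 / M ^+ a.
  by near: n; move/cvgrPdist_le : tr2v_sq_cvg; apply; rewrite !divr_gt0.
have bv : bmeas (fun g : mxBorel R n => tr2v (g : 'M[C]_n) ^+ 2) by apply: bmeasX; exact: bmeas_tr2v.
have bt k : bmeas (fun g : mxBorel R n => trn g ^+ k) by apply: bmeasX; exact: bmeas_trn.
rewrite sub0r normrN ger0_norm; last first.
  by apply: ER_ge0 => g _; rewrite mulr_ge0 ?exprn_ge0 ?tr2v_ge0 ?trn_ge0.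
apply: (@le_trans _ _ (M ^+ a * ER (haar n) (fun g => tr2v (g : 'M[C]_n) ^+ 2) + 4 / M * tmoment (2 * a.+1) n)).
  have bM1 : bmeas (fun g : mxBorel R n => M ^+ a * tr2v (g : 'M[C]_n) ^+ 2) by apply: bmeasM => //; exact: bmeas_cst.
  have bM2 : bmeas (fun g : mxBorel R n => 4 / M * trn g ^+ (2 * a.+1)) by apply: bmeasM => //; exact: bmeas_cst.
  rewrite -(ERZ (haarP n))// /tmoment -(ERZ (haarP n))// -(ERD (haarP n))//.
  apply: (ER_le (haarP n)) => [||g Ug]; [exact: bmeasM|exact: bmeasD|].
  have v0 := tr2v_ge0 g; have v2 := tr2v_le2 n0 Ug.
  rewrite !exprM; set x := trn g ^+ 2; have x0 : 0 <= x by exact: sqr_ge0.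
  have [xM|Mx] := leP x M.
    apply: ler_wpDr.
      by apply: mulr_ge0; [rewrite divr_ge0// ltW|exact: exprn_ge0].
    apply: ler_wpM2r; first exact: exprn_ge0.
    by rewrite lerXn2r ?nnegrE// ltW.
  apply: ler_wpDl; first by rewrite mulr_ge0 ?exprn_ge0// ltW.
  rewrite [leLHS]mulrC -[leRHS]mulrA; apply: ler_pM.
  - exact: sqr_ge0.
  - exact: exprn_ge0.
  - by rewrite expr2; nra.
  rewrite exprS mulrA; apply: ler_peMl; first exact: exprn_ge0.
  by rewrite mulrC ler_pdivlMr// mul1r ltW.
move: h2; rewrite sub0r normrN => /(le_trans (ler_norm _)); rewrite ler_pdivlMr// mulrC => h2.
have h3 : tmoment (2 * a.+1) n <= `|l| + 1.
  by move: h1 (ler_norm l); rewrite distrC => /ler_normlP[_]; lra.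
suff h4 : 4 / M * tmoment (2 * a.+1) n <= e / 2 by lra.
apply: (@le_trans _ _ (4 / M * (`|l| + 1))); first by rewrite ler_pM2l ?divr_gt0.
rewrite mulrAC ler_pdivrMr// /M [leRHS]mulrDr mulr1.
have -> : e / 2 * (8 * (`|l| + 1) / e) = 4 * (`|l| + 1) by field; rewrite gt_eqF.
by rewrite lerDl divr_ge0// ltW.
Unshelve. all: by end_near. Qed.

(** The squared remainder involves [|tr g|^2] to the power [d - 2], and [tail_cvg] spends one more
    power, reaching [d - 1]: moments of order below [d] suffice. For [d <= 1] the power is
    trivial. *)
Lemma remainder_sq_cvg d :
  (forall k, (k < d)%N -> (fun n => tmoment (2 * k) n) @ \oo --> ((k`!)%:R : R)) ->
  (fun n => ER (haar n) (fun g => remainder d g ^+ 2)) @ \oo --> 0.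
Proof.
move=> md; set K : R := 2 * (#|{: {ffun 'I_d -> 'I_d.+1}}|)%:R ^+ 2.
have T : (fun n => ER (haar n) (fun g => trn g ^+ (2 * d.-2) * tr2v (g : 'M[C]_n) ^+ 2)) @ \oo --> 0.
  have [d2|d2] := ltnP d.-2.+1 d; first exact: tail_cvg (md _ d2).
  have -> : d.-2 = 0%N by move: d2; case: (d) => [|[|[|k]]]//; rewrite ltnn.
  rewrite (_ : (fun n => _) = (fun n => ER (haar n) (fun g => tr2v (g : 'M[C]_n) ^+ 2))); first exact: tr2v_sq_cvg.
  by apply/funext => n; apply: eq_ER => g _; rewrite muln0 expr0 mul1r.
have : (fun n => K * (ER (haar n) (fun g => tr2v (g : 'M[C]_n) ^+ 2) +
    ER (haar n) (fun g => trn g ^+ (2 * d.-2) * tr2v (g : 'M[C]_n) ^+ 2))) @ \oo --> K * (0 + 0).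
  by apply: cvgMr; apply: cvgD => //; exact: tr2v_sq_cvg.
rewrite addr0 mulr0; apply: squeeze_cvgr; last exact: cvg_cst.
near=> n.
have n0 : (0 < n)%N by near: n; exact: nbhs_infty_gt.
have b1 : bmeas (fun g : mxBorel R n => tr2v (g : 'M[C]_n) ^+ 2) by apply: bmeasX; exact: bmeas_tr2v.
have b2 : bmeas (fun g : mxBorel R n => trn g ^+ (2 * d.-2) * tr2v (g : 'M[C]_n) ^+ 2).
  by apply: bmeasM => //; apply: bmeasX; exact: bmeas_trn.
rewrite ER_ge0 => [|g _]/=; last exact: sqr_ge0.
rewrite -(ERD (haarP n))// -(ERZ (haarP n)); last exact: bmeasD.
apply: (ER_le (haarP n)) => [||g Ug].
- by apply: bmeasX; exact: bmeas_remainder.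
- by apply: bmeasM; [exact: bmeas_cst|exact: bmeasD].
- exact: remainder_sq_le.
Unshelve. all: by end_near. Qed.

Definition charsum_n d n (g : mxBorel R n) : C := charsum d (g : 'M[C]_n) / n%:R ^+ d.

Lemma cbm_charsum_n d n : cbm (@charsum_n d n).
Proof. by apply: cbmM; [exact: cbm_charsum|exact: cbm_cst]. Qed.

Lemma ER_charsum_n_sq d n : (0 < n)%N ->
  RtoC (ER (haar n) (fun g => rnorm (charsum_n d g) ^+ 2)) =
  charsum d (1%:M : 'M[C]_n) / n%:R ^+ d / n%:R ^+ d.
Proof.
move=> n0; have N0 : 0 < n%:R :> R by rewrite ltr0n.
have -> : ER (haar n) (fun g => rnorm (charsum_n d g) ^+ 2) =
    (n%:R ^+ d)^-1 ^+ 2 * ER (haar n) (fun g => rnorm (kappa (haarP n) d g : C) ^+ 2).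
  rewrite -(ERZ (haarP n)); last by apply: bmeasX; apply: cbm_rnorm; exact: cbm_hpoly.
  apply: eq_ER => g Ug; rewrite kappaE// /charsum_n rnormM rnormV rnormX rnorm_nat.
  by rewrite exprMn mulrC.
rewrite RtoCM ER_kappa_sq kappaE; last exact: unitary_group1.
rewrite [LHS]mulrC -[RHS]mulrA; congr (_ * _).
have E : RtoC (n%:R : R) = n%:R by exact: (rmorph_nat (real_complex R)).
have -> : RtoC ((n%:R ^+ d)^-1 ^+ 2 : R) = (RtoC n%:R ^+ d)^-1 ^+ 2.
  rewrite /RtoC; exact: (etrans (rmorphXn (real_complex R) _ _) (congr1 (fun x => x ^+ 2) (etrans (fmorphV (real_complex R) _) (congr1 _ (rmorphXn (real_complex R) _ _))))).
by rewrite E expr2.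
Qed.

(** The second moment is [kappa] at the identity divided by [n^(2d)]. There [tr g = n], the main
    term gives [1 / d!], and the other partitions contribute [O(1/n)]. *)
Lemma charsum_n_sq_cvg d : (0 < d)%N ->
  (fun n => ER (haar n) (fun g => rnorm (charsum_n d g) ^+ 2)) @ \oo --> ((d`!)%:R^-1 : R).
Proof.
move=> d0; set K : R := (#|{: {ffun 'I_d -> 'I_d.+1}}|)%:R.
have K0 : 0 <= K by exact: ler0n.
pose u n := ER (haar n) (fun g => rnorm (charsum_n d g) ^+ 2).
suff uc : (fun n => `|u n - (d`!)%:R^-1|) @ \oo --> 0.
  apply/cvgrPdist_le => e e0; near=> n; rewrite distrC.
  have : `|0 - `|u n - (d`!)%:R^-1| | <= e by near: n; move/cvgrPdist_le : uc; apply.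
  by rewrite sub0r normrN normr_id.
(* At the identity [tr2v] is at most 2 and [1 + n^(d-2)] is at most [2 n^(d-1)]; division by [n^d]
   leaves [4 K / n]. *)
apply: (@cvg0_invn _ _ (4 * K)) => n n0; rewrite normr_ge0/=.
have N0 : 0 < n%:R :> R by rewrite ltr0n.
have N1 : 1 <= n%:R :> R by rewrite ler1n.
have Nd : 0 < n%:R ^+ d :> R by rewrite exprn_gt0.
have nN : n%:R != 0 :> C by rewrite pnatr_eq0 -lt0n.
have tr1 : \tr (1%:M : 'M[C]_n) = n%:R by exact: mxtrace1.
have dE : RtoC ((d`!)%:R^-1 : R) = (d`!)%:R^-1.
  by apply: etrans (fmorphV (real_complex R) _) _; congr (_^-1); exact: (rmorph_nat (real_complex R)).
have E : RtoC (u n - (d`!)%:R^-1) =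
    (charsum d (1%:M : 'M[C]_n) / n%:R ^+ d - main_term d (1%:M : 'M[C]_n)) / n%:R ^+ d.
  rewrite mulrBl -ER_charsum_n_sq// /main_term tr1 mulfK ?expf_neq0// -dE.
  exact: (rmorphB (real_complex R)).
have rE (x : R) : rnorm (RtoC x) = `|x| by rewrite rnorm_sqrt/= expr0n addr0 sqrtr_sqr.
rewrite -rE E rnormM rnormV rnormX rnorm_nat ler_pdivrMr//.
apply: le_trans (charsum_main d n0 (@unitary_group1 R n)) _.
rewrite -/K tr1 rnorm_nat.
have v2 := tr2v_le2 n0 (@unitary_group1 R n); have v0 := tr2v_ge0 (1%:M : 'M[C]_n).
have -> : 4 * K / n%:R * n%:R ^+ d = K * ((n%:R ^+ d.-1 + n%:R ^+ d.-1) * 2).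
  rewrite -[in n%:R ^+ d](prednK d0) exprS -[X in X = _]mulrA mulKf ?gt_eqF//; ring.
apply: ler_wpM2l => //; apply: ler_pM; [|exact: v0| |exact: v2].
  by apply: addr_ge0 => //; apply: exprn_ge0; exact: ltW.
apply: lerD; first by rewrite exprn_ege1.
by apply: ler_weXn2l => //; exact: leq_pred.
Unshelve. all: by end_near. Qed.

Lemma ER_main_term d k n : ER (haar n) (fun g => rnorm (main_term d (g : 'M[C]_n)) ^+ k) =
  (d`!)%:R^-1 ^+ k * tmoment (d * k) n.
Proof.
rewrite -(ERZ (haarP n)); last by apply: bmeasX; exact: bmeas_trn.
by apply: eq_ER => g _; rewrite rnormM rnormV rnorm_nat rnormX exprMn exprM.
Qed.

Lemma rnorm_charsum_n_le d n (g : mxBorel R n) :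
  rnorm (charsum_n d g) <= rnorm (main_term d (g : 'M[C]_n)) + remainder d g.
Proof.
rewrite -[charsum_n d g](subrK (main_term d (g : 'M[C]_n))) [leRHS]addrC.
exact: rnormD.
Qed.

Lemma rnorm_main_term_le d n (g : mxBorel R n) :
  rnorm (main_term d (g : 'M[C]_n)) <= rnorm (charsum_n d g) + remainder d g.
Proof.
rewrite -[X in rnorm X <= _](subrK (charsum_n d g)) [leRHS]addrC.
by apply: le_trans (rnormD _ _) _; rewrite lerD2r -rnormN opprB.
Qed.

(** The second moment of the normalised kernel tends to [1 / d!]. By induction the remainder is
    negligible, so the second moment of [(tr g)^d / d!] has the same limit, and multiplication by
    [d!^2] gives [d!]. *)
Lemma tmoment_cvg d : (fun n => tmoment (2 * d) n) @ \oo --> ((d`!)%:R : R).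
Proof.
elim/ltn_ind: d => d IH.
have [->|d0] := posnP d.
  rewrite muln0 (_ : (fun n => _) = fun=> 1); first exact: cvg_cst.
  apply/funext => n; rewrite -[RHS](ER_cst (haarP n)); apply: eq_ER => g _; exact: expr0.
have f0 : (d`!)%:R != 0 :> R by rewrite pnatr_eq0 -lt0n fact_gt0.
have bG n : bmeas (fun g : mxBorel R n => rnorm (main_term d (g : 'M[C]_n)) ^+ 2).
  by apply: bmeasX; apply: cbm_rnorm; exact: cbm_main_term.
have bW n : bmeas (fun g : mxBorel R n => rnorm (charsum_n d g) ^+ 2).
  by apply: bmeasX; apply: cbm_rnorm; exact: cbm_charsum_n.
have bR n : bmeas (fun g : mxBorel R n => remainder d g ^+ 2).
  by apply: bmeasX; exact: bmeas_remainder.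
have uc : (fun n => ER (haar n) (fun g => rnorm (main_term d (g : 'M[C]_n)) ^+ 2)) @ \oo --> ((d`!)%:R^-1 : R).
  apply: (cvg_of_quad_dist (charsum_n_sq_cvg d0) (remainder_sq_cvg IH)).
    by move=> n; apply: ER_ge0 => g _; exact: sqr_ge0.
  move=> e n e0 n0.
  have P := haarP n.
  have bM1 : bmeas (fun g : mxBorel R n => e * rnorm (charsum_n d g) ^+ 2).
    by apply: bmeasM => //; exact: bmeas_cst.
  have bM2 : bmeas (fun g : mxBorel R n => (e^-1 + 1) * remainder d g ^+ 2).
    by apply: bmeasM => //; exact: bmeas_cst.
  have pt (a b r : R) : 0 <= a -> 0 <= b -> 0 <= r -> a <= b + r -> b <= a + r ->
      a ^+ 2 - b ^+ 2 <= e * b ^+ 2 + (e^-1 + 1) * r ^+ 2 /\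
      b ^+ 2 - a ^+ 2 <= e * b ^+ 2 + (e^-1 + 1) * r ^+ 2.
    move=> a0 b0 r0 ab ba.
    (* Young's inequality for the cross term of [(b + r)^2], from [(e b - r)^2 >= 0]. *)
    have H : 2 * b * r <= e * b ^+ 2 + e^-1 * r ^+ 2.
      have : 0 <= e^-1 * (e * b - r) ^+ 2 by rewrite mulr_ge0 ?sqr_ge0 ?invr_ge0 ?ltW.
      suff -> : e^-1 * (e * b - r) ^+ 2 = e * b ^+ 2 - 2 * b * r + e^-1 * r ^+ 2 by lra.
      by field; rewrite gt_eqF.
    have H1 : a ^+ 2 <= (b + r) ^+ 2 by rewrite lerXn2r ?nnegrE// addr_ge0.
    have H2 : b ^+ 2 <= a ^+ 2 + 2 * b * r + r ^+ 2 by nra.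
    by split; nra.
  rewrite -(ERZ P)// -(ERZ P)// -(ERD P)//; apply/ler_normlP; split.
    rewrite opprB -(ERB P)//; apply: (ER_le P); [|exact: bmeasD|].
      by apply: bmeasD => //; exact: bmeasN.
    move=> g Ug; apply: (pt _ _ _ _ _ _ _ _).2; rewrite ?rnorm_ge0//; first exact: rnorm_main_term_le.
    exact: rnorm_charsum_n_le.
  rewrite -(ERB P)//; apply: (ER_le P); [|exact: bmeasD|].
    by apply: bmeasD => //; exact: bmeasN.
  move=> g Ug; apply: (pt _ _ _ _ _ _ _ _).1; rewrite ?rnorm_ge0//; first exact: rnorm_main_term_le.
  exact: rnorm_charsum_n_le.
have -> : (d`!)%:R = (d`!)%:R ^+ 2 * (d`!)%:R^-1 :> R by rewrite expr2 mulfK.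
rewrite (_ : (fun n => _) = (fun n => (d`!)%:R ^+ 2 * ER (haar n) (fun g => rnorm (main_term d (g : 'M[C]_n)) ^+ 2))); first exact: cvgMr.
by apply/funext => n; rewrite ER_main_term mulnC mulrA exprVn divff ?mul1r// expf_neq0.
Qed.

Lemma charsum_n_tmoment d :
  (fun n => ER (haar n) (fun g => rnorm (charsum_n d g)) - (d`!)%:R^-1 * tmoment d n) @ \oo --> 0.
Proof.
apply/cvgrPdist_le => e e0.
have e2 : 0 < e / 2 by rewrite divr_gt0.
have rc := @remainder_sq_cvg d (fun k _ => @tmoment_cvg k).
near=> n.
have h : `|0 - ER (haar n) (fun g => remainder d g ^+ 2)| <= e / 2 * (e / 2).
  by near: n; move/cvgrPdist_le : rc; apply; rewrite mulr_gt0.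
have P := haarP n.
have bR : bmeas (fun g : mxBorel R n => remainder d g ^+ 2).
  by apply: bmeasX; exact: bmeas_remainder.
have bM : bmeas (fun g : mxBorel R n => (e / 2)^-1 * remainder d g ^+ 2).
  by apply: bmeasM => //; exact: bmeas_cst.
have bG : bmeas (fun g : mxBorel R n => rnorm (main_term d (g : 'M[C]_n))).
  by apply: cbm_rnorm; exact: cbm_main_term.
have bW : bmeas (fun g : mxBorel R n => rnorm (charsum_n d g)).
  by apply: cbm_rnorm; exact: cbm_charsum_n.
have -> : (d`!)%:R^-1 * tmoment d n = ER (haar n) (fun g => rnorm (main_term d (g : 'M[C]_n))).
  rewrite -[d in tmoment d]muln1 -[_%:R^-1]expr1 -ER_main_term.
  by apply: eq_ER => g _; rewrite expr1.
(* Completing the square bounds [r] by [e / 2] plus a multiple of [r^2], which turns the L^2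
   estimate into one for first moments. *)
have pt (a b r : R) : a <= b + r -> a - b <= e / 2 + (e / 2)^-1 * r ^+ 2.
  move=> ab; suff : 0 <= e / 2 + (e / 2)^-1 * r ^+ 2 - r by lra.
  have -> : e / 2 + (e / 2)^-1 * r ^+ 2 - r =
      (e / 2)^-1 * ((r - e / 4) ^+ 2 + 3 / 16 * e ^+ 2).
    by field; rewrite gt_eqF.
  by rewrite mulr_ge0 ?invr_ge0 ?(ltW e2)// addr_ge0 ?sqr_ge0// mulr_ge0// sqr_ge0.
have hE : (e / 2)^-1 * ER (haar n) (fun g => remainder d g ^+ 2) <= e / 2.
  by rewrite mulrC ler_pdivrMr//; apply: le_trans (ler_norm _) _; rewrite -normrN -sub0r.
have {}hE : e / 2 + (e / 2)^-1 * ER (haar n) (fun g => remainder d g ^+ 2) <= e by lra.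
have bS : bmeas (fun g : mxBorel R n => e / 2 + (e / 2)^-1 * remainder d g ^+ 2).
  by apply: bmeasD => //; exact: bmeas_cst.
have SE : ER (haar n) (fun g => e / 2 + (e / 2)^-1 * remainder d g ^+ 2) <= e.
  by rewrite (ERD P)//; [rewrite (ER_cst P) (ERZ P)|exact: bmeas_cst].
rewrite sub0r normrN; apply/ler_normlP; split; apply: le_trans SE.
  rewrite opprB -(ERB P)//; apply: (ER_le P) => //; first by apply: bmeasD => //; exact: bmeasN.
  by move=> g _; apply: pt; exact: rnorm_main_term_le.
rewrite -(ERB P)//; apply: (ER_le P) => //; first by apply: bmeasD => //; exact: bmeasN.
by move=> g _; apply: pt; exact: rnorm_charsum_n_le.
Unshelve. all: by end_near. Qed.

End Moments.

(** * Half-integer moments of the exponential distribution *)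

Section ExpPoly.
Variable R : realType.
Implicit Types (p : {poly R}) (x : R).

Lemma is_derive_continuous (f : R -> R) x df : is_derive x 1 f df -> {for x, continuous f}.
Proof. by move=> [df' _]; apply/differentiable_continuous/derivable1_diffP. Qed.

Lemma is_derive_expRN x : is_derive x 1 (fun z : R => expR (- z)) (- expR (- x)).
Proof.
apply: is_derive_eq (is_derive1_comp (is_derive_expR (- x)) (is_deriveNid x 1)) _.
exact: mulrN1.
Qed.

Lemma is_derive_poly_expRN p x :
  is_derive x 1 (fun z => p.[z] * expR (- z)) ((p^`() - p).[x] * expR (- x)).
Proof.
apply: (is_derive_eq (@is_deriveM _ _ (horner p) (fun z => expR (- z)) x 1 _ _ (is_derive_poly p x) (is_derive_expRN x))).
rewrite hornerD hornerN /GRing.scale/=; ring.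
Qed.

Lemma cvg_exprn_expRN k : x ^+ k * expR (- x) @[x --> +oo%R] --> (0 : R).
Proof.
apply/cvgrPdist_le => e e0; near=> x.
have x0 : 0 < x by near: x; apply: nbhs_pinfty_gt; exact: num_real.
rewrite sub0r normrN ger0_norm; last by rewrite mulr_ge0 ?expR_ge0 ?exprn_ge0 ?ltW.
rewrite expRN ler_pdivrMr ?expR_gt0//.
have := expR_ge1Dxn k (ltW x0) => H.
have : x ^+ k.+1 / (k.+1`!)%:R <= expR x by apply: le_trans H; rewrite lerDr.
move=> /(ler_wpM2l (ltW e0)); apply: le_trans.
have -> : e * (x ^+ k.+1 / (k.+1`!)%:R) = (x / ((k.+1`!)%:R / e)) * x ^+ k.
  by rewrite exprS; field; rewrite gt_eqF//= pnatr_eq0 -lt0n fact_gt0.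
apply: ler_peMl; first by rewrite exprn_ge0 ?ltW.
rewrite ler_pdivlMr ?divr_gt0 ?ltr0n ?fact_gt0// mul1r.
Unshelve. all: by end_near. Qed.

Lemma cvg_poly_expRN p : p.[x] * expR (- x) @[x --> +oo%R] --> (0 : R).
Proof.
rewrite (_ : (fun x => _) = (fun x => \sum_(i < size p) p`_i * (x ^+ i * expR (- x)))); last first.
  by apply/funext => x; rewrite horner_coef mulr_suml; apply: eq_bigr => i _; rewrite mulrA.
elim: (size p) => [|m IH].
  by rewrite (_ : (fun x => _) = fun=> 0); [exact: cvg_cst|apply/funext => x; rewrite big_ord0].
rewrite (_ : (fun x => _) = (fun x => \sum_(i < m) p`_i * (x ^+ i * expR (- x)) + p`_m * (x ^+ m * expR (- x)))); last first.
  by apply/funext => x; rewrite big_ord_recr.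
have H : p`_m * (x ^+ m * expR (- x)) @[x --> +oo%R] --> p`_m * 0.
  by apply: cvgMr; exact: cvg_exprn_expRN.
have := cvgD IH H; rewrite mulr0 addr0; exact.
Qed.

(** The polynomial [G] with [G - G' = X^k], so that [- G e^(-x)] is a primitive of [x^k e^(-x)]; its
    value [k!] at 0 is the integral. *)
Fixpoint gamma_poly k : {poly R} :=
  if k is k'.+1 then 'X^k + k%:R *: gamma_poly k' else 1.

Lemma gamma_poly_deriv k : gamma_poly k - (gamma_poly k)^`() = 'X^k.
Proof.
elim: k => [|k IH]; first by rewrite /= derivC subr0 expr0.
rewrite [gamma_poly _]/= derivD derivXn derivZ opprD addrACA -scalerBr IH.
by rewrite -scaler_nat subrK.
Qed.

Lemma gamma_poly0 k : (gamma_poly k).[0] = (k`!)%:R.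
Proof.
elim: k => [|k IH]; first by rewrite /= hornerC.
by rewrite /= hornerD hornerXn hornerZ IH expr0n add0r factS natrM.
Qed.

Lemma integral_exprn_expRN k :
  (\int[@lebesgue_measure R]_(x in `[0%R, +oo[) (x ^+ k * expR (- x))%:E = ((k`!)%:R)%:E)%E.
Proof.
have dF x : is_derive x 1 (fun z => (- gamma_poly k).[z] * expR (- z)) (x ^+ k * expR (- x)).
  apply: is_derive_eq (is_derive_poly_expRN _ _) _.
  by rewrite derivN opprK addrC gamma_poly_deriv hornerXn.
rewrite (@ge0_continuous_FTC2y _ _ (fun z => (- gamma_poly k).[z] * expR (- z)) 0 0).
- by rewrite oppr0 expR0 mulr1 hornerN gamma_poly0 EFinN oppeK add0e.
- by move=> x x0; rewrite mulr_ge0 ?expR_ge0 ?exprn_ge0.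
- apply: continuous_subspaceT => x.
  rewrite (_ : (fun x => _) = (fun x => ('X^k).[x] * expR (- x))); last first.
    by apply/funext => z; rewrite hornerXn.
  exact: is_derive_continuous (is_derive_poly_expRN 'X^k x).
- exact: cvg_poly_expRN.
- by move=> x _; have [] := dF x.
- exact: cvg_at_right_filter (is_derive_continuous (dF 0)).
- by move=> x _; rewrite derive1E; have [_ ->] := dF x.
Qed.

Definition taylor_poly N : {poly R} := \poly_(i < N) ((-1) ^+ i / (i`!)%:R).

Lemma deriv_taylor_poly N : (taylor_poly N.+1)^`() = - taylor_poly N.
Proof.
apply/polyP => i; rewrite coef_deriv coefN !coef_poly ltnS.
case: ifP => _; last by rewrite mul0rn oppr0.
rewrite exprS mulN1r factS natrM mulNr mulNrn; congr (- _).
by rewrite -[LHS]mulr_natl invfM mulrCA mulVKf// pnatr_eq0.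
Qed.

(** Up to sign, the remainder differentiates to the remainder of order one less. For each sign [s],
    the function [f] vanishes at 0 and has a nonnegative derivative by the induction hypothesis. *)
Lemma expR_taylor N x : 0 <= x ->
  `|expR (- x) - (taylor_poly N).[x]| <= x ^+ N / (N`!)%:R.
Proof.
elim: N x => [|N IH] x x0.
  rewrite /taylor_poly poly_def big_ord0 horner0 subr0 expr0 fact0 divr1 ger0_norm ?expR_ge0//.
  by rewrite expR_le1 oppr_le0.
have [E0 T0] : ((N.+1`!)%:R^-1 *: 'X^(N.+1)).[0 : R] = 0 /\ (taylor_poly N.+1).[0] = 1.
  split; first by rewrite hornerZ hornerXn expr0n mulr0.
  by rewrite horner_coef0 coef_poly/= expr0 fact0 divr1.
have fN : (N.+1`!)%:R != 0 :> R by rewrite pnatr_eq0 -lt0n fact_gt0.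
have dq y : ((N.+1`!)%:R^-1 *: 'X^(N.+1))^`().[y : R] = y ^+ N / (N`!)%:R.
  rewrite derivZ derivXn hornerZ hornerMn hornerXn factS natrM.
  by rewrite -[y ^+ _ *+ _]mulr_natl invfM mulrC mulrACA mulfV ?pnatr_eq0// mul1r.
have main (s : R) : (s == 1) || (s == -1) ->
    0 <= x ^+ N.+1 / (N.+1`!)%:R - s * (expR (- x) - (taylor_poly N.+1).[x]).
  move=> s1; pose q := (N.+1`!)%:R^-1 *: 'X^(N.+1) + s *: taylor_poly N.+1.
  pose f (z : R) := q.[z] - s * expR (- z).
  have df (y : R) : is_derive y 1 f (y ^+ N / (N`!)%:R + s * (expR (- y) - (taylor_poly N).[y])).
    apply: is_derive_eq (is_deriveB (is_derive_poly q y) (is_deriveZ s (is_derive_expRN y))) _.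
    rewrite /q derivD hornerD dq derivZ hornerZ deriv_taylor_poly hornerN /GRing.scale/=.
    ring.
  have f0 : f 0 = 0.
    by rewrite /f /q hornerD E0 hornerZ T0 oppr0 expR0 mulr1 add0r subrr.
  have <- : f x = x ^+ N.+1 / (N.+1`!)%:R - s * (expR (- x) - (taylor_poly N.+1).[x]).
    rewrite /f /q hornerD hornerZ hornerXn hornerZ; ring.
  rewrite -f0; apply: (@ger0_derive1_ndecry _ f 0) => //.
  - move=> y; rewrite in_itv/= andbT => y0; rewrite derive1E; have [_ ->] := df y.
    have /ler_normlP[h1 h2] := IH y (ltW y0).
    by case/orP: s1 => /eqP ->; rewrite ?mul1r ?mulN1r; lra.
  - apply: continuous_subspaceT => y.
    exact: is_derive_continuous (df y).
apply/ler_normlP; split.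
  by have := main (-1) (introT orP (or_intror (eqxx _))); lra.
by have := main 1 (introT orP (or_introl (eqxx _))); lra.
Qed.

End ExpPoly.

Section ExponentialMoments.
Variable R : realType.
Implicit Types (f h : R -> R) (x : R).
Local Notation leb := (@lebesgue_measure R).
Local Notation pos := (`[0%R, +oo[%classic : set (measurableTypeR R)).

(** Growth is measured on the half-line, where both [|tr g|^2] and an exponential variable take
    their values. *)
Definition poly_growth f :=
  measurable_fun setT f /\ exists C k, forall x, 0 <= x -> `|f x| <= C * (1 + x) ^+ k.

Definition exp_mean f : R := \int[leb]_(x in pos) (f x * expR (- x)).

Lemma poly_growthD f h : poly_growth f -> poly_growth h -> poly_growth (fun x => f x + h x).
Proof.
move=> [mf [C [k fC]]] [mh [D [l hD]]]; split; first exact: measurable_funD.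
have nn (u : R -> R) B j : (forall x, 0 <= x -> `|u x| <= B * (1 + x) ^+ j) -> 0 <= B.
  by move=> /(_ 0 (lexx 0)); rewrite addr0 expr1n mulr1; apply: le_trans.
have C0 := nn _ _ _ fC; have D0 := nn _ _ _ hD.
exists (C + D), (k + l)%N => x x0; have x1 : 1 <= 1 + x by rewrite lerDl.
apply: le_trans (ler_normD _ _) _; rewrite mulrDl.
apply: lerD; [apply: le_trans (fC x x0) _|apply: le_trans (hD x x0) _]; apply: ler_wpM2l => //;
  apply: ler_weXn2l => //; [exact: leq_addr|exact: leq_addl].
Qed.

Lemma poly_growthM f h : poly_growth f -> poly_growth h -> poly_growth (fun x => f x * h x).
Proof.
move=> [mf [C [k fC]]] [mh [D [l hD]]]; split; first exact: measurable_funM.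
exists (C * D), (k + l)%N => x x0.
by rewrite normrM exprD mulrACA; apply: ler_pM => //; [exact: fC|exact: hD].
Qed.

Lemma poly_growth_cst c : poly_growth (fun=> c).
Proof. by split; [exact: measurable_cst|exists `|c|, 0%N => x _; rewrite mulr1]. Qed.

Lemma poly_growth_id : poly_growth id.
Proof.
split; first exact: measurable_id.
by exists 1, 1%N => x x0; rewrite mul1r ger0_norm// lerDr.
Qed.

Lemma poly_growthX f k : poly_growth f -> poly_growth (fun x => f x ^+ k).
Proof.
move=> gf; elim: k => [|k IH].
  by under [X in poly_growth X]eq_fun do rewrite expr0; exact: poly_growth_cst.
by under [X in poly_growth X]eq_fun do rewrite exprS; exact: poly_growthM.
Qed.

Lemma poly_growth_expRN s : 0 <= s -> poly_growth (fun x => expR (- (s * x))).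
Proof.
move=> s0; split; first by apply: measurableT_comp; [exact: measurable_expR|apply: measurableT_comp => //; exact: measurable_funM].
exists 1, 0%N => x x0; rewrite mulr1 ger0_norm ?expR_ge0// expR_le1 oppr_le0.
exact: mulr_ge0.
Qed.

Lemma poly_growth_sqrt : poly_growth (@Num.sqrt R).
Proof.
split.
  by apply: continuous_measurable_fun; exact: sqrt_continuous.
exists 1, 1%N => x x0; rewrite ger0_norm ?sqrtr_ge0// mul1r expr1.
have := sqr_sqrtr x0; have := sqrtr_ge0 x; set y := Num.sqrt x => y0 <-; nra.
Qed.

Lemma integrable_exprn_expRN k :
  leb.-integrable pos (EFin \o (fun x => x ^+ k * expR (- x))).
Proof.
have mf : measurable_fun pos (fun x : R => x ^+ k * expR (- x)).
  apply: measurable_funM; first exact: measurable_funX.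
  by apply: measurableT_comp; [exact: measurable_expR|exact: measurable_funN].
apply/integrableP; split; first exact/measurable_EFinP.
rewrite [ltLHS](_ : _ = (\int[leb]_(x in pos) (x ^+ k * expR (- x))%:E)%E).
  by rewrite integral_exprn_expRN ltry.
apply: eq_integral; move=> x /set_mem; rewrite /= in_itv/= andbT => x0.
by rewrite ger0_norm// mulr_ge0 ?expR_ge0 ?exprn_ge0.
Qed.

Lemma exp_mean_integrable f : poly_growth f ->
  leb.-integrable pos (EFin \o (fun x => f x * expR (- x))).
Proof.
move=> [mf [C [k fC]]].
have C0 : 0 <= C by have := fC 0 (lexx 0); rewrite addr0 expr1n mulr1; apply: le_trans.
have mp : measurable pos by exact: measurable_itv.
have i1 := integrableD mp (integrable_exprn_expRN 0) (integrable_exprn_expRN k).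
(* The dominating function comes from [(1 + x)^k <= 2^k (1 + x^k)], checked separately for [x <= 1]
   and [x > 1]. *)
have i2 := integrableZl mp (C * 2 ^+ k) i1.
apply: le_integrable i2 => //.
  apply/measurable_EFinP/measurable_funM; first exact: measurable_funTS.
  by apply: measurableT_comp; [exact: measurable_expR|exact: measurable_funN].
move=> x; rewrite /= in_itv/= andbT => x0; rewrite lee_fin.
rewrite expr0 -mulrDl !normrM [in leRHS]mulrA [`|expR _|]ger0_norm ?expR_ge0//.
apply: ler_wpM2r; first exact: expR_ge0.
rewrite [`|1 + _|]ger0_norm ?addr_ge0 ?exprn_ge0// -normrM [`|C * _|]ger0_norm ?mulr_ge0 ?exprn_ge0//.
apply: le_trans (fC x x0) _; rewrite -mulrA; apply: ler_wpM2l => //.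
have [x1|x1] := leP x 1.
  apply: (@le_trans _ _ (2 ^+ k)); first by rewrite lerXn2r ?nnegrE ?addr_ge0//; lra.
  by rewrite ler_peMr ?exprn_ge0// lerDl exprn_ge0.
apply: (@le_trans _ _ ((2 * x) ^+ k)); first by rewrite lerXn2r ?nnegrE ?addr_ge0 ?mulr_ge0//; lra.
by rewrite exprMn ler_wpM2l ?exprn_ge0// lerDr.
Qed.

Lemma exp_meanX k : exp_mean (fun x => x ^+ k) = (k`!)%:R.
Proof. by rewrite /exp_mean /Rintegral integral_exprn_expRN. Qed.

Lemma exp_meanD f h : poly_growth f -> poly_growth h ->
  exp_mean (fun x => f x + h x) = exp_mean f + exp_mean h.
Proof.
move=> gf gh; rewrite -[RHS]RintegralD//; try exact: exp_mean_integrable.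
by apply: eq_Rintegral => x _; rewrite mulrDl.
Qed.

Lemma exp_meanZ c f : poly_growth f -> exp_mean (fun x => c * f x) = c * exp_mean f.
Proof.
move=> gf; rewrite -[RHS]RintegralZl//; last exact: exp_mean_integrable.
by apply: eq_Rintegral => x _; rewrite mulrA.
Qed.

Lemma exp_mean_le f h : poly_growth f -> poly_growth h ->
  (forall x, 0 <= x -> f x <= h x) -> exp_mean f <= exp_mean h.
Proof.
move=> gf gh fh; apply: le_Rintegral => //; try exact: exp_mean_integrable.
by move=> x /=; rewrite in_itv/= andbT => x0; rewrite ler_wpM2r ?expR_ge0 ?fh.
Qed.

End ExponentialMoments.

(** * Convergence of the means of functions of [|tr g|^2] *)

Section Convergence.
Variables (R : realType) (haar : forall n : nat, probability (mxBorel R n) R).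
Hypothesis haarP : forall n, is_haar (haar n).
Local Notation C := (Cplx R).
Implicit Types (f h : R -> R) (x : R).

Definition tr_mean n f : R := ER (haar n) (fun g => f (trn g ^+ 2)).

Definition good f := poly_growth f /\ (fun n => tr_mean n f) @ \oo --> exp_mean f.

Lemma bmeas_poly_growth n f : poly_growth f -> bmeas (fun g : mxBorel R n => f (trn g ^+ 2)).
Proof.
move=> [mf [D [k fD]]].
have D0 : 0 <= D by have := fD 0 (lexx 0); rewrite addr0 expr1n mulr1; apply: le_trans.
have [mt _] := bmeasX 2 (@bmeas_trn R n); split; first exact: measurableT_comp.
exists (D * (1 + n%:R ^+ 2) ^+ k) => g Ug.
apply: le_trans (fD _ (sqr_ge0 _)) _; apply: ler_wpM2l => //.
rewrite lerXn2r ?nnegrE ?addr_ge0 ?sqr_ge0// lerD2l lerXn2r ?nnegrE ?trn_ge0//.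
exact: (rnorm_tr_le 1 Ug).
Qed.

Lemma tr_meanD n f h : poly_growth f -> poly_growth h ->
  tr_mean n (fun x => f x + h x) = tr_mean n f + tr_mean n h.
Proof. by move=> gf gh; apply: (ERD (haarP n)); exact: bmeas_poly_growth. Qed.

Lemma tr_meanZ n c f : poly_growth f -> tr_mean n (fun x => c * f x) = c * tr_mean n f.
Proof. by move=> gf; apply: (ERZ (haarP n)); exact: bmeas_poly_growth. Qed.

Lemma tr_mean_le n f h : poly_growth f -> poly_growth h ->
  (forall x, 0 <= x -> f x <= h x) -> tr_mean n f <= tr_mean n h.
Proof.
move=> gf gh fh; apply: (ER_le (haarP n)); try exact: bmeas_poly_growth.
by move=> g _; apply: fh; exact: sqr_ge0.
Qed.

Lemma poly_growthZ c f : poly_growth f -> poly_growth (fun x => c * f x).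
Proof. by apply: poly_growthM; exact: poly_growth_cst. Qed.

Lemma goodD f h : good f -> good h -> good (fun x => f x + h x).
Proof.
move=> [gf cf] [gh ch]; split; first exact: poly_growthD.
rewrite exp_meanD// (_ : (fun n => _) = (fun n => tr_mean n f + tr_mean n h)); first exact: cvgD.
by apply/funext => n; rewrite tr_meanD.
Qed.

Lemma goodZ c f : good f -> good (fun x => c * f x).
Proof.
move=> [gf cf]; split; first exact: poly_growthZ.
rewrite exp_meanZ// (_ : (fun n => _) = (fun n => c * tr_mean n f)); first exact: cvgMr.
by apply/funext => n; rewrite tr_meanZ.
Qed.

Lemma good_exprn k : good (fun x => x ^+ k).
Proof.
split; first by apply: poly_growthX; exact: poly_growth_id.
rewrite exp_meanX (_ : (fun n => _) = tmoment haar (2 * k)); first exact: tmoment_cvg.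
by apply/funext => n; apply: eq_ER => g _; rewrite exprM.
Qed.

Lemma good_sum (I : Type) (s : seq I) (F : I -> R -> R) :
  (forall i, good (F i)) -> good (fun x => \sum_(i <- s) F i x).
Proof.
move=> gF; elim: s => [|i s IH].
  have := goodZ 0 (good_exprn 0); congr good; apply/funext => x.
  by rewrite big_nil mul0r.
by under [X in good X]eq_fun do rewrite big_cons; exact: goodD.
Qed.

(** The error bound [q] is itself good, so its small limit mean controls the error for all large
    [n]. Four contributions of [e / 4] add up: two from the mean of [q] at [n], one from its limit
    mean, one from [p]. *)
Lemma good_approx f : poly_growth f ->
  (forall e, 0 < e -> exists p q, [/\ good p, good q,
     forall x, 0 <= x -> `|f x - p x| <= q x & exp_mean q <= e]) -> good f.
Proof.
move=> gf H; split=> //; apply/cvgrPdist_le => e e0.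
have e4 : 0 < e / 4 by rewrite divr_gt0.
have [p [q [[gp cp] [gq cq] fpq qe]]] := H _ e4.
have gN u : poly_growth u -> poly_growth (fun x => -1 * u x) by exact: poly_growthZ.
have gB := poly_growthD gf (gN _ gp); have gB' := poly_growthD gp (gN _ gf).
have pt x : 0 <= x -> f x + -1 * p x <= q x /\ p x + -1 * f x <= q x.
  by move=> /fpq/ler_normlP[]; split; lra.
near=> n.
have h1 : `|exp_mean p - tr_mean n p| <= e / 4.
  by near: n; move/cvgrPdist_le : cp; apply.
have h2 : `|exp_mean q - tr_mean n q| <= e / 4.
  by near: n; move/cvgrPdist_le : cq; apply.
have t1 := tr_mean_le n gB gq (fun x hx => (pt x hx).1).
have t2 := tr_mean_le n gB' gq (fun x hx => (pt x hx).2).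
have t3 := exp_mean_le gB gq (fun x hx => (pt x hx).1).
have t4 := exp_mean_le gB' gq (fun x hx => (pt x hx).2).
move: t1 t2 t3 t4; rewrite !tr_meanD ?tr_meanZ ?exp_meanD ?exp_meanZ//; try exact: gN.
move: h1 h2 => /ler_normlP[h1 h1'] /ler_normlP[h2 h2'] t1 t2 t3 t4.
by apply/ler_normlP; split; lra.
Unshelve. all: by end_near. Qed.

Section Exponentials.
Variable s : R.
Hypotheses (s0 : 0 <= s) (s1 : s <= 1 / 4).
Local Notation E x := (expR (- (s * x))).

Lemma bin_le_exp2 n k : ('C(n, k) <= 2 ^ n)%N.
Proof.
elim: n k => [|n IH] [|k]; rewrite ?bin0 ?bin0n ?expn_gt0//.
by rewrite binS expnS mul2n -addnn leq_add.
Qed.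

(** Writing [(k + N)!] with a binomial coefficient of at most [2^(k+N)] leaves [(2 s)^N]; the
    condition [s <= 1 / 4] makes this decay at ratio [1 / 2]. *)
Lemma tail_coef_le k N : s ^+ N / (N`!)%:R * ((k + N)`!)%:R <= 2 ^+ k * (k`!)%:R / 2 ^+ N.
Proof.
have F0 m : 0 < (m`!)%:R :> R by rewrite ltr0n fact_gt0.
have -> : ((k + N)`!)%:R = 'C(k + N, N)%:R * ((N`!)%:R * (k`!)%:R) :> R.
  by have := bin_fact (leq_addl k N); rewrite addnK => <-; rewrite !natrM.
have -> : s ^+ N / (N`!)%:R * ('C(k + N, N)%:R * ((N`!)%:R * (k`!)%:R)) =
    s ^+ N * 'C(k + N, N)%:R * (k`!)%:R by field; rewrite gt_eqF.
rewrite [leRHS]mulrAC ler_pM2r//.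
apply: (@le_trans _ _ ((1 / 4) ^+ N * 2 ^+ (k + N))).
  apply: ler_pM; rewrite ?exprn_ge0//; first by rewrite lerXn2r ?nnegrE// divr_ge0.
  by rewrite -natrX ler_nat bin_le_exp2.
rewrite exprD mulrCA ler_pM2l ?exprn_gt0// -exprMn -exprVn.
by rewrite lerXn2r ?nnegrE//; lra.
Qed.

(* One factor E x at a time: the Taylor expansion of E x converges in mean because s is
   small, that of E x ^+ j would not. *)
Lemma good_exprn_expRN k j : good (fun x => x ^+ k * E x ^+ j).
Proof.
elim: j k => [|j IH] k.
  by under [X in good X]eq_fun do rewrite expr0 mulr1; exact: good_exprn.
apply: good_approx.
  apply: poly_growthM; first by apply: poly_growthX; exact: poly_growth_id.
  by apply: poly_growthX; exact: poly_growth_expRN.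
move=> e e0.
pose N := Num.bound (2 ^+ k * (k`!)%:R / e).
have NE : 2 ^+ k * (k`!)%:R / e <= N%:R.
  by apply/ltW/archi_boundP; rewrite divr_ge0 ?mulr_ge0 ?exprn_ge0// ltW.
(* Only the last exponential factor is expanded, so each term carries [E x ^+ j] and falls under the
   induction hypothesis, which holds for every power of [x]. *)
pose p x := \sum_(i < N) ((-s) ^+ i / (i`!)%:R) * (x ^+ (k + i) * E x ^+ j).
pose q x := (s ^+ N / (N`!)%:R) * x ^+ (k + N).
exists p, q; split.
- by apply: good_sum => i; exact: goodZ.
- by apply: goodZ; exact: good_exprn.
- move=> x x0; have y0 : 0 <= s * x by exact: mulr_ge0.
  have -> : x ^+ k * E x ^+ j.+1 - p x =
      x ^+ k * E x ^+ j * (expR (- (s * x)) - (taylor_poly R N).[s * x]).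
    rewrite mulrBr exprSr mulrA; congr (_ - _).
    rewrite /p /taylor_poly horner_poly mulr_sumr; apply: eq_bigr => i _.
    by rewrite exprD [(- s) ^+ i]exprNn exprMn; ring.
  rewrite normrM; apply: (@le_trans _ _ (x ^+ k * ((s * x) ^+ N / (N`!)%:R))).
    apply: ler_pM => //; last exact: expR_taylor.
    rewrite ger0_norm ?mulr_ge0 ?exprn_ge0 ?expR_ge0// ler_piMr ?exprn_ge0//.
    by rewrite exprn_ile1 ?expR_ge0// expR_le1 oppr_le0.
  by rewrite /q exprD exprMn le_eqVlt; apply/orP; left; apply/eqP; ring.
- rewrite /q exp_meanZ; last by apply: poly_growthX; exact: poly_growth_id.
  rewrite exp_meanX; apply: le_trans (tail_coef_le k N) _.
  rewrite ler_pdivrMr ?exprn_gt0// -ler_pdivrMl// mulrC; apply: le_trans NE _.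
  by rewrite -natrX ler_nat ltnW// ltn_expl.
Qed.

End Exponentials.

End Convergence.

(** The classical polynomial iteration increasing to the square root on [[0, 1]]. The difference is
    spelled with [-1 *] to match the sums and products under which multipliers are closed. *)
Fixpoint sqrt_iter (R : realType) K (w : R) : R :=
  if K is K'.+1 then
    let q := sqrt_iter K' w in q + 1 / 2 * (w + -1 * (q * q))
  else 0.

(** The new error is [(r - q) (1 - (r + q) / 2)], at most [y (1 - y / 2)] for the old error [y].
    This map is increasing on [[0, 1]] and sends [2 / (K + 2)] below [2 / (K + 3)]. *)
Lemma sqrt_iter_bound (R : realType) K (w : R) : 0 <= w <= 1 ->
  0 <= sqrt_iter K w <= Num.sqrt w /\ Num.sqrt w - sqrt_iter K w <= 2 / (K%:R + 2).
Proof.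
move=> /andP[w0 w1]; set r := Num.sqrt w.
have r0 : 0 <= r := sqrtr_ge0 w.
have rr : w = r * r by rewrite -expr2 sqr_sqrtr.
have r1 : r <= 1 by rewrite -sqrtr1 ler_wsqrtr.
elim: K => [|K] /=; first by rewrite lexx r0 subr0 add0r divff ?pnatr_eq0//; split.
set q := sqrt_iter K w => -[/andP[q0 qr] qb].
have E : r - (q + 1 / 2 * (w + -1 * (q * q))) = (r - q) * (1 - (r + q) / 2).
  by rewrite rr; field.
have q1 : q <= 1 by lra.
have h : 0 <= r - (q + 1 / 2 * (w + -1 * (q * q))).
  by rewrite E mulr_ge0; lra.
split.
  apply/andP; split; last by rewrite -subr_ge0.
  have : 0 <= (r - q) * (r + q) by apply: mulr_ge0; lra.
  rewrite rr; lra.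
rewrite E; set y := r - q in qb *.
have y0 : 0 <= y by rewrite subr_ge0.
apply: (@le_trans _ _ (y * (1 - y / 2))).
  by apply: ler_wpM2l => //; rewrite /y; lra.
have K0 : 0 <= K%:R :> R by exact: ler0n.
rewrite -[K.+1%:R]natr1; set c : R := K%:R in qb K0 *.
have c2 : 0 < c + 2 by lra. have c3 : 0 < c + 1 + 2 by lra.
have y1 : y <= 1 by rewrite /y; lra.
apply: (@le_trans _ _ (2 / (c + 2) * (1 - 2 / (c + 2) / 2))).
  set z := 2 / (c + 2) in qb *.
  have z1 : z <= 1 by rewrite /z ler_pdivrMr//; lra.
  by rewrite -subr_ge0 (_ : _ - _ = (z - y) * (1 - (y + z) / 2)); [rewrite mulr_ge0; lra|field].
rewrite -subr_ge0.
have -> : 2 / (c + 1 + 2) - 2 / (c + 2) * (1 - 2 / (c + 2) / 2) =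
    2 / ((c + 1 + 2) * (c + 2) ^+ 2) by field; rewrite !gt_eqF.
by rewrite divr_ge0 ?mulr_ge0 ?exprn_ge0// ltW.
Qed.

Section HalfIntegers.
Variables (R : realType) (haar : forall n : nat, probability (mxBorel R n) R).
Hypothesis haarP : forall n, is_haar (haar n).

Section Multipliers.
Variable s : R.
Hypotheses (s0 : 0 <= s) (s1 : s <= 1 / 4).
Local Notation E x := (expR (- (s * x))).
Local Notation good := (good haar).

(** Goodness is not visibly stable under products. Admissible functions therefore carry all factors
    [x ^+ k * E x ^+ j] along, and multipliers, closed under sums and products, build up polynomials
    in [x] and [E x]. *)
Definition admissible (h : R -> R) := forall k j, good (fun x => x ^+ k * E x ^+ j * h x).
Definition multiplier (f : R -> R) := forall h, admissible h -> admissible (fun x => f x * h x).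

Lemma admissible1 : admissible (fun=> 1).
Proof.
move=> k j; under [X in good X]eq_fun do rewrite mulr1; exact: good_exprn_expRN.
Qed.

Lemma multiplier_id : multiplier id.
Proof.
move=> h ah k j; have := ah k.+1 j; congr good; apply/funext => x.
by rewrite exprS; ring.
Qed.

Lemma multiplier_exp : multiplier (fun x => E x).
Proof.
move=> h ah k j; have := ah k j.+1; congr good; apply/funext => x.
by rewrite exprS; ring.
Qed.

Lemma multiplier_cst c : multiplier (fun=> c).
Proof.
move=> h ah k j; have := goodZ haarP c (ah k j); congr good; apply/funext => x.
by ring.
Qed.

Lemma multiplierD f1 f2 : multiplier f1 -> multiplier f2 -> multiplier (fun x => f1 x + f2 x).
Proof.
move=> m1 m2 h ah k j; have := goodD haarP (m1 _ ah k j) (m2 _ ah k j).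
by congr good; apply/funext => x; rewrite mulrDl mulrDr.
Qed.

Lemma multiplierM f1 f2 : multiplier f1 -> multiplier f2 -> multiplier (fun x => f1 x * f2 x).
Proof.
move=> m1 m2 h ah k j; have := m1 _ (m2 _ ah) k j.
by congr good; apply/funext => x; rewrite !mulrA.
Qed.

Lemma multiplier_sqrt_iter K : multiplier (fun x => sqrt_iter K (s * (x * E x))).
Proof.
elim: K => [|K IH] /=; first exact: multiplier_cst.
apply: multiplierD => //; apply: multiplierM; first exact: multiplier_cst.
apply: multiplierD; last by apply: multiplierM; [exact: multiplier_cst|exact: multiplierM].
apply: multiplierM; first exact: multiplier_cst.
by apply: multiplierM; [exact: multiplier_id|exact: multiplier_exp].
Qed.

Lemma good_sqrt_iter m K : good (fun x => x ^+ m * sqrt_iter K (s * (x * E x))).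
Proof.
have := @multiplier_sqrt_iter K _ admissible1 m 0%N; congr good; apply/funext => x.
by rewrite expr0 !mulr1.
Qed.

End Multipliers.

(* With w = s x exp(- s x) <= 1, sqrt x is close to sqrt w / sqrt s for small s, and sqrt w is
   a uniform limit of polynomials in w. *)
Lemma good_exprn_sqrt m : good haar (fun x => x ^+ m * Num.sqrt x).
Proof.
apply: good_approx => //.
  apply: poly_growthM; last exact: poly_growth_sqrt.
  by apply: poly_growthX; exact: poly_growth_id.
(* [s * B] is the exponential mean of the error bound [s (2 x^m + x^(m+2))] used below. *)
move=> e e0; pose B : R := 2 * (m`!)%:R + ((m + 2)`!)%:R.
have B0 : 0 < B by rewrite addr_gt0 ?mulr_gt0 ?ltr0n ?fact_gt0.
pose s := Num.min (1 / 4) (e / B).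
have s0 : 0 < s by rewrite lt_min !divr_gt0.
have s1 : s <= 1 / 4 by rewrite ge_min lexx.
have sB : s * B <= e by rewrite -ler_pdivlMr// ge_min lexx orbT.
pose t := Num.sqrt s; have t0 : 0 < t by rewrite sqrtr_gt0.
(* The iteration error [2 / (K + 2)] is divided by [t] when passing from the root of [w] to that of
   [x]; [K] brings the quotient below [s]. *)
pose K := Num.bound (2 / (t * s)).
have KE : t^-1 * (2 / (K%:R + 2)) <= s.
  have : 2 / (t * s) < K%:R by apply/archi_boundP; apply: divr_ge0 => //; apply: mulr_ge0; exact: ltW.
  rewrite ltr_pdivrMr ?mulr_gt0// => H.
  have K0 : 0 <= K%:R :> R by exact: ler0n.
  rewrite ler_pdivrMl// ler_pdivrMr; last by lra.
  have : 0 < t * s by exact: mulr_gt0.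
  lra.
have gX k : poly_growth (fun x : R => x ^+ k) by apply: poly_growthX; exact: poly_growth_id.
exists (fun x => t^-1 * (x ^+ m * sqrt_iter K (s * (x * expR (- (s * x)))))),
  (fun x => s * (2 * x ^+ m + x ^+ (m + 2))); split.
- by apply: goodZ => //; apply: good_sqrt_iter => //; exact: ltW.
- apply: goodZ => //; apply: goodD => //; last exact: good_exprn.
  by apply: goodZ => //; exact: good_exprn.
- move=> x x0; set w := s * _.
  have ew : expR (s * x) >= s * x by have := expR_ge1Dx (s * x); lra.
  have w01 : 0 <= w <= 1.
    rewrite /w mulr_ge0 ?(ltW s0) ?mulr_ge0 ?expR_ge0//= mulrA expRN.
    by rewrite ler_pdivrMr ?expR_gt0// mul1r.
  pose a := expR (- (s * x / 2)).
  have wE : Num.sqrt w = t * (Num.sqrt x * a).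
    have -> : w = s * (x * a ^+ 2).
      by rewrite /w /a -expRM_natl; congr (_ * (_ * expR _)); field.
    by rewrite (sqrtrM _ (ltW s0)) (sqrtrM _ x0) sqrtr_sqr ger0_norm ?expR_ge0.
  have [/andP[q0 qw] qb] := sqrt_iter_bound K w01.
  set q := sqrt_iter K w in q0 qw qb *.
  have a1 : a <= 1 by rewrite /a expR_le1 oppr_le0 divr_ge0// mulr_ge0// ltW.
  have a2 : 1 - a <= s * x / 2 by have := expR_ge1Dx (- (s * x / 2)); rewrite -/a; lra.
  have r0 := sqrtr_ge0 x; set r := Num.sqrt x in r0 wE *.
  have rr : r * r = x by rewrite -expr2 sqr_sqrtr.
  (* The error splits at [r * a], the root of [w] over [t]: the iteration costs at most [s], and the
     damping costs [r (1 - a) <= r s x / 2 <= s (1 + x^2)]. *)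
  have H1 : 0 <= r - t^-1 * q <= s * (2 + x ^+ 2).
    have tq : t^-1 * q <= r * a by rewrite ler_pdivrMl// -wE.
    have h1 : r * a - t^-1 * q <= s.
      apply: le_trans KE; rewrite -[r * a](mulKf (lt0r_neq0 t0)) -mulrBr.
      by rewrite ler_pM2l ?invr_gt0// -wE.
    have h2 : r * (1 - a) <= s * (1 + x ^+ 2).
      apply: (@le_trans _ _ (r * (s * x / 2))); first exact: ler_wpM2l.
      have -> : r * (s * x / 2) = s * (r * x / 2) by field.
      rewrite ler_pM2l//.
      have : r <= 1 + x by nra.
      nra.
    by apply/andP; split; nra.
  have -> : x ^+ m * r - t^-1 * (x ^+ m * q) = x ^+ m * (r - t^-1 * q) by ring.
  have -> : s * (2 * x ^+ m + x ^+ (m + 2)) = x ^+ m * (s * (2 + x ^+ 2)) by rewrite exprD; ring.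
  have /andP[H0 H2] := H1.
  by rewrite ger0_norm ?mulr_ge0 ?exprn_ge0// ler_wpM2l ?exprn_ge0.
- rewrite exp_meanZ; last by apply: poly_growthD => //; exact: poly_growthZ.
  rewrite exp_meanD//; last exact: poly_growthZ.
  by rewrite exp_meanZ// !exp_meanX.
Qed.

(** The real power is matched at positive points only, so the closed half-line is exchanged for the
    open one of [Gamma]. *)
Lemma exp_mean_Gamma (f : R -> R) (a : R) : poly_growth f ->
  (forall x, 0 < x -> f x = x `^ (a - 1)) -> exp_mean f = Gamma a.
Proof.
move=> gf fE; rewrite /exp_mean -(Rintegral_itv_obnd_cbnd).
  by apply: eq_Rintegral => x /set_mem/=; rewrite in_itv/= andbT => /fE ->.
apply: integrableS (exp_mean_integrable gf) => //.
by move=> x /=; rewrite !in_itv/= !andbT; exact: ltW.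
Qed.

(** In terms of [y = |tr g|^2] the integrand [|tr g|^d] is a power of [y] for even [d], and a power
    times the root of [y] for odd [d]. *)
Lemma tmoment_Gamma d : tmoment haar d @ \oo --> (Gamma (1 + d%:R / 2) : R).
Proof.
have aE : 1 + d%:R / 2 - 1 = d%:R / 2 :> R by rewrite addrC addKr.
have dE := odd_double_half d; have [od|ed] := boolP (odd d).
  have dR : d%:R / 2 = d./2%:R + 2^-1 :> R.
    by move: dE; rewrite od; set k := d./2 => <-; rewrite -mul2n natrD natrM mulr1n; field.
  have [gf cf] := good_exprn_sqrt d./2.
  rewrite -(exp_mean_Gamma gf) => [|x x0].
    rewrite (_ : tmoment _ _ = fun n => tr_mean haar n (fun x => x ^+ d./2 * Num.sqrt x))//.
    apply/funext => n; apply: eq_ER => g _.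
    by rewrite -exprM sqrtr_sqr ger0_norm ?trn_ge0// -exprSr -{1}dE od mul2n.
  by rewrite aE dR powRD ?gt_eqF// powR_mulrn ?ltW// powR12_sqrt// ltW.
have dR : d%:R / 2 = d./2%:R :> R.
  by move: dE; rewrite (negbTE ed); set k := d./2 => <-; rewrite add0n -mul2n natrM; field.
have [gf cf] := good_exprn haarP d./2.
rewrite -(exp_mean_Gamma gf) => [|x x0].
  rewrite (_ : tmoment _ _ = fun n => tr_mean haar n (fun x => x ^+ d./2))//.
  apply/funext => n; apply: eq_ER => g _.
  by rewrite -exprM -{1}dE (negbTE ed) mul2n.
by rewrite aE dR powR_mulrn ?ltW.
Qed.

End HalfIntegers.

(** * The limits *)

Section Asymptotics.
Variables (R : realType) (haar : forall n : nat, probability (mxBorel R n) R).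
Hypothesis haarP : forall n, is_haar (haar n).
Local Notation C := (Cplx R).

Lemma proj_constE d n :
  proj_const (hpoly R d n) = (ER (haar n) (fun g => rnorm (charsum d (g : 'M[C]_n))))%:E.
Proof.
have -> : ER (haar n) (fun g => rnorm (charsum d (g : 'M[C]_n))) =
    ER (haar n) (fun g => rnorm (kappa (haarP n) d g : C)).
  by apply: eq_ER => g Ug; rewrite kappaE.
by apply/le_anti; rewrite proj_const_le proj_const_ge.
Qed.

Lemma ER_charsum_n d n : ER (haar n) (fun g => rnorm (charsum_n d g)) =
  ER (haar n) (fun g => rnorm (charsum d (g : 'M[C]_n))) * (n%:R ^+ d)^-1.
Proof.
rewrite mulrC -(ERZ (haarP n)); last by apply: cbm_rnorm; exact: cbm_charsum.
by apply: eq_ER => g _; rewrite /charsum_n rnormM rnormV rnormX rnorm_nat mulrC.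
Qed.

Lemma ER_charsum_n_cvg d : (fun n => ER (haar n) (fun g => rnorm (charsum_n d g))) @ \oo -->
  (Gamma (1 + d%:R / 2) / (d`!)%:R : R).
Proof.
have H1 := charsum_n_tmoment haarP d.
have H2 : (fun n => (d`!)%:R^-1 * tmoment haar d n) @ \oo --> (d`!)%:R^-1 * (Gamma (1 + d%:R / 2) : R).
  by apply: cvgMr; exact: tmoment_Gamma.
have := cvgD H1 H2; rewrite add0r mulrC => H; apply: cvg_trans (H _).
rewrite (_ : (fun n => ER _ _) = (fun n => ER (haar n) (fun g => rnorm (charsum_n d g)) -
   (d`!)%:R^-1 * tmoment haar d n + (d`!)%:R^-1 * tmoment haar d n)); first by [].
by apply/funext => n; rewrite subrK.
Qed.

Lemma ffact_bounds N d : (0 < N)%N -> (N ^ d <= (N + d - 1) ^_ d <= (N + d) ^ d)%N.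
Proof.
move=> N0; apply/andP; split.
  elim: d => [|d IH]; first by rewrite ffactn0.
  rewrite addnS subn1 /= ffactnS expnS leq_mul// ?leq_addr//.
  by move: IH; rewrite subn1.
have le M : (M ^_ d <= M ^ d)%N.
  elim: d M => [|d IH] M; first by rewrite ffactn0.
  rewrite ffactnS expnS leq_mul//; apply: leq_trans (IH _) _.
  by case: d {IH} => // d; rewrite leq_exp2r// leq_pred.
by apply: leq_trans (le _) _; case: d {le} => // d; rewrite leq_exp2r// leq_subr.
Qed.

(** For [n > 0] the binomial coefficient is the dimension of X; it is compared with its leading term
    [n^(2d) / d!], which links the two normalisations of the limit. *)
Definition bin_ratio d n : R := ('C((n ^ 2 + d - 1)%N, d))%:R * (d`!)%:R / (n%:R ^+ 2) ^+ d.

Lemma bin_ratio_cvg d : bin_ratio d @ \oo --> (1 : R).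
Proof.
have u0 : (fun n => d%:R / n%:R : R) @ \oo --> 0.
  by apply: (@cvg0_invn _ _ d%:R) => n n0; rewrite lexx andbT divr_ge0.
have uc k : (fun n => (1 + d%:R / n%:R : R) ^+ k) @ \oo --> (1 : R).
  elim: k => [|k IH]; first by under eq_fun do rewrite expr0; exact: cvg_cst.
  have H : (fun n => (1 + d%:R / n%:R : R) * (1 + d%:R / n%:R) ^+ k) @ \oo --> ((1 + 0) * 1 : R).
    by apply: cvgM => //; apply: cvgD => //; exact: cvg_cst.
  rewrite addr0 mulr1 in H.
  by under eq_fun do rewrite exprS; exact: H.
apply: (@squeeze_cvgr _ _ _ _ (fun=> 1) (fun n => (1 + d%:R / n%:R : R) ^+ d)); [|exact: cvg_cst|exact: uc].
near=> n.
have n0 : (0 < n)%N by near: n; exact: nbhs_infty_gt.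
have N0 : 0 < n%:R :> R by rewrite ltr0n.
have N1 : 1 <= n%:R :> R by rewrite ler1n.
have n20 : (0 < n ^ 2)%N by rewrite expn_gt0 n0.
have /andP[] := ffact_bounds d n20.
rewrite -bin_ffact -!(ler_nat R) natrM => lo hi.
rewrite /bin_ratio ler_pdivlMr ?exprn_gt0// mul1r ler_pdivrMr ?exprn_gt0//.
move: lo hi; rewrite !natrX natrD natrX => -> /= hi; apply: le_trans hi _.
rewrite -exprMn lerXn2r ?nnegrE ?mulr_ge0 ?addr_ge0 ?divr_ge0 ?exprn_ge0//.
rewrite mulrDl mul1r lerD2l expr2 mulrA divfK ?gt_eqF//.
exact: ler_peMr.
Unshelve. all: by end_near. Qed.

Lemma ER_charsum_sqrt_cvg d :
  (fun n => ER (haar n) (fun g => rnorm (charsum d (g : 'M[C]_n))) *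
     (Num.sqrt ('C((n ^ 2 + d - 1)%N, d))%:R : R)^-1) @ \oo -->
  (Gamma (1 + d%:R / 2 : R) / Num.sqrt (d`!)%:R : R).
Proof.
set S := Num.sqrt (d`!)%:R.
have f0 : 0 < (d`!)%:R :> R by rewrite ltr0n fact_gt0.
have S0 : 0 < S by rewrite sqrtr_gt0.
have H1 : (fun n => (Num.sqrt (bin_ratio d n))^-1) @ \oo --> ((Num.sqrt 1)^-1 : R).
  apply: cvgV; first by rewrite sqrtr1.
  exact: (cvg_comp _ _ (@bin_ratio_cvg d) (@sqrt_continuous R 1)).
have H2 := cvgM (cvgM (@ER_charsum_n_cvg d) (cvg_cst S)) H1.
have E : Gamma (1 + d%:R / 2 : R) / (d`!)%:R * S * (Num.sqrt 1)^-1 = Gamma (1 + d%:R / 2 : R) / S.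
  rewrite sqrtr1 invr1 mulr1 -mulrA; congr (_ * _).
  by rewrite -[X in X^-1 * _](sqr_sqrtr (ltW f0)) -/S; field; rewrite gt_eqF.
rewrite E in H2; apply: cvg_trans (H2 _ _ _); apply: near_eq_cvg; near=> n.
have n0 : (0 < n)%N by near: n; exact: nbhs_infty_gt.
have N0 : 0 < n%:R :> R by rewrite ltr0n.
have sE : Num.sqrt (bin_ratio d n) = Num.sqrt ('C((n ^ 2 + d - 1)%N, d))%:R * S / n%:R ^+ d.
  have {1}-> : bin_ratio d n = (Num.sqrt ('C((n ^ 2 + d - 1)%N, d))%:R * S / n%:R ^+ d) ^+ 2.
    by rewrite /bin_ratio exprAC !exprMn exprVn !sqr_sqrtr ?ler0n.
  by rewrite sqrtr_sqr ger0_norm// divr_ge0 ?mulr_ge0 ?sqrtr_ge0 ?exprn_ge0// ltW.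
have nd : n%:R ^+ d != 0 :> R by rewrite expf_neq0// gt_eqF.
rewrite /= ER_charsum_n sE -!mulrA; congr (_ * _).
set c := Num.sqrt _.
rewrite !invfM invrK [S * _]mulrCA mulVKf; last by rewrite gt_eqF.
by rewrite mulrCA mulVf// mulr1.
Unshelve. all: by end_near. Qed.

End Asymptotics.

Theorem theorem2p23 (R : realType)
    (haar : forall n : nat, probability (mxBorel R n) R)
    (haarP : forall n : nat, is_haar (haar n)) :
  [/\ forall n d : nat,
        (proj_const (hpoly R d n) =
         \int[haar n]_(g in @unitary_group R n)
           (rnorm (\sum_(m : {ffun 'I_d -> 'I_d.+1} | is_partition m)
              (n ^ plength m)%N%:R / (pz m)%:R *
              \prod_(j < d | (j < plength m)%N)
                \tr ((g : 'M[Cplx R]_n) ^+ m j)))%R%:E)%E,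
      forall d : nat,
        (proj_const (hpoly R d n) *
           ((Num.sqrt ('C((n ^ 2 + d - 1)%N, d)%:R : R))^-1)%:E)%E @[n --> \oo]
        --> (Gamma (1 + d%:R / 2 : R) / Num.sqrt (d`!%:R : R))%:E &
      forall d : nat,
        (proj_const (hpoly R d n) * (((n ^ d)%N%:R : R)^-1)%:E)%E @[n --> \oo]
        --> (Gamma (1 + d%:R / 2 : R) / d`!%:R)%:E].
Proof.
split=> [n d|d|d].
- rewrite (proj_constE haarP) -(ERE (haarP n))//.
  by apply: cbm_rnorm; exact: (cbm_charsum haarP).
- under eq_fun do rewrite (proj_constE haarP) -EFinM.
  by apply: cvg_EFin; [exact: nearW|exact: ER_charsum_sqrt_cvg].
- under eq_fun do rewrite (proj_constE haarP) -EFinM natrX -(ER_charsum_n haarP).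
  by apply: cvg_EFin; [exact: nearW|exact: ER_charsum_n_cvg].
Qed.
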